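(* Consider a stochastic processing network as described in the context. Suppose it is synchronized and satisfies Assumption B1: each buffer has exactly one associated activity, i.e. $\mathcal J_i=\{j_i\}$ for all $i\in\mathcal I$; write $\mathcal K_i:=\mathcal K_{j_i}$. For $k\in\mathcal K$ let $\rho^{(k)}=\sum_{i\in\mathcal I:\,k\in\mathcal K_i}\rho_i$ and $m^{(k)}=\sum_{i\in\mathcal I:\,k\in\mathcal K_i}m_i$. If $\rho^{(k)}<\frac{1}{\max_{i\in\mathcal I}|\mathcal K_i|}$ for all $k\in\mathcal K$, then: (1) the $\varepsilon$-LRFS process is queue-length-stable for any $\varepsilon\in\left(0,\ \min_{k\in\mathcal K}\frac{\frac{1}{\max_{i\in\mathcal I}|\mathcal K_i|}-\rho^{(k)}}{m^{(k)}}\right)$; (2) the LRFS process is queue-length-stable if all routes are bounded in length.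
   Context: **Network.** A stochastic processing network has buffers $\mathcal I=\{1,\dots,I\}$, activities $\mathcal J=\{1,\dots,J\}$ and processors $\mathcal K=\{1,\dots,K\}$. Buffers have infinite capacity and hold jobs awaiting service. Activity $j$ processes only jobs from a single buffer $i_j\in\mathcal I$ and requires simultaneous possession of the set $\mathcal K_j\subseteq\mathcal K$ of processors. Let $\mathcal J_i=\{j\in\mathcal J: i_j=i\}$. Buffers $i,\ell$ are *processor-independent* if $\bigcup_{j\in\mathcal J_i}\mathcal K_j$ and $\bigcup_{j\in\mathcal J_\ell}\mathcal K_j$ are disjoint. $Q_i(t)\in\mathbb Z_+$ is the number of jobs waiting in buffer $i$ at time $t$, excluding those being processed. $\sigma(t)=[\sigma_j(t)]\in\{0,1\}^J$ is the vector of activity levels (each activity is fully employed or not employed). **Routing.** After finishing service at buffer $i$, a job joins buffer $\ell$ with probability $P_{i\ell}$ and leaves the network with probability $1-\sum_\ell P_{i\ell}$, independently of everything else; $P=[P_{i\ell}]$, and $\sum_k P^k$ converges. All routes are *bounded* (in length) if $\inf\{d\in\mathbb N:P^d=0\}<\infty$. **Resource allocation.** If $\sigma_j(t)=1$, activity $j$ decreases the remaining service requirement of the job it processes at rate $\beta_j>0$. Service is non-preemptive; multiple activities may not work on the same job simultaneously; each processor has unit capacity: $\sum_{j:k\in\mathcal K_j}\sigma_j(t)\le 1$ for all $k$. **Arrivals.** $A_i(s,t)$ is the number of external arrivals to buffer $i$ in $[s,t)$ (possibly dependent across buffers; there are external arrivals to at least one buffer). Assume $E[A_i(0,t)^2]<\infty$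 for all $t<\infty$ and $\limsup_{t\to\infty}E[A_i(t,t+1)\mid\{A_1(0,s),\dots,A_I(0,s):0\le s\le t\}]<\alpha_i$ for constants $\alpha_i\in(0,\infty)$, in the sense that there is a constant $N<\infty$ such that for all $i$ and $t\ge N$ this conditional expectation is at most $\alpha_i$. With $\alpha=[\alpha_i]$, the effective arrival rate vector is $\lambda=\sum_{k\ge0}(P^T)^k\alpha$. **Service.** Service times are independent, and independent of routing and arrivals; their distribution depends only on the buffer. A generic service time $\Gamma_i$ at buffer $i$ has $E[\Gamma_i]=m_i\in(0,\infty)$ and $E[\Gamma_i^2]<\infty$. The nominal load is $\rho=[\rho_i]$, $\rho_i=\lambda_i m_i$. **Synchronized.** The network is *synchronized* if for all $s,t\ge0$, $i$, $j$: $A_i(s,t)=A_i(s,\lceil t\rceil)$ and $\Gamma_i=m_i=\beta_j=1$ with probability 1; that is, arrivals and service completions occur only at integer times (and remaining service requirements at integer times lie in $\{0,1\}$). **Maximality.** Activity $j$ is maximal in $u\in\{0,1\}^J$ if there is $k\in\mathcal K_j$ with $\sum_{\ell\in\mathcal J:k\in\mathcal K_\ell}u_\ell=1$. For $w\in\mathbb R_+^I$, activity $j$ is maximal in $u$ with respect to $w$ if $w_{i_j}=0$ or $j$ is maximal in $u$; otherwise it is non-maximal. $u$ is maximal with respect to $w$ if all activities are. **Policies.** Each job has a counter, starting at 1 and increased by 1 each time the job is routed to a buffer (including revisited buffers). Fix a partition $\mathcal I=\bigcup_{h=1}^H\mathcal I^{(h)}$ of the buffers into components such that any two buffers in different components are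 processor-independent (routing between components is allowed). Each component has a timer $\mathcal T^{(h)}(t)\in[0,1]$ decreasing at unit rate while positive. Let $Q^{(h)}(t)=[Q_i(t)\mathbf 1\{i\in\mathcal I^{(h)}\}]_{i}$. *LRFS policy.* For each $h$, whenever an arrival and/or service completion occurs at time $t$ in component $\mathcal I^{(h)}$, immediately after all arrivals and completions: (1) find the set $\Sigma$ of non-maximal activities in $\sigma(t)$ with respect to $Q^{(h)}(t)$; (2) find a job with the smallest counter among those in buffers $\{i_j:j\in\Sigma\}$, ties broken arbitrarily; (3) choose an arbitrary activity $j\in\Sigma$ to process that job, setting $\sigma_j(t)=1$; (4) repeat (1)–(3) until $\sigma(t)$ is maximal with respect to $Q^{(h)}(t)$. *$\varepsilon$-LRFS policy.* At the same epochs: (1) find a buffer $i\in\mathcal I^{(h)}$ containing a job with the largest counter among those in buffers $\mathcal I^{(h)}$; (2) find the set $\Sigma\subset\mathcal J_i$ of non-maximal activities in $\sigma(t)$; (3) if $\Sigma\ne\emptyset$ and $\mathcal T^{(h)}(t)=0$: (3-1) with probability $\varepsilon$ choose an arbitrary $j\in\Sigma$ to process the job identified in step (1), setting $\sigma_j(t)=1$, and with probability $1-\varepsilon$ do nothing; (3-2) set $\mathcal T^{(h)}(t)=1$; (4) execute the LRFS policy for component $\mathcal I^{(h)}$. For $\varepsilon=0$ this is LRFS. **Process and stability.** $Q_{i,c}(t)$ is the number of waiting jobs with counter $c$ in buffer $i$; $V_{i,c}^j(t)$ is the remaining service requirement of the job with counter $c$ in buffer $i$ being processed by activity $j$ ($0$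 if there is none). The state is $X(t)=[Q_{i,c}(t),V^j_{i,c}(t),\mathcal T^{(h)}(t)]\in\Omega_X=(\mathbb Z_+^I\times\mathbb R_+^{I\times J})^\infty\times[0,1]^H$, with right-continuous sample paths and $|X(t)|=\sum_{i,c}Q_{i,c}(t)+\sum_{i,c,j}V_{i,c}^j(t)$. Let $\Omega_X^*=\{X\in\Omega_X:|X|<\infty\}$. The process $\{X(t)\}$ under the $\varepsilon$-LRFS (resp. LRFS) policy is the $\varepsilon$-LRFS (resp. LRFS) process. It is *queue-length-stable* if $\limsup_{t\to\infty}\frac1t\int_0^tE[|X(s)|]\,ds<\infty$ for every initial state $X(0)\in\Omega_X^*$.
   Formalization: It is additionally assumed that limsup of E[A_i(t,t+1)^2] is finite for every i; with only E[A_i(0,t)^2] finite for each t the claim fails (batches n^2 with probability 1/(2n^2) at time n). *)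

(* Defs.v *)
From HB Require Import structures.
From mathcomp Require Import all_boot all_order all_algebra.
From mathcomp Require Import all_classical all_reals all_analysis.

Set Implicit Arguments.
Unset Strict Implicit.
Unset Printing Implicit Defensive.

Import Order.TTheory GRing.Theory Num.Theory.
Import numFieldNormedType.Exports.

Local Open Scope classical_set_scope.
Local Open Scope ring_scope.

Record network (R : realType) := Network {
  nbuf : nat;
  nact : nat;
  nproc : nat;
  ncomp : nat;
  buf : 'I_nact -> 'I_nbuf;
  procs : 'I_nact -> {set 'I_nproc};
  routing : 'M[R]_nbuf;
  beta : 'I_nact -> R;
  alpha : 'cV[R]_nbuf;
  service_law : 'I_nbuf -> probability R R;
  (* the partition of the buffers into components, as a labelling *)
  comp : 'I_nbuf -> 'I_ncomp
}.

Section Network.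
Variables (R : realType) (N : network R).
Local Notation B := 'I_(nbuf N).
Local Notation A := 'I_(nact N).
Local Notation K := 'I_(nproc N).
Local Notation H := 'I_(ncomp N).

Definition buffer_acts (i : B) : {set A} := [set j | buf j == i].

Definition buffer_procs (i : B) : {set K} :=
  (\bigcup_(j in buffer_acts i) procs j)%SET.

Definition processor_independent (i l : B) : bool :=
  [disjoint buffer_procs i & buffer_procs l].

Definition mean_service (i : B) : R :=
  fine (\int[service_law i]_x x%:E)%E.

(* Effective arrival rates and nominal loads. *)
Definition eff_rate (i : B) : R :=
  limn (series (fun k => (((routing N)^T ^+ k) *m alpha N) i 0)).

Definition load (i : B) : R := eff_rate i * mean_service i.

Definition bounded_routes : Prop := exists d : nat, routing N ^+ d = 0.

Record network_ok : Prop := NetworkOk {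
  (* no activity could ever be maximal without processors *)
  procs_neq0 : forall j : A, procs j != finset.set0;
  routing_ge0 : forall i l : B, 0 <= routing N i l;
  routing_le1 : forall i : B, \sum_l routing N i l <= 1;
  routing_cvg : forall i l : B,
    cvgn (series (fun k => (routing N ^+ k) i l));
  beta_gt0 : forall j : A, 0 < beta j;
  alpha_gt0 : forall i : B, 0 < alpha N i 0;
  service_gt0 : forall i : B, {ae service_law i, forall x : R, 0 < x};
  service_sqr : forall i : B,
    (\int[service_law i]_x (x ^+ 2)%:E < +oo)%E;
  comp_indep : forall i l : B, comp i != comp l -> processor_independent i l
}.

(* Index c stands for the counter value c.+1. *)
Record state := State {
  Q : B -> nat -> nat;
  V : B -> nat -> A -> R;
  timer : H -> R
}.

Definition in_state_space (x : state) : Prop :=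
  (forall i c j, 0 <= V x i c j) /\ (forall h, 0 <= timer x h <= 1).

Definition state_norm (x : state) : \bar R :=
  (\sum_(i : B) \sum_(0 <= c <oo) (Q x i c)%:R%:E
   + \sum_(i : B) \sum_(j : A) \sum_(0 <= c <oo) (V x i c j)%:E)%E.

Definition queue (x : state) (i : B) : \bar R :=
  (\sum_(0 <= c <oo) (Q x i c)%:R%:E)%E.

Definition comp_queue (h : H) (x : state) (i : B) : \bar R :=
  if comp i == h then queue x i else 0%E.

(* Service times are positive, so the jobs in service are exactly those with
   positive remaining requirement, and the state determines sigma. *)
Definition activity_level (x : state) (j : A) : bool :=
  `[< exists i c, 0 < V x i c j >].

Definition proc_use (u : A -> bool) (k : K) : nat :=
  (\sum_(j | k \in procs j) u j)%N.

Definition maximal (u : A -> bool) (j : A) : bool :=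
  [exists k in procs j, proc_use u k == 1%N].

Definition maximal_wrt (u : A -> bool) (w : B -> \bar R) (j : A) : bool :=
  (w (buf j) == 0%E) || maximal u j.

Definition admissible (x : state) : Prop :=
  [/\ forall i c j, 0 < V x i c j -> i = buf j,
      forall j i c i' c', 0 < V x i c j -> 0 < V x i' c' j ->
        (i, c) = (i', c') &
      forall k, (proc_use (activity_level x) k <= 1)%N].

Section Dynamics.

(* [started] counts, per activity, the services begun in (0, t], [completed]
   those finished in (0, t]; [trials] counts, per component, the randomized
   epsilon-steps. They index the random marks below, so that each mark is used
   exactly once. *)
Record config := Config {
  st : state;
  started : A -> nat;
  completed : A -> nat;
  trials : H -> nat
}.

Definition initial_config (x : state) : config :=
  Config x (fun=> 0%N) (fun=> 0%N) (fun=> 0%N).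

Definition flow (d : R) (z : config) : config :=
  Config
    (State (Q (st z))
       (fun i c j => Num.max 0 (V (st z) i c j - beta j * d))
       (fun h => Num.max 0 (timer (st z) h - d)))
    (started z) (completed z) (trials z).

(* At one sample point: [route j n] is the destination of the n-th job
   completed by activity j (None when it leaves the network), [serv j n] the
   service time of the n-th service started by j, and [coin h n] the outcome of
   the n-th epsilon-step of component h. *)
Variables (route : A -> nat -> option B) (serv : A -> nat -> R).
Variable (coin : H -> nat -> bool).

Definition start (j : A) (c : nat) (z : config) : config :=
  let x := st z in
  Config
    (State
       (fun i c' => if (i == buf j) && (c' == c) then (Q x i c').-1
                    else Q x i c')
       (fun i c' j' => if [&& i == buf j, c' == c & j' == j]
                       then serv j (started z j) else V x i c' j')
       (timer x))
    (fun j' => (started z j' + (j' == j))%N) (completed z) (trials z).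

Definition lrfs_nonmax (h : H) (z : config) (j : A) : bool :=
  ~~ maximal_wrt (activity_level (st z)) (comp_queue h (st z)) j.

Inductive lrfs_run (h : H) : config -> config -> Prop :=
| lrfs_done z of (forall j, ~~ lrfs_nonmax h z j) : lrfs_run h z z
| lrfs_step z j c z' of
    lrfs_nonmax h z j & (0 < Q (st z) (buf j) c)%N &
    (forall j' c', lrfs_nonmax h z j' -> (0 < Q (st z) (buf j') c')%N ->
      (c <= c')%N) &
    lrfs_run h (start j c z) z' : lrfs_run h z z'.

(* i contains a job with counter index c, the largest one in component h *)
Definition largest_counter (h : H) (x : state) (i : B) (c : nat) : Prop :=
  [/\ comp i = h, (0 < Q x i c)%N &
      forall i' c', comp i' = h -> (0 < Q x i' c')%N -> (c' <= c)%N].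

Definition nonmax_act (z : config) (i : B) (j : A) : bool :=
  (j \in buffer_acts i) && ~~ maximal (activity_level (st z)) j.

Definition use_trial (h : H) (z : config) : config :=
  Config
    (State (Q (st z)) (V (st z))
       (fun h' => if h' == h then 1 else timer (st z) h'))
    (started z) (completed z) (fun h' => (trials z h' + (h' == h))%N).

Inductive eps_trial (h : H) : config -> config -> Prop :=
| eps_empty z of (forall i c, comp i = h -> Q (st z) i c = 0%N) :
    eps_trial h z z
| eps_skip z i c of
    largest_counter h (st z) i c &
    (forall j, ~~ nonmax_act z i j) \/ timer (st z) h != 0 :
    eps_trial h z z
| eps_success z i c j of
    largest_counter h (st z) i c & timer (st z) h = 0 & nonmax_act z i j &
    coin h (trials z h) :
    eps_trial h z (use_trial h (start j c z))
| eps_failure z i c j of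
    largest_counter h (st z) i c & timer (st z) h = 0 & nonmax_act z i j &
    ~~ coin h (trials z h) :
    eps_trial h z (use_trial h z).

Definition eps_lrfs_run (h : H) (z z' : config) : Prop :=
  exists2 y, eps_trial h z y & lrfs_run h y z'.

Variable run : H -> config -> config -> Prop.

(* Service completions, d time units after z with no event in between. *)
Definition finishes (z : config) (d : R) (i : B) (c : nat) (j : A) : bool :=
  (0 < V (st z) i c j) && (V (st z) i c j == beta j * d).

Definition act_finishes (z : config) (d : R) (j : A) : bool :=
  `[< exists i c, finishes z d i c j >].

Definition next_buf (z : config) (j : A) : option B := route j (completed z j).

Definition routed (z : config) (d : R) (i : B) (c : nat) : nat :=
  if c is c'.+1 then
    (\sum_(j | next_buf z j == Some i) finishes z d (buf j) c' j)%N
  else 0%N.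

(* The configuration immediately after the completions, the resulting routing
   and [a i] external arrivals at each buffer i, before any decision. *)
Definition pre_decision (a : B -> nat) (z : config) (d : R) : config :=
  let z' := flow d z in
  Config
    (State
       (fun i c => (Q (st z') i c + (if c == 0 then a i else 0)
                    + routed z d i c)%N)
       (V (st z')) (timer (st z')))
    (started z')
    (fun j => (completed z' j + act_finishes z d j)%N)
    (trials z').

(* An external or routed arrival, or a completion, occurs in component h. *)
Definition comp_event (a : B -> nat) (z : config) (d : R) (h : H) : bool :=
  [exists i, (comp i == h) &&
     ((0 < a i)%N ||
      [exists j, act_finishes z d j &&
         ((buf j == i) || (next_buf z j == Some i))])].

(* Components are processor-independent, so the order in which they take their
   decisions is immaterial; they are listed by index. *)
Definition jump (a : B -> nat) (z : config) (d : R) (z' : config) : Prop :=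
  exists y : nat -> config,
    [/\ y 0%N = pre_decision a z d, y (ncomp N) = z' &
        forall h : H, if comp_event a z d h then run h (y h) (y h.+1)
                      else y h.+1 = y h].

(* One sample path; [a i t] is the number of external arrivals to buffer i at
   time t. The path flows on a right neighbourhood of every t >= 0 and on a left
   neighbourhood of every t > 0, and obeys the jump rule at every t > 0 (if
   nothing happens at t, that rule is the flow). In particular it is
   right-continuous with locally finitely many jumps. Z 0 is the configuration
   after whatever happens at time 0. *)
Definition evolves (a : B -> R -> nat) (Z : R -> config) : Prop :=
  [/\ forall t, 0 <= t -> in_state_space (st (Z t)) /\ admissible (st (Z t)),
      forall t, 0 <= t -> exists2 d, 0 < d &
        forall u, t <= u < t + d -> Z u = flow (u - t) (Z t) &
      forall t, 0 < t -> exists s, [/\ 0 <= s < t,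
        (forall u, s <= u < t -> Z u = flow (u - s) (Z s)) &
        jump (a ^~ t) (Z s) (t - s) (Z t)]].

End Dynamics.

Section Stochastic.
Context (d : measure_display) (Om : measurableType d).

Record primitives := Primitives {
  (* external arrivals to a buffer at a given instant *)
  arr : B -> R -> Om -> nat;
  route : A -> nat -> Om -> option B;
  serv : A -> nat -> Om -> R
}.

Variables (P : probability Om R) (W : primitives).

Definition arrivals_in (i : B) (D : set R) (w : Om) : nat :=
  \big[addn/0%N]_(u \in D) arr W i u w.

(* A_i(s,t), the number of external arrivals in [s,t) *)
Definition arrivals (i : B) (s t : R) : Om -> nat :=
  arrivals_in i [set u | s <= u < t].


(* the sigma-algebra of {A_i(0,s) : i, 0 <= s <= t} *)
Definition arrival_history (t : R) : set (set Om) :=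
  <<s [set E | exists i (s : R) (D : set nat),
         0 <= s <= t /\ E = arrivals i 0 s @^-1` D] >>.

(* Z is a version of the conditional expectation E[Y | G]. *)
Definition is_cond_exp (G : set (set Om)) (Y Z : Om -> R) : Prop :=
  [/\ forall D : set R, measurable D -> G (Z @^-1` D),
      P.-integrable setT (EFin \o Z) &
      forall E, G E -> (\int[P]_(w in E) (Z w)%:E = \int[P]_(w in E) (Y w)%:E)%E].

Record primitives_ok : Prop := PrimitivesOk {
  arr_finite : forall i (t : R) w, finite_set [set u | 0 <= u < t /\ arr W i u w <> 0%N];
  arrivals_measurable : forall i (s t : R), 0 <= s -> measurable_fun setT (arrivals i s t);
  arrivals_exist : exists i (t : R), (0 < P [set w | (0 < arrivals i 0 t w)%N])%E;
  arrivals_sqr : forall i (t : R), (\int[P]_w ((arrivals i 0 t w)%:R ^+ 2)%:E < +oo)%E;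
  arrivals_rate : exists t0 : R, forall i (t : R), 0 <= t -> t0 <= t ->
    exists2 Z : Om -> R,
      is_cond_exp (arrival_history t) (fun w => (arrivals i t (t + 1) w)%:R) Z &
      {ae P, forall w, Z w <= alpha N i 0};
  route_measurable : forall j n (o : option B), measurable [set w | route W j n w = o];
  route_law : forall j n (l : B),
    P [set w | route W j n w = Some l] = (routing N (buf j) l)%:E;
  serv_gt0 : forall j n w, 0 < serv W j n w;
  serv_measurable : forall j n, measurable_fun setT (serv W j n);
  serv_law : forall j n (D : set R), measurable D ->
    P (serv W j n @^-1` D) = service_law (buf j) D
}.

Definition synchronized : Prop :=
  [/\ forall (i : B) (s t : R), 0 <= s -> 0 <= t ->
        {ae P, forall w, arrivals i s t w = arrivals i s (Num.ceil t)%:~R w},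
      forall i : B, {ae service_law i, forall x : R, x = 1},
      forall i : B, mean_service i = 1 &
      forall j : A, beta j = 1].

(* Randomness available to a policy: the sigma-algebra [seed] carries the
   randomization used for arbitrary choices, [coin h n] decides the n-th
   epsilon-step of component h. *)
Inductive source :=
| Seed | Arrivals | Route of A & nat | Service of A & nat | Coin of H & nat.

HB.instance Definition _ := gen_eqMixin source.

Section Policy.
Variables (seed : set (set Om)) (coin : H -> nat -> Om -> bool).

Definition source_events (s : source) : set (set Om) :=
  match s with
  | Seed => seed
  | Arrivals => <<s [set E | exists i (t : R) (D : set nat),
                       0 <= t /\ E = arrivals i 0 t @^-1` D] >>
  | Route j n => [set E | exists D : set (option B), E = route W j n @^-1` D]
  | Service j n => [set E | exists2 D : set R, measurable D &
                                               E = serv W j n @^-1` D]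
  | Coin h n => [set E | exists D : set bool, E = coin h n @^-1` D]
  end.

Definition sources_independent : Prop :=
  forall (s : seq source) (E : source -> set Om), uniq s ->
    (forall x, x \in s -> source_events x (E x)) ->
    P (\big[setI/setT]_(x <- s) E x) = (\prod_(x <- s) fine (P (E x)))%:E.

(* Everything revealed by time t when, for each activity j, s j services have
   started and e j have been completed, and n h epsilon-steps have been made in
   each component h. *)
Definition revealed (t : R) (s e : A -> nat) (n : H -> nat) : set (set Om) :=
  <<s [set E | [\/ seed E,
         exists i (u : R) (D : set nat),
           0 <= u <= t /\ E = arrivals_in i [set v | 0 <= v <= u] @^-1` D,
         exists j m, (m < s j)%N /\ source_events (Service j m) E |
         (exists j m, (m < e j)%N /\ source_events (Route j m) E) \/
         (exists h m, (m < n h)%N /\ source_events (Coin h m) E)]] >>.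

Definition state_events (X : Om -> state) : set (set Om) :=
  <<s [set E | [\/ exists i c q, E = [set w | Q (X w) i c = q],
         exists i c j (r : R), E = [set w | V (X w) i c j <= r] |
         exists h (r : R), E = [set w | timer (X w) h <= r]]] >>.

(* The marks used up to time t form a multi-parameter stopping point: neither
   the state at t nor the number of marks used depends on arrivals after t or on
   the routing, service and coin marks not used yet. *)
Definition non_anticipating (Z : R -> Om -> config) : Prop :=
  forall (t : R) s e n E, 0 <= t -> state_events (fun w => st (Z t w)) E ->
    revealed t s e n
      (E `&` [set w | [/\ started (Z t w) = s, completed (Z t w) = e &
                          trials (Z t w) = n]]).

End Policy.

Inductive policy := LRFS | EpsLRFS of R.

Definition policy_run (p : policy) (serv : A -> nat -> R)
    (coin : H -> nat -> bool) : H -> config -> config -> Prop :=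
  match p with
  | LRFS => lrfs_run serv
  | EpsLRFS _ => eps_lrfs_run serv coin
  end.

Definition coin_law (p : policy) (coin : H -> nat -> Om -> bool) : Prop :=
  if p is EpsLRFS eps then
    forall h n, P [set w | coin h n w] = eps%:E
  else True.

(* X is a process governed by policy p, for some tie-breaking, with initial
   state x. The coins play no role under LRFS. *)
Definition policy_process (p : policy) (x : state) (X : R -> Om -> state) :
    Prop :=
  exists (seed : set (set Om)) (coin : H -> nat -> Om -> bool)
         (Z : R -> Om -> config),
  [/\ [/\ sigma_algebra setT seed, seed `<=` measurable &
          forall h n, measurable [set w | coin h n w]],
      coin_law p coin /\ sources_independent seed coin,
      non_anticipating seed coin Z,
      {ae P, forall w,
         Z 0 w = initial_config x /\
         evolves (fun j n => route W j n w)
           (policy_run p (fun j n => serv W j n w) (fun h n => coin h n w))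
           (fun i t => arr W i t w) (Z ^~ w)} &
      X = fun t w => st (Z t w)].

(* In a synchronized network, remaining requirements at integer times are 0 or
   1; for t = 0 this constrains the initial state. *)
Definition synchronized_process (X : R -> Om -> state) : Prop :=
  forall n : nat, {ae P, forall w, forall i c j,
    V (X n%:R w) i c j = 0 \/ V (X n%:R w) i c j = 1}.

Definition queue_length_stable
    (process : state -> (R -> Om -> state) -> Prop) : Prop :=
  forall x, in_state_space x -> (state_norm x < +oo)%E ->
  forall X, process x X ->
  (limf_esup (fun t : R =>
     (t^-1)%:E * \int[lebesgue_measure]_(s in `[0%R, t])
                   \int[P]_w state_norm (X s w)) (pinfty_nbhs R) < +oo)%E.

(* limsup_{t -> oo} E[A_i(t,t+1)^2] < oo. Finiteness of each E[A_i(0,t)^2] alone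
   (arrivals_sqr) does not give stability: batches of size n^2 arriving at time n
   with probability 1/(2 n^2) have rate 1/2, but the mean queue length of a
   single unit-rate server fed by them grows linearly. *)
Definition arrivals_sqr_limsup : Prop :=
  exists C t0 : R, forall (i : B) (t : R), 0 <= t -> t0 <= t ->
    (\int[P]_w ((arrivals i t (t + 1) w)%:R ^+ 2)%:E <= C%:E)%E.

End Stochastic.
End Network.

(* Main.v *)
(** At integer times let T be the numbers of jobs present and B those in
    service, per buffer and counter index. For weights g that solve
    g i c = s i c + \sum_l p i l * g l (c+1), the routing of a completed job
    replaces its weight by the expected weight after routing, so the potential
    Phi = \sum g T loses \sum s B and gains \sum alpha_i g i 0 per step in
    conditional mean, with bounded second moments: its square has drift at most
    2 Phi (\sum alpha_i g i 0 - \sum s B) + K.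

    Low counters, by induction on c: for a processor k let s be the indicator
    of the buffers that need k and of the counter indices up to c. Then the
    gain is at most rho^(k). The drift of \sum_k Phi_k^2 is negative, because,
    unless the epsilon-coin succeeds, a waiting job of buffer i with counter
    index at most c entails that some processor of i serves such a job, while
    \sum_(k in K_i) rho^(k) + epsilon < 1.

    High counters: for s the indicator of the indices from c0 on, the gain is
    the mean work that a new job brings beyond c0, which tends to 0 as c0 grows;
    the epsilon-step serves such jobs at rate epsilon, which exceeds the gain
    for c0 large. For bounded routes the gain vanishes outright. *)

Require Import Defs.
From mathcomp Require Import all_boot all_order all_algebra.
From mathcomp Require Import all_classical all_reals all_analysis.
From mathcomp Require Import measurable_realfun.
From mathcomp Require Import ring lra zify.

Set Implicit Arguments.
Unset Strict Implicit.
Unset Printing Implicit Defensive.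

Import Order.TTheory GRing.Theory Num.Theory.
Import numFieldNormedType.Exports.

Local Open Scope classical_set_scope.
Local Open Scope ring_scope.

(** * Expectations *)

(** The load condition enters only through the sum over the processors of one buffer: there are at
    most max|K_i| of them, and on each of them rho^(k) + epsilon stays below 1/max|K_i|. The drift
    needs the mean of arrivals and routing given all that shaped the current state, while the
    hypotheses give a rate given the arrival history alone, and marks indexed by random counts.
    Conditional bounds are therefore inequalities between integrals over the sets of a
    sigma-algebra. Independent sources are joined to the arrival history by a pi-lambda argument.
    Events are cut along the countably many values of the counts: on each piece the next mark is a
    fixed one, still fresh. Two obstacles shape the drift. The coin is tossed after the arrivals
    that end a slot, so it is weighed against the jobs of the next slot, known before the toss. And
    a component decides only when an event occurs in it, so initial jobs may wait untouched forever;
    this costs a constant, since a buffer in that situation holds no more than its initial jobs. The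
    drift inequalities are telescoped in time, which bounds time averages without any recurrence
    argument. *)

Section Expectation.
Context (R : realType) (d : measure_display) (Om : measurableType d).
Variable P : probability Om R.
Implicit Types f g : Om -> R.

Definition L1 f := P.-integrable setT (EFin \o f).

Definition L2 f := measurable_fun setT f /\ L1 (fun w => f w ^+ 2).

Local Notation EE f := (\int[P]_w f w)%R.

Lemma L1_measurable f : L1 f -> measurable_fun setT f.
Proof. by case/integrableP => /measurable_EFinP. Qed.

Lemma L1_cst (c : R) : L1 (fun=> c).
Proof. exact: finite_measure_integrable_cst. Qed.

Lemma L1D f g : L1 f -> L1 g -> L1 (fun w => f w + g w).
Proof. by move=> hf hg; exact: (integrableD measurableT hf hg). Qed.

Lemma L1Z (c : R) f : L1 f -> L1 (fun w => c * f w).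
Proof. by move=> hf; exact: (integrableZl measurableT c hf). Qed.

Lemma L1N f : L1 f -> L1 (fun w => - f w).
Proof. by move=> hf; exact: (integrableN hf). Qed.

Lemma L1B f g : L1 f -> L1 g -> L1 (fun w => f w - g w).
Proof. by move=> hf /L1N; exact: L1D. Qed.

Lemma L1_sum I (r : seq I) (p : pred I) (F : I -> Om -> R) :
  (forall i, p i -> L1 (F i)) -> L1 (fun w => \sum_(i <- r | p i) F i w).
Proof.
move=> hF; elim: r => [|i r IH].
  have -> : (fun w => \sum_(i <- [::] | p i) F i w) = fun=> 0.
    by apply/funext => w; rewrite big_nil.
  exact: L1_cst.
have -> : (fun w => \sum_(j <- i :: r | p j) F j w) =
    fun w => (if p i then F i w else 0) + \sum_(j <- r | p j) F j w.
  by apply/funext => w; rewrite big_cons; case: (p i); rewrite ?add0r.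
by apply: L1D => //; case: (boolP (p i)) => [/hF|_] //; exact: L1_cst.
Qed.

Lemma L1_dom f g : measurable_fun setT f -> L1 g ->
  {ae P, forall w, `|f w| <= g w} -> L1 f.
Proof.
move=> mf hg fg; apply/integrableP; split; first exact/measurable_EFinP.
have /integrableP[mg goo] := hg.
apply: le_lt_trans goo; apply: ae_ge0_le_integral => //.
- by apply: measurableT_comp => //; exact/measurable_EFinP.
- exact: measurableT_comp.
- apply: filterS fg => w fgw _ /=; rewrite lee_fin.
  by rewrite (le_trans fgw)// ler_norm.
Qed.

Lemma EED f g : L1 f -> L1 g -> EE (fun w => f w + g w) = EE f + EE g.
Proof. by move=> hf hg; rewrite RintegralD. Qed.

Lemma EEB f g : L1 f -> L1 g -> EE (fun w => f w - g w) = EE f - EE g.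
Proof. by move=> hf hg; rewrite RintegralB. Qed.

Lemma EEZ (c : R) f : L1 f -> EE (fun w => c * f w) = c * EE f.
Proof. by move=> hf; rewrite RintegralZl. Qed.

Lemma EE_cst (c : R) : EE (fun=> c) = c.
Proof. by rewrite Rintegral_cst//= probability_setT mulr1. Qed.

Lemma EE_ge0 f : (forall w, 0 <= f w) -> 0 <= EE f.
Proof. by move=> f0; apply: Rintegral_ge0 => w _. Qed.

Lemma EE_sum I (r : seq I) (p : pred I) (F : I -> Om -> R) :
  (forall i, p i -> L1 (F i)) ->
  EE (fun w => \sum_(i <- r | p i) F i w) = \sum_(i <- r | p i) EE (F i).
Proof.
move=> hF; elim: r => [|i r IH].
  have -> : (fun w => \sum_(i <- [::] | p i) F i w) = fun=> 0.
    by apply/funext => w; rewrite big_nil.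
  by rewrite EE_cst big_nil.
rewrite big_cons -IH; case: (boolP (p i)) => [pi|npi].
  rewrite -EED; [|exact: hF|exact: L1_sum].
  by congr Rintegral; apply/funext => w; rewrite big_cons pi.
by congr Rintegral; apply/funext => w; rewrite big_cons (negbTE npi).
Qed.

Lemma EE_le f g : L1 f -> L1 g -> {ae P, forall w, f w <= g w} -> EE f <= EE g.
Proof.
move=> hf hg fg; rewrite -subr_ge0 -EEB//.
set h := fun w => _.
have hh : L1 h by exact: L1B.
(* The inequality holds only almost everywhere; the absolute value replaces [h] by a function that
   is nonnegative everywhere. *)
suff -> : EE h = EE (fun w => `|h w|) by exact: EE_ge0.
congr fine; apply: ae_eq_integral => //.
- by apply/measurable_EFinP; exact: L1_measurable.
- apply/measurable_EFinP; apply: measurableT_comp => //; exact: L1_measurable.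
- by apply: filterS fg => w fgw _ /=; rewrite ger0_norm// /h subr_ge0.
Qed.

Lemma EFin_EE f : L1 f -> (EE f)%:E = (\int[P]_w (f w)%:E)%E.
Proof. by move=> hf; rewrite /Rintegral fineK//; exact: integrable_fin_num. Qed.

Lemma L2_cst (c : R) : L2 (fun=> c).
Proof. by split; [exact: measurable_cst | exact: L1_cst]. Qed.

Lemma L2_dom f g : measurable_fun setT f -> L2 g ->
  {ae P, forall w, `|f w| <= g w} -> L2 f.
Proof.
move=> mf [mg hg] fg; split=> //; apply: (L1_dom _ hg).
  exact: measurable_funX.
apply: filterS fg => w fgw; rewrite normrX lerXn2r ?nnegrE//.
exact: le_trans fgw.
Qed.

Lemma L2D f g : L2 f -> L2 g -> L2 (fun w => f w + g w).
Proof.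
move=> [mf hf] [mg hg]; split; first exact: measurable_funD.
apply: (@L1_dom _ (fun w => 2 * f w ^+ 2 + 2 * g w ^+ 2)).
- by apply: measurable_funX; exact: measurable_funD.
- by apply: L1D; exact: L1Z.
- apply/aeW => w; rewrite ger0_norm ?sqr_ge0//.
  by have := sqr_ge0 (f w - g w); nra.
Qed.

Lemma L2Z (c : R) f : L2 f -> L2 (fun w => c * f w).
Proof.
move=> [mf hf]; split; first exact: measurable_funM.
have -> : (fun w => (c * f w) ^+ 2) = fun w => c ^+ 2 * f w ^+ 2.
  by apply/funext => w; rewrite exprMn.
exact: L1Z.
Qed.

Lemma L2_sum I (r : seq I) (p : pred I) (F : I -> Om -> R) :
  (forall i, p i -> L2 (F i)) -> L2 (fun w => \sum_(i <- r | p i) F i w).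
Proof.
move=> hF; elim: r => [|i r IH].
  have -> : (fun w => \sum_(i <- [::] | p i) F i w) = fun=> 0.
    by apply/funext => w; rewrite big_nil.
  exact: L2_cst.
have -> : (fun w => \sum_(j <- i :: r | p j) F j w) =
    fun w => (if p i then F i w else 0) + \sum_(j <- r | p j) F j w.
  by apply/funext => w; rewrite big_cons; case: (p i); rewrite ?add0r.
by apply: L2D => //; case: (boolP (p i)) => [/hF|_] //; exact: L2_cst.
Qed.

Lemma L2_L1 f : L2 f -> L1 f.
Proof.
move=> [mf hf]; apply: (@L1_dom _ (fun w => 1 + f w ^+ 2)) => //.
  by apply: L1D => //; exact: L1_cst.
apply/aeW => w; rewrite -(real_normK (num_real (f w))).
by have := sqr_ge0 (`|f w| - 1); have := normr_ge0 (f w); nra.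
Qed.

Lemma L2M f g : L2 f -> L2 g -> L1 (fun w => f w * g w).
Proof.
move=> [mf hf] [mg hg].
apply: (@L1_dom _ (fun w => f w ^+ 2 + g w ^+ 2)).
- exact: measurable_funM.
- exact: L1D.
- apply/aeW => w; rewrite ler_norml.
  have := sqr_ge0 (f w - g w); have := sqr_ge0 (f w + g w) => h1 h2.
  by apply/andP; split; nra.
Qed.

(* A bound on the conditional expectation of [A] given [G], stated without
   conditional expectations. *)
Definition cdom (G : set (set Om)) (A : Om -> R) (c : R) :=
  forall F, G F -> (\int[P]_(w in F) (A w)%:E <= c%:E * P F)%E.

(** All subsets [D] are allowed, since the variables in question take countably many values. *)
Definition adapted (G : set (set Om)) (T : Type) (f : Om -> T) :=
  forall D : set T, G (f @^-1` D).

Lemma adapted_comp G (T U : Type) (h : T -> U) (f : Om -> T) :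
  adapted G f -> adapted G (fun w => h (f w)).
Proof. by move=> hf D; exact: (hf (h @^-1` D)). Qed.

End Expectation.

(** * Discrete variables adapted to a sub-sigma-algebra *)

Section SigmaAlgebra.
Context (d : measure_display) (Om : measurableType d) (G : set (set Om)).
Hypothesis sG : sigma_algebra setT G.

Lemma sigma_algebra_setC A : G A -> G (~` A).
Proof. by case: sG => _ GC _ /GC; rewrite setTD. Qed.

Lemma sigma_algebra_setT : G setT.
Proof. by rewrite -setC0; apply: sigma_algebra_setC; case: sG. Qed.

Lemma sigma_algebra_setI A B : G A -> G B -> G (A `&` B).
Proof.
move=> GA GB; have e := measurable_g_measurableTypeE sG.
have mA : G.-sigma.-measurable A by rewrite e.
have mB : G.-sigma.-measurable B by rewrite e.
have : G.-sigma.-measurable (A `&` B) by exact: measurableI.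
by rewrite e.
Qed.

Lemma sigma_algebra_setD A B : G A -> G B -> G (A `\` B).
Proof. by move=> GA /sigma_algebra_setC GB; exact: sigma_algebra_setI. Qed.

Lemma sigma_algebra_countable_bigcup (T : Type) (F : T -> set Om) :
  countable [set: T] -> (forall t, G (F t)) -> G (\bigcup_t F t).
Proof.
move=> cT GF; have e := measurable_g_measurableTypeE sG.
have mF t : G.-sigma.-measurable (F t) by rewrite e.
have : G.-sigma.-measurable (\bigcup_t F t) by exact: countable_bigcupT_measurable.
by rewrite e.
Qed.

Lemma adapted_points (T : Type) (f : Om -> T) : countable [set: T] ->
  (forall t, G (f @^-1` [set t])) -> adapted G f.
Proof.
move=> cT hf D.
have -> : f @^-1` D = \bigcup_t (if `[< D t >] then f @^-1` [set t] else set0).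
  apply/seteqP; split=> [w Dw|w [t _]]; first by exists (f w) => //; rewrite asboolT.
  by case: asboolP => //= Dt ft; rewrite /preimage/= ft.
apply: sigma_algebra_countable_bigcup => // t.
by case: asboolP => // _; case: sG.
Qed.

Lemma adapted2 (T U V : Type) (h : T -> U -> V) (f : Om -> T) (g : Om -> U) :
  countable [set: T] -> countable [set: U] ->
  adapted G f -> adapted G g -> adapted G (fun w => h (f w) (g w)).
Proof.
move=> cT cU hf hg D.
have -> : (fun w => h (f w) (g w)) @^-1` D =
    \bigcup_t (f @^-1` [set t] `&` g @^-1` (h t @^-1` D)).
  by apply/seteqP; split=> [w Dw|w [t _ [<-]]]//; exists (f w).
apply: sigma_algebra_countable_bigcup => // t.
by apply: sigma_algebra_setI; [exact: hf | exact: hg].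
Qed.

Lemma adapted_cst (T : Type) (c : T) : adapted G (fun=> c).
Proof.
move=> D; rewrite preimage_cst; case: ifP => _; first exact: sigma_algebra_setT.
by case: sG.
Qed.

Lemma adapted_sum I (r : seq I) (p : pred I) (F : I -> Om -> nat) :
  (forall i, p i -> adapted G (F i)) ->
  adapted G (fun w => \sum_(i <- r | p i) F i w)%N.
Proof.
move=> hF; elim: r => [|i r IH].
  have -> : (fun w => \sum_(i <- [::] | p i) F i w)%N = fun=> 0%N.
    by apply/funext => w; rewrite big_nil.
  exact: adapted_cst.
have -> : (fun w => \sum_(j <- i :: r | p j) F j w)%N =
    fun w => ((if p i then F i w else 0) + \sum_(j <- r | p j) F j w)%N.
  by apply/funext => w; rewrite big_cons; case: (p i); rewrite ?add0n.
apply: (adapted2 addn) => //.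
by case: (boolP (p i)) => [/hF|_] //; exact: adapted_cst.
Qed.

End SigmaAlgebra.

(** * Conditional bounds against adapted integer weights *)

Section Cdom.
Context (R : realType) (d : measure_display) (Om : measurableType d).
Variable P : probability Om R.

Lemma adapted_measurable (f : Om -> nat) : adapted (@measurable _ Om) f ->
  measurable_fun setT (fun w => (f w)%:R : R).
Proof.
move=> hf _ Y _; rewrite setTI.
exact: (hf ((fun n : nat => n%:R : R) @^-1` Y)).
Qed.

(** The layer-cake form of an integer factor. It turns the mean of a product with [Y] into a series
    of integrals over the sets where [q < Y], the only objects that [cdom] bounds. *)
Lemma natr_nneseries (n : nat) (x : R) : 0 <= x ->
  ((n%:R * x)%:E = \sum_(0 <= q <oo) ((q < n)%:R * x)%:E)%E.
Proof.
move=> x0; apply/esym/cvg_lim => //.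
have h m : (n <= m)%N -> (\sum_(0 <= q < m) ((q < n)%:R * x)%:E = (n%:R * x)%:E)%E.
  move=> nm; rewrite sumEFin -mulr_suml; congr (_ * _)%:E.
  rewrite (big_cat_nat _ (n := n))//= [X in _ + X]big_nat [X in _ + X]big1 ?addr0; last first.
    by move=> i /andP[ni _]; rewrite ltnNge ni.
  rewrite big_nat (eq_bigr (fun=> 1)); last by move=> i /andP[_ ->].
  by rewrite -big_nat sumr_const_nat subn0.
apply: cvg_near_cst; exists n => // m /= nm; exact: h.
Qed.

Lemma cdom_mul (G : set (set Om)) (A : Om -> R) (c : R) (Y : Om -> nat) :
  G `<=` measurable -> adapted G Y -> cdom P G A c ->
  (forall w, 0 <= A w) -> 0 <= c -> L1 P (fun w => (Y w)%:R) ->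
  L1 P (fun w => (Y w)%:R * A w) -> measurable_fun setT A ->
  \int[P]_w ((Y w)%:R * A w) <= c * \int[P]_w (Y w)%:R.
Proof.
move=> GM aY hA A0 c0 h1 h2 mA.
have mY q : measurable [set w | (q < Y w)%N].
  by apply: GM; exact: (aY [set n | (q < n)%N]).
have mq q : measurable_fun setT (fun w => (q < Y w)%:R : R).
  apply: (@adapted_measurable (fun w => (q < Y w)%N : nat)) => D.
  by apply: GM; exact: (aY [set n | D (q < n)%N]).
rewrite -lee_fin EFinM !EFin_EE//.
have -> : (\int[P]_w ((Y w)%:R * A w)%:E =
    \int[P]_w \sum_(0 <= q <oo) ((q < Y w)%:R * A w)%:E)%E.
  by apply: eq_integral => w _; exact: natr_nneseries.
have -> : (\int[P]_w ((Y w)%:R)%:E =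
    \int[P]_w \sum_(0 <= q <oo) ((q < Y w)%:R * 1)%:E)%E.
  by apply: eq_integral => w _; rewrite -natr_nneseries// mulr1.
have mf (Z : Om -> R) q : measurable_fun setT Z ->
    measurable_fun setT (fun w => ((q < Y w)%:R * Z w)%:E).
  by move=> mZ; apply/measurable_EFinP; exact: measurable_funM.
have f0 (Z : Om -> R) q w : (forall w, 0 <= Z w) -> (0 <= ((q < Y w)%:R * Z w)%:E)%E.
  by move=> Z0; rewrite lee_fin mulr_ge0.
rewrite integral_nneseries//; [|by move=> q; exact: mf|by move=> q w _; exact: f0].
rewrite integral_nneseries//; last by move=> q; apply: (mf (fun=> 1)).
rewrite -nneseriesZl; last by move=> q _; apply: integral_ge0 => w _; rewrite lee_fin mulr1.
apply: lee_nneseries => q _.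
  by move=> _; apply: integral_ge0 => w _; rewrite lee_fin mulr_ge0.
have -> : (\int[P]_w ((q < Y w)%:R * 1)%:E = P [set w | (q < Y w)%N])%E.
  rewrite -[X in _ = P X]setIT -integral_indic//; apply: eq_integral => w _.
  rewrite mulr1 indicE.
  by have -> : (w \in [set w | (q < Y w)%N]) = (q < Y w)%N by apply/idP/idP; rewrite inE.
apply: le_trans (hA _ (aY [set n | (q < n)%N])).
rewrite [leRHS]integral_mkcond le_eqVlt; apply/orP; left; apply/eqP.
apply: eq_integral => w _; rewrite patchE; case: ifPn.
  by rewrite inE /= => ->; rewrite mul1r.
by rewrite notin_setE /= => /negP/negbTE ->; rewrite mul0r.
Qed.

End Cdom.

(** * Sequences with bounded time averages *)

Section AvgBounded.
Context (R : realType).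
Implicit Types e f : nat -> R.

(** The summand 1 absorbs additive constants, even at [M = 0]. *)
Definition avg_bounded e := exists K : R, forall M, \sum_(n < M) e n <= K * (M%:R + 1).

Lemma avg_bounded_cst (c : R) : 0 <= c -> avg_bounded (fun=> c).
Proof.
by move=> c0; exists c => M; rewrite sumr_const card_ord -[c *+ M]mulr_natr ler_wpM2l// lerDl.
Qed.

Lemma avg_boundedD e f : avg_bounded e -> avg_bounded f ->
  avg_bounded (fun n => e n + f n).
Proof.
move=> [K hK] [L hL]; exists (K + L) => M.
by rewrite big_split mulrDl lerD.
Qed.

Lemma avg_boundedZ (c : R) e : 0 <= c -> avg_bounded e ->
  avg_bounded (fun n => c * e n).
Proof.
by move=> c0 [K hK]; exists (c * K) => M; rewrite -mulr_sumr -mulrA ler_wpM2l.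
Qed.

Lemma le_avg_bounded e f : (forall n, e n <= f n) -> avg_bounded f -> avg_bounded e.
Proof.
by move=> ef [K hK]; exists K => M; apply: le_trans (hK M); exact: ler_sum.
Qed.

Lemma eq_avg_bounded e f : (forall n, f n = e n) -> avg_bounded e -> avg_bounded f.
Proof. by move=> ef; apply: le_avg_bounded => n; rewrite ef. Qed.

(** A Foster-Lyapunov inequality summed over time: [l] telescopes, and whatever happens before [n1]
    only adds a constant. *)
Lemma avg_bounded_drift (l e f : nat -> R) (del : R) n1 : 0 < del ->
  (forall n, 0 <= l n) -> (forall n, 0 <= e n) -> (forall n, 0 <= f n) ->
  avg_bounded f ->
  (forall n, (n1 <= n)%N -> l n.+1 + del * e n <= l n + f n) ->
  avg_bounded e.
Proof.
move=> del0 l0 e0 f0 [K hK] hd.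
have f1 m : 0 <= \sum_(n < m) f n by exact: sumr_ge0.
have e1 m : 0 <= \sum_(n < m) e n by exact: sumr_ge0.
have K0 : 0 <= K by have := hK 0%N; rewrite big_ord0 add0r mulr1.
have h m : del * \sum_(n < n1 + m) e n + l (n1 + m)%N <=
    l n1 + del * \sum_(n < n1) e n + \sum_(n < n1 + m) f n.
  elim: m => [|m IH]; first by rewrite addn0; have := f1 n1; lra.
  rewrite addnS !big_ord_recr/=.
  by have := hd _ (leq_addr m n1); lra.
pose K1 := (l n1 + del * \sum_(n < n1) e n) / del.
have K10 : 0 <= K1 by rewrite divr_ge0 ?(ltW del0)// addr_ge0// mulr_ge0 ?(ltW del0).
exists (K1 + del^-1 * K * (n1%:R + 1)) => M.
have {}h : del * \sum_(n < n1 + M) e n <= del * (K1 + del^-1 * K * (n1%:R + M%:R + 1)).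
  have -> : del * (K1 + del^-1 * K * (n1%:R + M%:R + 1)) =
      l n1 + del * \sum_(n < n1) e n + K * (n1%:R + M%:R + 1).
    by rewrite /K1; field; rewrite gt_eqF.
  by have := h M; have := hK (n1 + M)%N; rewrite natrD; have := l0 (n1 + M)%N; lra.
rewrite ler_pM2l// in h.
have : \sum_(n < M) e n <= \sum_(n < n1 + M) e n.
  by rewrite [in leRHS]addnC big_split_ord/= lerDl sumr_ge0.
have ki0 : 0 <= del^-1 * K by rewrite mulr_ge0// invr_ge0 ltW.
have M0 : 0 <= M%:R :> R by []; have n10 : 0 <= n1%:R :> R by [].
have := mulr_ge0 K10 M0; have := mulr_ge0 ki0 (mulr_ge0 n10 M0).
move: (del^-1 * K) h ki0 => dk h ki0 h1 h2 hM; apply: le_trans hM _; nra.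
Qed.

End AvgBounded.

(** * Drift estimates *)

Section Model.
Context (R : realType) (d : measure_display) (Om : measurableType d).
Variable P : probability Om R.
Variables (I : finType) (p : I -> I -> R) (al : I -> R) (cI n0 : nat) (Ca : R).
Variables (T B : nat -> I -> nat -> Om -> nat) (a : nat -> I -> Om -> nat).
Variable J : nat -> I -> I -> Om -> nat.
Variable F : nat -> set (set Om).
(* In slot [n], buffer [i] holds [T n i c] jobs with counter index [c], waiting
   or in service, [B n i c] of them in service; [a n i] new jobs arrive at its
   end, and a job of buffer [i] completed then moves to [l] if [J n i l] is 1.
   [F n] is the information available in slot [n]. *)
Hypothesis p_ge0 : forall i l, 0 <= p i l.
Hypothesis al_ge0 : forall i, 0 <= al i.
Hypothesis sF : forall n, sigma_algebra setT (F n).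
Hypothesis FM : forall n, F n `<=` measurable.
Hypothesis aT : forall n i c, adapted (F n) (T n i c).
Hypothesis aB : forall n i c, adapted (F n) (B n i c).
Hypothesis mJ : forall n i l, measurable_fun setT (fun w => (J n i l w)%:R : R).
Hypothesis T0 : forall i c, L2 P (fun w => (T 0 i c w)%:R).
Hypothesis dyn : forall n, {ae P, forall w, forall i c,
  (T n.+1 i c w + B n i c w =
   T n i c w + (if c is c'.+1 then \sum_j B n j c' w * J n j i w else a n i w))%N}.
Hypothesis cut : forall n, {ae P, forall w, forall i c,
  (cI + n <= c)%N -> T n i c w = 0%N}.
Hypothesis BT : forall n, {ae P, forall w, forall i c, (B n i c w <= T n i c w)%N}.
Hypothesis B1 : forall n, {ae P, forall w, forall i,
  (\sum_(c < cI + n) B n i c w <= 1)%N}.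
Hypothesis J1 : forall n, {ae P, forall w, forall i, (\sum_l J n i l w <= 1)%N}.
Hypothesis aL2 : forall n i, L2 P (fun w => (a n i w)%:R).
Hypothesis route : forall n i l, cdom P (F n) (fun w => (J n i l w)%:R) (p i l).
Hypothesis arr : forall n i, (n0 <= n)%N ->
  cdom P (F n) (fun w => (a n i w)%:R) (al i).
Hypothesis aCa : forall n i, (n0 <= n)%N -> \int[P]_w ((a n i w)%:R ^+ 2) <= Ca.

(** By [cut], almost surely no job has a counter index from [cI + n] on, so the finite range misses
    nothing. *)
Definition potential (g : I -> nat -> R) n w : R :=
  \sum_i \sum_(c < cI + n) g i c * (T n i c w)%:R.

Definition outflow (g : I -> nat -> R) n w : R :=
  \sum_i \sum_(c < cI + n) g i c * (B n i c w)%:R.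

Definition inflow (g : I -> nat -> R) n w : R :=
  \sum_i (g i 0%N * (a n i w)%:R +
    \sum_(c < cI + n) \sum_l g l c.+1 * ((B n i c w)%:R * (J n i l w)%:R)).

(** The mean weight of a job after its completion; a job that leaves weighs 0. *)
Definition routed_potential (g : I -> nat -> R) i c : R := \sum_l p i l * g l c.+1.

Lemma potential_step g n : {ae P, forall w,
  potential g n.+1 w = potential g n w + inflow g n w - outflow g n w}.
Proof.
have := dyn n; have := cut n; have := BT n.
apply: filterS3 => w hB hc hd.
rewrite /potential /inflow /outflow.
have e i c : (T n.+1 i c w)%:R = (T n i c w)%:R - (B n i c w)%:R +
    (if c is c'.+1 then \sum_j (B n j c' w)%:R * (J n j i w)%:R else (a n i w)%:R) :> R.
  have /(congr1 (fun m => m%:R : R)) := hd i c; rewrite !natrD.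
  case: c => [|c] h.
    by rewrite -[LHS](addrK (B n i 0%N w)%:R) h; ring.
  rewrite -[LHS](addrK (B n i c.+1 w)%:R) h natr_sum.
  by under eq_bigr do rewrite natrM; ring.
transitivity (\sum_i (\sum_(c < cI + n) g i c * ((T n i c w)%:R - (B n i c w)%:R) +
   (g i 0%N * (a n i w)%:R +
    \sum_(c < cI + n) g i c.+1 * \sum_j (B n j c w)%:R * (J n j i w)%:R))).
  apply: eq_bigr => i _; rewrite addnS.
  rewrite (eq_bigr (fun c : 'I_(cI + n).+1 =>
    g i c * ((T n i c w)%:R - (B n i c w)%:R) +
    g i c * (if c : nat is c'.+1 then \sum_j (B n j c' w)%:R * (J n j i w)%:R
             else (a n i w)%:R))); last by move=> c _; rewrite e mulrDr.
  rewrite big_split /= big_ord_recr /= [X in _ + X]big_ord_recl /=.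
  (* The range at [n.+1] is longer by the index [cI + n], at which slot [n] has neither jobs nor
     services. *)
  have t0 : T n i (cI + n)%N w = 0%N by exact: hc.
  have b0 : B n i (cI + n)%N w = 0%N by apply/eqP; rewrite -leqn0 -t0 hB.
  by rewrite t0 b0 subrr mulr0 addr0.
rewrite big_split /= big_split /= big_split /= addrAC [in RHS]addrA.
rewrite -sumrB.
have -> : \sum_i (\sum_(c < cI + n) g i c * (T n i c w)%:R -
      \sum_(c < cI + n) g i c * (B n i c w)%:R) =
    \sum_i \sum_(c < cI + n) g i c * ((T n i c w)%:R - (B n i c w)%:R).
  apply: eq_bigr => i _; rewrite -sumrB; apply: eq_bigr => c _; exact: esym (mulrBr _ _ _).
rewrite -!addrA; congr (_ + _); congr (_ + _).
transitivity (\sum_i \sum_(c < cI + n) \sum_j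
    g i c.+1 * ((B n j c w)%:R * (J n j i w)%:R)).
  by apply: eq_bigr => i _; apply: eq_bigr => c _; rewrite mulr_sumr.
rewrite exchange_big [RHS]exchange_big /=; apply: eq_bigr => c _.
exact: exchange_big.
Qed.

Lemma B_le1 n : {ae P, forall w, forall i c, (B n i c w <= 1)%N}.
Proof.
have := B1 n; have := BT n; have := cut n.
apply: filterS3 => w hc hBT hB i c.
have [cn|cn] := ltnP c (cI + n); last by rewrite (leq_trans (hBT _ _))// hc.
by apply: leq_trans (hB i); rewrite (bigD1 (Ordinal cn))//= leq_addr.
Qed.

Lemma J_le1 n : {ae P, forall w, forall i l, (J n i l w <= 1)%N}.
Proof.
have := J1 n; apply: filterS => w hJ i l.
by apply: leq_trans (hJ i); rewrite (bigD1 l)//= leq_addr.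
Qed.

Lemma measurable_T n i c : measurable_fun setT (fun w => (T n i c w)%:R : R).
Proof. by apply: adapted_measurable => D; apply: FM; exact: aT. Qed.

Lemma measurable_B n i c : measurable_fun setT (fun w => (B n i c w)%:R : R).
Proof. by apply: adapted_measurable => D; apply: FM; exact: aB. Qed.

Lemma L2_B n i c : L2 P (fun w => (B n i c w)%:R).
Proof.
apply: (L2_dom (measurable_B _ _ _) (L2_cst P 1)).
by apply: filterS (B_le1 n) => w hB; rewrite ger0_norm// lern1.
Qed.

Lemma L2_BJ n i c l : L2 P (fun w => (B n i c w)%:R * (J n i l w)%:R).
Proof.
apply: (L2_dom _ (L2_cst P 1)).
  by apply: measurable_funM => //; exact: measurable_B.
have := B_le1 n; have := J_le1 n; apply: filterS2 => w hJ hB.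
by rewrite ger0_norm ?mulr_ge0// mulr_ile1// lern1.
Qed.

(** A buffer gains in one slot at most its arrivals and one routed job from each buffer. *)
Lemma L2_T n i c : L2 P (fun w => (T n i c w)%:R).
Proof.
elim: n i c => [|n IH] i c; first exact: T0.
apply: (@L2_dom _ _ _ _ _ (fun w => (T n i c w)%:R + ((a n i w)%:R + #|I|%:R))).
- exact: measurable_T.
- by apply: L2D => //; apply: L2D => //; exact: L2_cst.
have := dyn n; have := B_le1 n; have := J_le1 n; apply: filterS3 => w hJ hB hd.
rewrite ger0_norm// -!natrD ler_nat (leq_trans (leq_addr (B n i c w) _))// hd.
rewrite leq_add2l; case: c => [|c]; first by rewrite leq_addr.
rewrite (leq_trans _ (leq_addl _ _))//.
rewrite (@leq_trans (\sum_(j : I) 1)%N)//; last by rewrite sum1_card.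
by apply: leq_sum => j _; have := hB j c; have := hJ j i; nia.
Qed.

Lemma L2_potential g n : L2 P (potential g n).
Proof. by do 2! (apply: L2_sum => ? _); apply: L2Z; exact: L2_T. Qed.

Lemma L2_outflow g n : L2 P (outflow g n).
Proof. by do 2! (apply: L2_sum => ? _); apply: L2Z; exact: L2_B. Qed.

Lemma L2_inflow g n : L2 P (inflow g n).
Proof.
apply: L2_sum => i _; apply: L2D; first exact: L2Z.
by do 2! (apply: L2_sum => ? _); apply: L2Z; exact: L2_BJ.
Qed.

Lemma EE_mul_outflow g n Y : L2 P Y -> \int[P]_w (Y w * outflow g n w) =
  \sum_i \sum_(c < cI + n) g i c * \int[P]_w (Y w * (B n i c w)%:R).
Proof.
move=> hY.
have -> : (fun w => Y w * outflow g n w) = fun w =>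
    \sum_i \sum_(c < cI + n) g i c * (Y w * (B n i c w)%:R).
  apply/funext => w; rewrite mulr_sumr; apply: eq_bigr => i _.
  by rewrite mulr_sumr; apply: eq_bigr => c _; rewrite mulrCA.
have h i c : L1 P (fun w => Y w * (B n i c w)%:R) by apply: L2M => //; exact: L2_B.
rewrite EE_sum => [|i _]; last by apply: L1_sum => c _; exact: L1Z.
apply: eq_bigr => i _; rewrite EE_sum => [|c _]; last exact: L1Z.
by apply: eq_bigr => c _; rewrite EEZ.
Qed.

Lemma EE_potential_mul g n X : L2 P X -> \int[P]_w (potential g n w * X w) =
  \sum_i \sum_(c < cI + n) g i c * \int[P]_w ((T n i c w)%:R * X w).
Proof.
move=> hX.
have -> : (fun w => potential g n w * X w) = fun w =>
    \sum_i \sum_(c < cI + n) g i c * ((T n i c w)%:R * X w).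
  apply/funext => w; rewrite mulr_suml; apply: eq_bigr => i _.
  by rewrite mulr_suml; apply: eq_bigr => c _; rewrite mulrA.
have h i c : L1 P (fun w => (T n i c w)%:R * X w) by apply: L2M => //; exact: L2_T.
rewrite EE_sum => [|i _]; last by apply: L1_sum => c _; exact: L1Z.
apply: eq_bigr => i _; rewrite EE_sum => [|c _]; last exact: L1Z.
by apply: eq_bigr => c _; rewrite EEZ.
Qed.

Lemma EE_mul_inflow g n Y : L2 P Y -> \int[P]_w (Y w * inflow g n w) =
  \sum_i (g i 0%N * \int[P]_w (Y w * (a n i w)%:R) +
    \sum_(c < cI + n) \sum_l g l c.+1 *
      \int[P]_w (Y w * ((B n i c w)%:R * (J n i l w)%:R))).
Proof.
move=> hY.
have -> : (fun w => Y w * inflow g n w) = fun w =>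
    \sum_i (g i 0%N * (Y w * (a n i w)%:R) +
    \sum_(c < cI + n) \sum_l g l c.+1 * (Y w * ((B n i c w)%:R * (J n i l w)%:R))).
  apply/funext => w; rewrite mulr_sumr; apply: eq_bigr => i _.
  rewrite mulrDr mulrCA; congr (_ + _).
  rewrite mulr_sumr; apply: eq_bigr => c _.
  by rewrite mulr_sumr; apply: eq_bigr => l _; rewrite mulrCA.
have h i c l : L1 P (fun w => Y w * ((B n i c w)%:R * (J n i l w)%:R)).
  by apply: L2M => //; exact: L2_BJ.
have h' i : L1 P (fun w => Y w * (a n i w)%:R) by exact: L2M.
rewrite EE_sum => [|i _]; last first.
  by apply: L1D; [exact: L1Z | do 2! (apply: L1_sum => ? _); exact: L1Z].
apply: eq_bigr => i _; rewrite EED; last 2 first.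
- exact: L1Z.
- by do 2! (apply: L1_sum => ? _); exact: L1Z.
rewrite EEZ//; congr (_ + _).
rewrite EE_sum => [|c _]; last by apply: L1_sum => ? _; exact: L1Z.
apply: eq_bigr => c _; rewrite EE_sum => [|l _]; last exact: L1Z.
by apply: eq_bigr => l _; rewrite EEZ.
Qed.

(** The integer weight [Y] lets [cdom_mul] act term by term. The alternative [g i 0 = 0] cancels the
    arrivals, and with them the restriction to slots from [n0] on. *)
Lemma inflow_le g n (Y : Om -> nat) : (forall i c, 0 <= g i c) ->
  (n0 <= n)%N \/ (forall i, g i 0%N = 0) ->
  adapted (F n) Y -> L2 P (fun w => (Y w)%:R) ->
  \int[P]_w ((Y w)%:R * inflow g n w) <=
  (\sum_i al i * g i 0%N) * \int[P]_w (Y w)%:R +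
  \int[P]_w ((Y w)%:R * outflow (routed_potential g) n w).
Proof.
move=> g0 hn aY hY; rewrite EE_mul_inflow// EE_mul_outflow// big_split/=.
apply: lerD.
  rewrite mulr_suml; apply: ler_sum => i _.
  case: hn => [hn|->]; last by rewrite mul0r mulr0 mul0r.
  rewrite mulrAC mulrC ler_wpM2r//.
  apply: (cdom_mul (@FM n)) => //.
  - exact: arr.
  - exact: L2_L1.
  - exact: L2M.
  - by case: (aL2 n i).
apply: ler_sum => i _; apply: ler_sum => c _; rewrite mulr_suml.
apply: ler_sum => l _.
rewrite mulrAC mulrC ler_wpM2r//.
have hYB : L1 P (fun w => (Y w * B n i c w)%:R).
  have -> : (fun w => (Y w * B n i c w)%:R) = fun w => (Y w)%:R * (B n i c w)%:R :> R.
    by apply/funext => w; rewrite natrM.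
  by apply: L2M => //; exact: L2_B.
have -> : (fun w => (Y w)%:R * ((B n i c w)%:R * (J n i l w)%:R)) =
    fun w => (Y w * B n i c w)%:R * (J n i l w)%:R :> R.
  by apply/funext => w; rewrite natrM mulrA.
have -> : (fun w => (Y w)%:R * (B n i c w)%:R) = fun w => (Y w * B n i c w)%:R :> R.
  by apply/funext => w; rewrite natrM.
apply: (cdom_mul (@FM n)) => //.
- exact: (adapted2 (sF n)).
have -> : (fun w => (Y w * B n i c w)%:R * (J n i l w)%:R) =
    fun w => (Y w)%:R * ((B n i c w)%:R * (J n i l w)%:R) :> R.
  by apply/funext => w; rewrite natrM mulrA.
by apply: L2M => //; exact: L2_BJ.
Qed.

Lemma potential_ge0 g n w : (forall i c, 0 <= g i c) -> 0 <= potential g n w.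
Proof. by move=> g0; do 2! (apply: sumr_ge0 => ? _); exact: mulr_ge0. Qed.

Lemma outflow_ge0 g n w : (forall i c, 0 <= g i c) -> 0 <= outflow g n w.
Proof. by move=> g0; do 2! (apply: sumr_ge0 => ? _); exact: mulr_ge0. Qed.

Lemma inflow_ge0 g n w : (forall i c, 0 <= g i c) -> 0 <= inflow g n w.
Proof.
move=> g0; apply: sumr_ge0 => i _; apply: addr_ge0; first exact: mulr_ge0.
by do 2! (apply: sumr_ge0 => ? _); rewrite !mulr_ge0.
Qed.

Lemma outflowD g h n w :
  outflow (fun i c => g i c + h i c) n w = outflow g n w + outflow h n w.
Proof.
rewrite /outflow -big_split; apply: eq_bigr => i _ /=.
by rewrite -big_split; apply: eq_bigr => c _; rewrite mulrDl.
Qed.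

(** The potential is real-valued, but it is a nonnegative combination of the integers [T n i c], to
    each of which [inflow_le] applies. *)
Lemma EE_potential_inflow g n : (forall i c, 0 <= g i c) -> (n0 <= n)%N ->
  \int[P]_w (potential g n w * inflow g n w) <=
  (\sum_i al i * g i 0%N) * \int[P]_w potential g n w +
  \int[P]_w (potential g n w * outflow (routed_potential g) n w).
Proof.
move=> g0 hn.
have e1 : \int[P]_w potential g n w = \int[P]_w (potential g n w * 1).
  by congr Rintegral; apply/funext => w; rewrite mulr1.
rewrite e1 !EE_potential_mul; try exact: L2_outflow; try exact: L2_inflow;
  try exact: L2_cst.
rewrite mulr_sumr -big_split; apply: ler_sum => i _ /=.
rewrite mulr_sumr -big_split; apply: ler_sum => c _ /=.
rewrite mulrCA -mulrDr ler_wpM2l//.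
have -> : (fun w => (T n i c w)%:R * 1) = fun w => (T n i c w)%:R :> R.
  by apply/funext => w; rewrite mulr1.
by apply: inflow_le => //; [left | exact: L2_T].
Qed.

Lemma EE_sqr_sum_bounded (X : nat -> I -> Om -> R) (C : R) :
  (forall n i, L2 P (X n i)) ->
  (forall n i, (n0 <= n)%N -> \int[P]_w (X n i w ^+ 2) <= C) ->
  exists K, 0 <= K /\
    forall n, (n0 <= n)%N -> \int[P]_w ((\sum_i X n i w) ^+ 2) <= K.
Proof.
move=> XL XC.
suff [K [K0 hK]] : exists K, 0 <= K /\
    forall n, (n0 <= n)%N -> \int[P]_w ((\sum_(i <- index_enum I) X n i w) ^+ 2) <= K.
  by exists K.
elim: (index_enum I) => [|i r [K [K0 IH]]].
  exists 0; split => // n _.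
  have -> : (fun w => (\sum_(i <- [::]) X n i w) ^+ 2) = fun=> 0.
    by apply/funext => w; rewrite big_nil expr0n.
  by rewrite EE_cst.
exists (`|2 * C + 2 * K|); split => // n nn; apply: le_trans (ler_norm _).
have LS : L2 P (fun w => \sum_(j <- r) X n j w) by exact: L2_sum.
apply: (@le_trans _ _ (\int[P]_w (2 * X n i w ^+ 2 + 2 * (\sum_(j <- r) X n j w) ^+ 2))).
  apply: EE_le.
  - have -> : (fun w => (\sum_(j <- i :: r) X n j w) ^+ 2) =
        fun w => (X n i w + \sum_(j <- r) X n j w) ^+ 2.
      by apply/funext => w; rewrite big_cons.
    by have [] := L2D (XL n i) LS.
  - by apply: L1D; apply: L1Z; [case: (XL n i) | case: LS].
  - apply/aeW => w; rewrite big_cons.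
    by have := sqr_ge0 (X n i w - \sum_(j <- r) X n j w); nra.
rewrite EED ?EEZ; try (by apply: L1Z; case: (XL n i)); try (by case: (XL n i));
  try (by apply: L1Z; case: LS); try (by case: LS).
by have := XC n i nn; have := IH n nn; lra.
Qed.

(** In each slot a buffer completes at most one job, which has at most one destination; so the
    inflow is at most the sum of the [kap * (a n i + 1)]. *)
Lemma inflow_sqr_bounded g kap : (forall i c, 0 <= g i c <= kap) ->
  exists K, 0 <= K /\ forall n, (n0 <= n)%N -> \int[P]_w (inflow g n w ^+ 2) <= K.
Proof.
move=> gk.
have g0 i c : 0 <= g i c by case/andP: (gk i c).
have gle i c : g i c <= kap by case/andP: (gk i c).
have L2X n i : L2 P (fun w => kap * ((a n i w)%:R + 1)).
  by apply: L2Z; apply: L2D => //; exact: L2_cst.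
have [|K [K0 hK]] := @EE_sqr_sum_bounded _ (kap ^+ 2 * (2 * Ca + 2)) L2X.
  move=> n i hn.
  apply: (@le_trans _ _ (\int[P]_w (kap ^+ 2 * (2 * (a n i w)%:R ^+ 2 + 2)))).
    apply: EE_le.
    - by case: (L2X n i).
    - apply: L1Z; apply: L1D; last exact: L1_cst.
      by apply: L1Z; case: (aL2 n i).
    - apply/aeW => w; rewrite exprMn ler_wpM2l ?sqr_ge0//.
      by have := sqr_ge0 ((a n i w)%:R - 1 : R); nra.
  have h1 : L1 P (fun w => 2 * (a n i w)%:R ^+ 2) by apply: L1Z; case: (aL2 n i).
  rewrite EEZ; last by apply: L1D => //; exact: L1_cst.
  rewrite ler_wpM2l ?sqr_ge0// EED//; last exact: L1_cst.
  rewrite EE_cst EEZ; last by case: (aL2 n i).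
  by have := aCa i hn; lra.
exists K; split => // n hn; apply: le_trans (hK n hn).
apply: EE_le.
- by case: (L2_inflow g n).
- have : L2 P (fun w => \sum_i kap * ((a n i w)%:R + 1)) by exact: L2_sum.
  by case.
have := B1 n; have := J1 n; apply: filterS2 => w hJ hB.
have := inflow_ge0 n w g0 => i0.
have hle : inflow g n w <= \sum_i kap * ((a n i w)%:R + 1); last first.
  by rewrite lerXn2r// nnegrE// (le_trans i0).
apply: ler_sum => i _; rewrite mulrDr lerD ?ler_wpM2r//.
have k0 : 0 <= kap by exact: le_trans (g0 i 0%N) _.
apply: (@le_trans _ _ (\sum_(c < cI + n) kap * (B n i c w)%:R)); last first.
  by rewrite -mulr_sumr ler_wpM2l// -natr_sum lern1.
apply: ler_sum => c _.
apply: (@le_trans _ _ (\sum_l kap * ((B n i c w)%:R * (J n i l w)%:R))).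
  by apply: ler_sum => l _; rewrite ler_wpM2r// mulr_ge0.
rewrite -mulr_sumr ler_wpM2l// -mulr_sumr -natr_sum -natrM ler_nat.
by rewrite -[leqRHS]muln1 leq_mul2l hJ orbT.
Qed.

Lemma outflow_le g kap n : (forall i c, 0 <= g i c <= kap) ->
  {ae P, forall w, outflow g n w <= kap * #|I|%:R}.
Proof.
move=> gk; have := B1 n; apply: filterS => w hB.
apply: (@le_trans _ _ (\sum_(i : I) kap)); last first.
  by rewrite sumr_const mulr_natr.
apply: ler_sum => i _.
have k0 : 0 <= kap by have /andP[h1 h2] := gk i 0%N; exact: le_trans h1 h2.
apply: (@le_trans _ _ (\sum_(c < cI + n) kap * (B n i c w)%:R)).
  by apply: ler_sum => c _; rewrite ler_wpM2r//; case/andP: (gk i c).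
by rewrite -mulr_sumr -[leRHS]mulr1 ler_wpM2l// -natr_sum lern1.
Qed.

(** In the square of potential plus inflow minus outflow, the product of inflow and outflow has a
    negative sign and is dropped, so their correlation is of no concern. The routed part of the
    outflow then cancels against the bound on the inflow. *)
Lemma quadratic_drift g s kap : (forall i c, 0 <= g i c <= kap) ->
  (forall i c, g i c = s i c + routed_potential g i c) ->
  exists K, 0 <= K /\ forall n, (n0 <= n)%N ->
  \int[P]_w (potential g n.+1 w ^+ 2) +
    2 * \int[P]_w (potential g n w * outflow s n w) <=
  \int[P]_w (potential g n w ^+ 2) +
    2 * (\sum_i al i * g i 0%N) * \int[P]_w potential g n w + K.
Proof.
move=> gk gE.
have g0 i c : 0 <= g i c by case/andP: (gk i c).
have [K [K0 hK]] := inflow_sqr_bounded gk.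
exists (K + (kap * #|I|%:R) ^+ 2); split; first by rewrite addr_ge0 ?sqr_ge0.
move=> n hn.
have L2phi := L2_potential g n; have L2in := L2_inflow g n.
have L2out := L2_outflow g n.
have i1 : L1 P (fun w => potential g n w ^+ 2) by case: L2phi.
have i2 : L1 P (fun w => 2 * (potential g n w * inflow g n w)).
  by apply: L1Z; exact: L2M.
have i3 : L1 P (fun w => 2 * (potential g n w * outflow g n w)).
  by apply: L1Z; exact: L2M.
have i4 : L1 P (fun w => inflow g n w ^+ 2) by case: L2in.
have i5 : L1 P (fun=> (kap * #|I|%:R) ^+ 2) by exact: L1_cst.
have : \int[P]_w (potential g n.+1 w ^+ 2) <=
    \int[P]_w (potential g n w ^+ 2 + 2 * (potential g n w * inflow g n w)
     - 2 * (potential g n w * outflow g n w)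
     + inflow g n w ^+ 2 + (kap * #|I|%:R) ^+ 2).
  apply: EE_le.
  - by case: (L2_potential g n.+1).
  - by apply: L1D => //; apply: L1D => //; apply: L1B => //; exact: L1D.
  have := potential_step g n; have := outflow_le n gk; apply: filterS2 => w ho ->.
  have := potential_ge0 n w g0; have := inflow_ge0 n w g0.
  have := outflow_ge0 n w g0 => o0 in0 p0.
  have : outflow g n w ^+ 2 <= (kap * #|I|%:R) ^+ 2.
    by rewrite lerXn2r ?nnegrE// (le_trans o0).
  have := mulr_ge0 o0 in0; nra.
rewrite EED//; last by apply: L1D => //; apply: L1B => //; exact: L1D.
rewrite EED//; last by apply: L1B => //; exact: L1D.
rewrite EEB//; last exact: L1D.
rewrite EED// EE_cst EEZ; last exact: L2M.
rewrite EEZ; last exact: L2M.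
have -> : \int[P]_w (potential g n w * outflow g n w) =
    \int[P]_w (potential g n w * outflow s n w) +
    \int[P]_w (potential g n w * outflow (routed_potential g) n w).
  rewrite -EED; try by apply: L2M => //; exact: L2_outflow.
  congr Rintegral; apply/funext => w; rewrite -mulrDr -outflowD; congr (_ * _).
  by apply: eq_bigr => i _; apply: eq_bigr => c _; rewrite -gE.
have := EE_potential_inflow g0 hn; have := hK n hn; lra.
Qed.

(** Without weight on new arrivals the mean potential cannot grow in any slot, including those
    before the bound on the arrival rate holds. *)
Lemma linear_drift g s n : (forall i c, 0 <= g i c) -> (forall i c, 0 <= s i c) ->
  (forall i c, g i c = s i c + routed_potential g i c) ->
  (forall i, g i 0%N = 0) ->
  \int[P]_w (potential g n.+1 w) <= \int[P]_w (potential g n w).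
Proof.
move=> g0 s0 gE gz.
have L2phi := L2_potential g n; have L2in := L2_inflow g n.
have L2out := L2_outflow g n.
have -> : \int[P]_w (potential g n.+1 w) =
    \int[P]_w (potential g n w + inflow g n w - outflow g n w).
  have m1 : L1 P (fun w => potential g n w + inflow g n w - outflow g n w).
    by apply: L1B; [apply: L1D|]; exact: L2_L1.
  have m2 : L1 P (potential g n.+1) by apply: L2_L1; exact: L2_potential.
  apply/eqP; rewrite eq_le; apply/andP; split; apply: EE_le => //;
    by apply: filterS (potential_step g n) => w ->.
rewrite EEB ?EED; try exact: L2_L1; last by apply: L1D; exact: L2_L1.
have : \int[P]_w (1%:R * inflow g n w) <= (\sum_i al i * g i 0%N) * \int[P]_w 1%:R +
  \int[P]_w (1%:R * outflow (routed_potential g) n w).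
  apply: (@inflow_le g n (fun=> 1%N)) => //; first by right.
  - exact: (adapted_cst (sF n)).
  - exact: L2_cst.
rewrite [X in X * _]big1 ?mul0r ?add0r => [|i _]; last by rewrite gz mulr0.
under eq_Rintegral do rewrite mul1r.
under [X in _ <= X]eq_Rintegral do rewrite mul1r.
have -> : \int[P]_w (outflow g n w) = \int[P]_w (outflow s n w) +
    \int[P]_w (outflow (routed_potential g) n w).
  rewrite -EED; try by apply: L2_L1; exact: L2_outflow.
  congr Rintegral; apply/funext => w; rewrite -outflowD.
  by apply: eq_bigr => i _; apply: eq_bigr => c _; rewrite -gE.
have : 0 <= \int[P]_w (outflow s n w) by apply: EE_ge0 => w; exact: outflow_ge0.
by move=> h1 h2; lra.
Qed.

Lemma L1_potential g n : L1 P (potential g n).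
Proof. by apply: L2_L1; exact: L2_potential. Qed.

Definition lo n i c w : nat := (\sum_(c' < cI + n | (c' < c)%N) T n i c' w)%N.

Definition hi n i c w : nat := (\sum_(c' < cI + n | (c <= c')%N) T n i c' w)%N.

Definition total_jobs n w : nat := (\sum_i \sum_(c < cI + n) T n i c w)%N.

Lemma total_lo_hi n c w : total_jobs n w = (\sum_i lo n i c w + \sum_i hi n i c w)%N.
Proof.
rewrite -big_split; apply: eq_bigr => i _ /=.
rewrite (bigID (fun c' : 'I_(cI + n) => (c' < c)%N))/=; congr (_ + _)%N.
by apply: eq_bigl => c'; rewrite -leqNgt.
Qed.

Lemma L2_lo n i c : L2 P (fun w => (lo n i c w)%:R).
Proof.
have -> : (fun w => (lo n i c w)%:R) =
    fun w => \sum_(c' < cI + n | (c' < c)%N) (T n i c' w)%:R :> R.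
  by apply/funext => w; rewrite natr_sum.
by apply: L2_sum => c' _; exact: L2_T.
Qed.

Lemma L2_hi n i c : L2 P (fun w => (hi n i c w)%:R).
Proof.
have -> : (fun w => (hi n i c w)%:R) =
    fun w => \sum_(c' < cI + n | (c <= c')%N) (T n i c' w)%:R :> R.
  by apply/funext => w; rewrite natr_sum.
by apply: L2_sum => c' _; exact: L2_T.
Qed.

Lemma potential_lo (q : pred I) c n w :
  potential (fun i c' => (q i && (c' < c)%N)%:R) n w = \sum_(i | q i) (lo n i c w)%:R.
Proof.
rewrite /potential [RHS]big_mkcond; apply: eq_bigr => i _; case: (q i) => /=.
  rewrite natr_sum [RHS]big_mkcond; apply: eq_bigr => c' _.
  by case: (c' < c)%N; rewrite ?mul1r ?mul0r.
by rewrite big1// => c' _; rewrite mul0r.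
Qed.

Lemma potential_hi c n w :
  potential (fun i c' => (c <= c')%N%:R) n w = \sum_i (hi n i c w)%:R.
Proof.
rewrite /potential; apply: eq_bigr => i _.
rewrite natr_sum [RHS]big_mkcond; apply: eq_bigr => c' _.
by case: (c <= c')%N; rewrite ?mul1r ?mul0r.
Qed.

Lemma potentialD g h n w :
  potential (fun i c => g i c + h i c) n w = potential g n w + potential h n w.
Proof.
rewrite /potential -big_split; apply: eq_bigr => i _ /=.
by rewrite -big_split; apply: eq_bigr => c _; rewrite mulrDl.
Qed.

Lemma ler_potential g h n w : (forall i c, g i c <= h i c) ->
  potential g n w <= potential h n w.
Proof. by move=> gh; do 2! (apply: ler_sum => ? _); rewrite ler_wpM2r. Qed.

Lemma potentialZ c g n w :
  potential (fun i c' => c * g i c') n w = c * potential g n w.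
Proof.
rewrite /potential mulr_sumr; apply: eq_bigr => i _.
by rewrite mulr_sumr; apply: eq_bigr => ? _; rewrite mulrA.
Qed.

(** * Drift under the service policy *)

Variables (K : finType) (Ks : I -> {set K}) (eps : R).
Variables (C : nat -> I -> Om -> bool) (G : nat -> I -> set (set Om)).
Variables (Q0 : I -> nat -> nat) (x0 : nat).
(* [C n i] is the outcome of the coin that serves the largest counter, [G n i]
   the information available before it is tossed; by then [T n.+1] is known. *)
Hypothesis eps_ge0 : 0 <= eps.
Hypothesis eps_le1 : eps <= 1.
Hypothesis sG : forall n i, sigma_algebra setT (G n i).
Hypothesis GM : forall n i, G n i `<=` measurable.
Hypothesis aTG : forall n i l c, adapted (G n i) (T n.+1 l c).
Hypothesis mC : forall n i, measurable_fun setT (fun w => (C n i w)%:R : R).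
Hypothesis coin_le : forall n i, cdom P (G n i) (fun w => (C n i w)%:R) eps.
Hypothesis coin_ge : forall n i,
  cdom P (G n i) (fun w => 1 - (C n i w)%:R) (1 - eps).
Hypothesis Q0x0 : forall i m, (\sum_(c < m) Q0 i c <= x0)%N.
(** A component without an event takes no decision, so jobs of the initial state may go on waiting
    with all processors idle; the first alternative covers this case. *)
Hypothesis pol : forall n, {ae P, forall w, forall i,
  (forall c, (T n.+1 i c w <= Q0 i c)%N) \/
  (forall c, (0 < T n.+1 i c w)%N ->
     if C n i w then exists l c', (c <= c')%N /\ (0 < B n.+1 l c' w)%N
     else exists l c' k, [/\ (c' <= c)%N, k \in Ks l, k \in Ks i &
                             (0 < B n.+1 l c' w)%N])}.

Lemma L1_coin_mul n i (Y : Om -> nat) : L2 P (fun w => (Y w)%:R) ->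
  L1 P (fun w => (Y w)%:R * (C n i w)%:R).
Proof.
move=> hY; apply: L2M => //; apply: (L2_dom (mC _ _) (L2_cst P 1)).
by apply/aeW => w; rewrite ger0_norm// lern1 leq_b1.
Qed.

Lemma EE_coin_le n i (Y : Om -> nat) : adapted (G n i) Y ->
  L2 P (fun w => (Y w)%:R) ->
  \int[P]_w ((Y w)%:R * (C n i w)%:R) <= eps * \int[P]_w (Y w)%:R.
Proof.
move=> aY hY; apply: (cdom_mul (@GM n i)) => //.
- exact: L2_L1.
- exact: L1_coin_mul.
Qed.

(** [cdom] bounds from above only; a lower bound comes from the complement of the coin. *)
Lemma EE_coin_ge n i (Y : Om -> nat) : adapted (G n i) Y ->
  L2 P (fun w => (Y w)%:R) ->
  eps * \int[P]_w (Y w)%:R <= \int[P]_w ((Y w)%:R * (C n i w)%:R).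
Proof.
move=> aY hY; have hY1 := L2_L1 hY; have hYC := L1_coin_mul n i hY.
have e : (fun w => (Y w)%:R * (1 - (C n i w)%:R)) =
    fun w => (Y w)%:R - (Y w)%:R * (C n i w)%:R :> R.
  by apply/funext => w; rewrite mulrBr mulr1.
have : \int[P]_w ((Y w)%:R * (1 - (C n i w)%:R)) <= (1 - eps) * \int[P]_w (Y w)%:R.
  apply: (cdom_mul (@GM n i)) => //.
  - by move=> w; rewrite subr_ge0 lern1 leq_b1.
  - by rewrite subr_ge0.
  - by rewrite e; exact: L1B.
  - exact: measurable_funB.
by rewrite e EEB//; lra.
Qed.

(** The potential of [k] is the number of low jobs that need [k] plus a remainder [D k]. Exchanging
    the sums over [k] and [i] pairs the low jobs of a buffer with the low services on all its
    processors. The remainder sees only counter indices below [c], so the induction on [c] can pay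
    for it. *)
Lemma low_drift_path c (g : K -> I -> nat -> R) (rho : K -> R) kap n :
  (forall k i c', 0 <= g k i c' <= kap) -> (forall k, 0 <= rho k) ->
  (forall k i c', g k i c' =
    ((k \in Ks i) && (c' < c.+1)%N)%:R + routed_potential (g k) i c') ->
  (forall k i c', (c <= c')%N -> routed_potential (g k) i c' = 0) ->
  {ae P, forall w,
    \sum_k rho k * potential (g k) n.+1 w -
    \sum_k potential (g k) n.+1 w *
       outflow (fun i c' => ((k \in Ks i) && (c' < c.+1)%N)%:R) n.+1 w <=
    \sum_i ((\sum_(k in Ks i) rho k - 1) * (lo n.+1 i c.+1 w)%:R +
            (lo n.+1 i c.+1 w)%:R * (C n i w)%:R) +
    (\sum_k rho k * kap) * \sum_i (lo n.+1 i c w)%:R + #|I|%:R * x0%:R}.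
Proof.
move=> gk rho0 gE gz.
have g0 k i c' : 0 <= g k i c' by case/andP: (gk k i c').
have rp0 k i c' : 0 <= routed_potential (g k) i c'.
  by apply: sumr_ge0 => l _; exact: mulr_ge0.
have rple k i c' : routed_potential (g k) i c' <= kap * (xpredT i && (c' < c)%N)%:R.
  have [cc'|cc'] := ltnP c' c; last by rewrite gz// mulr0.
  rewrite mulr1; apply: le_trans (_ : g k i c' <= _); last by case/andP: (gk k i c').
  by rewrite gE lerDr.
have := pol n; have := cut n.+1; have := BT n.+1.
apply: filterS3 => w hBT hcut hpol.
pose S k := outflow (fun i c' => ((k \in Ks i) && (c' < c.+1)%N)%:R) n.+1 w.
pose L i : R := (lo n.+1 i c.+1 w)%:R.
pose D k := potential (routed_potential (g k)) n.+1 w.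
have S0 k : 0 <= S k by exact: outflow_ge0.
have D0 k : 0 <= D k by exact: potential_ge0.
have Dle k : D k <= kap * \sum_i (lo n.+1 i c w)%:R.
  rewrite (le_trans (ler_potential n.+1 w (rple k)))//.
  by rewrite (potentialZ kap (fun i c' => (xpredT i && (c' < c)%N)%:R)) potential_lo.
have UE k : potential (g k) n.+1 w = \sum_(i | k \in Ks i) L i + D k.
  rewrite -potential_lo -potentialD.
  by apply: eq_bigr => i _; apply: eq_bigr => c' _; rewrite -gE.
have h1 : \sum_k rho k * potential (g k) n.+1 w <=
    \sum_i (\sum_(k in Ks i) rho k) * L i +
    (\sum_k rho k * kap) * \sum_i (lo n.+1 i c w)%:R.
  have -> : \sum_k rho k * potential (g k) n.+1 w =
      \sum_k \sum_(i | k \in Ks i) rho k * L i + \sum_k rho k * D k.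
    by rewrite -big_split; apply: eq_bigr => k _; rewrite UE mulrDr mulr_sumr.
  rewrite (exchange_big_dep xpredT)//=; apply: lerD.
    by apply: ler_sum => i _; rewrite mulr_suml.
  by rewrite mulr_suml; apply: ler_sum => k _; rewrite -mulrA ler_wpM2l.
have h2 : \sum_i L i * \sum_(k in Ks i) S k <= \sum_k potential (g k) n.+1 w * S k.
  have -> : \sum_i L i * \sum_(k in Ks i) S k = \sum_k \sum_(i | k \in Ks i) L i * S k.
    rewrite [RHS](exchange_big_dep xpredT)//=; apply: eq_bigr => i _; exact: mulr_sumr.
  apply: ler_sum => k _; rewrite UE mulrDl -mulr_suml lerDl.
  exact: mulr_ge0.
(* A frozen buffer has at most [x0] low jobs. Otherwise a success makes the second factor
   nonpositive, and a failure yields a low service on a processor of [i], which makes the sum at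
   least 1 as soon as [i] has a low job. *)
have h3 i : L i * (1 - (C n i w)%:R - \sum_(k in Ks i) S k) <= x0%:R.
  have SS : 0 <= \sum_(k in Ks i) S k by exact: sumr_ge0.
  have L0 : 0 <= L i by exact: ler0n.
  have C0 : 0 <= (C n i w)%:R :> R by exact: ler0n.
  case: (hpol i) => [hf|ha].
    have hL : L i <= x0%:R.
      rewrite ler_nat (leq_trans _ (Q0x0 i (cI + n.+1)))// /lo big_mkcond/=.
      by apply: leq_sum => c' _; case: ifP => // _; exact: hf.
    apply: le_trans hL; rewrite -[leRHS]mulr1 ler_wpM2l//.
    by move: SS C0; set S1 := \sum_(k in _) _; lra.
  have [l0|] := posnP (lo n.+1 i c.+1 w); first by rewrite /L l0 mul0r.
  rewrite lt0n /lo sum_nat_eq0 negb_forall_in => /exists_inP[c' c'c].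
  rewrite -lt0n => /ha; case: (C n i w) => [_|].
    apply: (@le_trans _ _ 0) => //; rewrite subrr sub0r mulrN oppr_le0.
    exact: mulr_ge0.
  move=> [l [c'' [k [c''c kl ki Bp]]]].
  have c''cut : (c'' < cI + n.+1)%N.
    rewrite ltnNge; apply/negP => /(hcut l) T0'.
    by have := hBT l c''; rewrite T0' leqNgt Bp.
  suff S1 : 1 <= \sum_(k in Ks i) S k.
    apply: (@le_trans _ _ 0) => //; rewrite subr0 mulr_ge0_le0//.
    by rewrite subr_le0.
  rewrite (bigD1 k)//= -[leLHS]addr0; apply: lerD; last exact: sumr_ge0.
  rewrite /S /outflow (bigD1 l)//= -[leLHS]addr0; apply: lerD; last first.
    by do 2! (apply: sumr_ge0 => ? _); exact: mulr_ge0.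
  rewrite (bigD1 (Ordinal c''cut))//= -[leLHS]addr0; apply: lerD; last first.
    by apply: sumr_ge0 => ? _; exact: mulr_ge0.
  by rewrite kl (leq_ltn_trans c''c)// mul1r ler1n.
have : \sum_i L i * (1 - (C n i w)%:R - \sum_(k in Ks i) S k) <= #|I|%:R * x0%:R.
  apply: (@le_trans _ _ (\sum_(i : I) x0%:R)); first exact: ler_sum.
  by rewrite sumr_const mulr_natl.
have -> : \sum_i L i * (1 - (C n i w)%:R - \sum_(k in Ks i) S k) =
    \sum_i (1 - (C n i w)%:R) * L i - \sum_i L i * \sum_(k in Ks i) S k.
  by rewrite -sumrB; apply: eq_bigr => i _; ring.
have -> : \sum_i ((\sum_(k in Ks i) rho k - 1) * L i + L i * (C n i w)%:R) =
    \sum_i (\sum_(k in Ks i) rho k) * L i - \sum_i (1 - (C n i w)%:R) * L i.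
  by rewrite -sumrB; apply: eq_bigr => i _; ring.
move: h1 h2; rewrite /S; lra.
Qed.

Lemma adapted_lo n i l c : adapted (G n i) (lo n.+1 l c).
Proof. by apply: (adapted_sum (sG n i)) => c' _; exact: aTG. Qed.

Lemma adapted_hi n i l c : adapted (G n i) (hi n.+1 l c).
Proof. by apply: (adapted_sum (sG n i)) => c' _; exact: aTG. Qed.

Lemma low_level c (g : K -> I -> nat -> R) (rho : K -> R) kap del : 0 < del ->
  (forall i, \sum_(k in Ks i) rho k + eps <= 1 - del) ->
  (forall k i c', 0 <= g k i c' <= kap) ->
  (forall k i c', g k i c' =
    ((k \in Ks i) && (c' < c.+1)%N)%:R + routed_potential (g k) i c') ->
  (forall k i c', (c <= c')%N -> routed_potential (g k) i c' = 0) ->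
  (forall k, \sum_i al i * g k i 0%N <= rho k) ->
  avg_bounded (fun n => \int[P]_w (\sum_i (lo n i c w)%:R)) ->
  avg_bounded (fun n => \int[P]_w (\sum_i (lo n i c.+1 w)%:R)).
Proof.
move=> del0 slack gk gE gz grho IH.
have g0 k i c' : 0 <= g k i c' by case/andP: (gk k i c').
have rho0 k : 0 <= rho k.
  by apply: le_trans (grho k); apply: sumr_ge0 => i _; exact: mulr_ge0.
have /choice[Kk hK] k := quadratic_drift (gk k) (gE k).
have L1lo n c' : L1 P (fun w => \sum_i (lo n i c' w)%:R).
  by apply: L1_sum => i _; apply: L2_L1; exact: L2_lo.
have EElo0 n c' : 0 <= \int[P]_w (\sum_i (lo n i c' w)%:R).
  by apply: EE_ge0 => w; exact: sumr_ge0.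
(* When there are no buffers or no processors [kap] may be negative, hence its absolute value. *)
pose f n := 2 * (\sum_k rho k * `|kap|) * \int[P]_w (\sum_i (lo n i c w)%:R) +
  (2 * (#|I|%:R * x0%:R) + \sum_k Kk k).
have Kf : 0 <= \sum_k Kk k by apply: sumr_ge0 => k _; case: (hK k).
have rk0 : 0 <= \sum_k rho k * `|kap| by apply: sumr_ge0 => k _; exact: mulr_ge0.
(* Slot 0 is excluded because its state is not the outcome of a decision. *)
apply: (@avg_bounded_drift _ (fun n => \sum_k \int[P]_w (potential (g k) n w ^+ 2))
   _ f (2 * del) (maxn n0 1)).
- by rewrite mulr_gt0.
- by move=> n; apply: sumr_ge0 => k _; apply: EE_ge0 => w; exact: sqr_ge0.
- by move=> n; exact: EElo0.
- by move=> n; rewrite addr_ge0// ?mulr_ge0// addr_ge0// mulr_ge0// mulr_ge0.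
- apply: avg_boundedD; last first.
    by apply: avg_bounded_cst; rewrite addr_ge0// mulr_ge0// mulr_ge0.
  by apply: avg_boundedZ => //; rewrite mulr_ge0.
move=> [|n]; rewrite geq_max => /andP[hn _]//=.
pose sk k i c' : R := ((k \in Ks i) && (c' < c.+1)%N)%:R.
have L1US k : L1 P (fun w => potential (g k) n.+1 w * outflow (sk k) n.+1 w).
  by apply: L2M; [exact: L2_potential | exact: L2_outflow].
have hsum : \sum_k \int[P]_w (potential (g k) n.+2 w ^+ 2) +
    2 * \sum_k \int[P]_w (potential (g k) n.+1 w * outflow (sk k) n.+1 w) <=
    \sum_k \int[P]_w (potential (g k) n.+1 w ^+ 2) +
    2 * \sum_k rho k * \int[P]_w (potential (g k) n.+1 w) + \sum_k Kk k.
  rewrite !mulr_sumr -!big_split; apply: ler_sum => k _ /=.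
  have [_ /(_ _ hn) hk] := hK k; apply: le_trans hk _; rewrite lerD2r lerD2l.
  rewrite -mulrA ler_wpM2l// ler_wpM2r//.
  by apply: EE_ge0 => w; exact: potential_ge0.
have kapE k i c' : 0 <= g k i c' <= `|kap|.
  by case/andP: (gk k i c') => -> /le_trans ->//; exact: ler_norm.
have hpath := low_drift_path n kapE rho0 gE gz.
have L1lC i : L1 P (fun w => (lo n.+1 i c.+1 w)%:R * (C n i w)%:R).
  by apply: L1_coin_mul; exact: L2_lo.
have L1l i c' : L1 P (fun w => (lo n.+1 i c' w)%:R) by apply: L2_L1; exact: L2_lo.
have hE : \sum_k rho k * \int[P]_w (potential (g k) n.+1 w) -
    \sum_k \int[P]_w (potential (g k) n.+1 w * outflow (sk k) n.+1 w) <=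
    \sum_i ((\sum_(k in Ks i) rho k - 1) * \int[P]_w (lo n.+1 i c.+1 w)%:R +
            \int[P]_w ((lo n.+1 i c.+1 w)%:R * (C n i w)%:R)) +
    (\sum_k rho k * `|kap|) * \int[P]_w (\sum_i (lo n.+1 i c w)%:R) +
    #|I|%:R * x0%:R.
  have -> : \sum_k rho k * \int[P]_w (potential (g k) n.+1 w) -
      \sum_k \int[P]_w (potential (g k) n.+1 w * outflow (sk k) n.+1 w) =
      \int[P]_w (\sum_k rho k * potential (g k) n.+1 w -
        \sum_k potential (g k) n.+1 w * outflow (sk k) n.+1 w).
    rewrite EEB; [|by apply: L1_sum => k _; apply: L1Z; exact: L1_potential
                  |by apply: L1_sum => k _; exact: L1US].
    rewrite EE_sum => [|k _]; last by apply: L1Z; exact: L1_potential.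
    rewrite EE_sum => [|k _]; last exact: L1US.
    by congr (_ - _); apply: eq_bigr => k _; rewrite EEZ//; exact: L1_potential.
  have L1i i : L1 P (fun w => (\sum_(k in Ks i) rho k - 1) * (lo n.+1 i c.+1 w)%:R +
            (lo n.+1 i c.+1 w)%:R * (C n i w)%:R).
    by apply: L1D => //; exact: L1Z.
  have -> : \sum_i ((\sum_(k in Ks i) rho k - 1) * \int[P]_w (lo n.+1 i c.+1 w)%:R +
            \int[P]_w ((lo n.+1 i c.+1 w)%:R * (C n i w)%:R)) =
      \int[P]_w (\sum_i ((\sum_(k in Ks i) rho k - 1) * (lo n.+1 i c.+1 w)%:R +
            (lo n.+1 i c.+1 w)%:R * (C n i w)%:R)).
    rewrite EE_sum => [|i _]; last exact: L1i.
    by apply: eq_bigr => i _; rewrite EED//; [rewrite EEZ | exact: L1Z].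
  have L1S : L1 P (fun w =>
      \sum_i ((\sum_(k in Ks i) rho k - 1) * (lo n.+1 i c.+1 w)%:R +
            (lo n.+1 i c.+1 w)%:R * (C n i w)%:R)).
    by apply: L1_sum => i _; exact: L1i.
  have L1S' : L1 P (fun w => (\sum_k rho k * `|kap|) * \sum_i (lo n.+1 i c w)%:R).
    exact: L1Z.
  rewrite -(EEZ _ (L1lo _ _)) -[X in _ <= _ + X](EE_cst P) -EED//.
  rewrite -EED//; [|exact: L1D|exact: L1_cst].
  apply: EE_le => //.
    apply: L1B; first by apply: L1_sum => k _; apply: L1Z; exact: L1_potential.
    by apply: L1_sum => k _; exact: L1US.
  by apply: L1D; [exact: L1D|exact: L1_cst].
have hS : \sum_i ((\sum_(k in Ks i) rho k - 1) * \int[P]_w (lo n.+1 i c.+1 w)%:R +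
            \int[P]_w ((lo n.+1 i c.+1 w)%:R * (C n i w)%:R)) <=
    - del * \int[P]_w (\sum_i (lo n.+1 i c.+1 w)%:R).
  rewrite EE_sum// mulr_sumr; apply: ler_sum => i _.
  have := EE_coin_le (adapted_lo n i i c.+1) (L2_lo n.+1 i c.+1).
  have : 0 <= \int[P]_w ((lo n.+1 i c.+1 w)%:R : R) by apply: EE_ge0.
  by have := slack i; nra.
by rewrite /f; lra.
Qed.

Lemma avg_bounded_low (g : nat -> K -> I -> nat -> R) (rho : K -> R)
    (kap : nat -> R) del : 0 < del ->
  (forall i, \sum_(k in Ks i) rho k + eps <= 1 - del) ->
  (forall c k i c', 0 <= g c k i c' <= kap c) ->
  (forall c k i c', g c k i c' =
    ((k \in Ks i) && (c' < c.+1)%N)%:R + routed_potential (g c k) i c') ->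
  (forall c k i c', (c <= c')%N -> routed_potential (g c k) i c' = 0) ->
  (forall c k, \sum_i al i * g c k i 0%N <= rho k) ->
  forall c, avg_bounded (fun n => \int[P]_w (\sum_i (lo n i c w)%:R)).
Proof.
move=> del0 slack gk gE gz grho; elim=> [|c IH].
  apply: (@eq_avg_bounded _ (fun=> 0)); last exact: avg_bounded_cst.
  move=> n; rewrite (_ : (fun w => _) = fun=> 0) ?EE_cst//.
  by apply/funext => w; rewrite big1// => i _; rewrite /lo big_pred0.
exact: (low_level del0 slack (gk c) (gE c) (gz c) (grho c)).
Qed.

(** If buffer [i] has more than [x0] high jobs, a success puts some high job into service. So the
    mean of potential times high outflow is at least [eps] times the mean potential on that event.
    Over all [i] these events cover everything except states with few high jobs, where low jobs and
    a constant bound the potential. *)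
Lemma high_level c0 (g : I -> nat -> R) kap :
  0 < eps ->
  (forall i c, 0 <= g i c <= kap) ->
  (forall i c, g i c = (c0 <= c)%N%:R + routed_potential g i c) ->
  2 * #|I|.+1%:R * (\sum_i al i * g i 0%N) <= eps ->
  avg_bounded (fun n => \int[P]_w (\sum_i (lo n i c0 w)%:R)) ->
  avg_bounded (fun n => \int[P]_w (potential g n w)).
Proof.
move=> eps0 gk gE heta hlo.
have g0 i c : 0 <= g i c by case/andP: (gk i c).
have [Kq [Kq0 hK]] := quadratic_drift gk gE.
set eta := \sum_i _ in heta hK.
(* One unit per buffer, to sum the bounds over the buffers, and one more for positivity when there
   are none. *)
set N1 : R := #|I|.+1%:R in heta.
have N1gt0 : 0 < N1 by rewrite ltr0n.
have kap0 : 0 <= `|kap| by [].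
have gle i c : g i c <= `|kap| by case/andP: (gk i c) => _ /le_trans ->//; exact: ler_norm.
have ek0 : 0 <= 2 * eps * `|kap| by rewrite !mulr_ge0.
have cst0 : 0 <= 2 * eps * `|kap| * (#|I|%:R * x0%:R) + N1 * Kq.
  by apply: addr_ge0; apply: mulr_ge0 => //; apply: mulr_ge0.
pose f n := 2 * eps * `|kap| * \int[P]_w (\sum_i (lo n i c0 w)%:R) +
  (2 * eps * `|kap| * (#|I|%:R * x0%:R) + N1 * Kq).
have L1lo n c' : L1 P (fun w => \sum_i (lo n i c' w)%:R).
  by apply: L1_sum => i _; apply: L2_L1; exact: L2_lo.
apply: (@avg_bounded_drift _ (fun n => N1 * \int[P]_w (potential g n w ^+ 2))
   _ f eps (maxn n0 1)) => //.
- by move=> n; apply: mulr_ge0 => //; apply: EE_ge0 => w; exact: sqr_ge0.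
- by move=> n; apply: EE_ge0 => w; exact: potential_ge0.
- move=> n; apply: addr_ge0 => //; apply: mulr_ge0 => //.
  by apply: EE_ge0 => w; exact: sumr_ge0.
- by apply: avg_boundedD; [exact: avg_boundedZ | exact: avg_bounded_cst].
move=> [|n]; rewrite geq_max => /andP[hn _]//=.
pose S n w := outflow (fun _ c => (c0 <= c)%N%:R) n w.
(* More than [x0] jobs cannot be a frozen remnant of the initial state. *)
pose Y i w := (x0 < hi n.+1 i c0 w)%N.
have aTY i l c : adapted (G n i) (fun w => T n.+1 l c w * Y i w)%N.
  apply: (adapted2 (sG n i)) => //.
  exact: (@adapted_comp _ _ _ _ _ (fun m => nat_of_bool (x0 < m)%N) _ (adapted_hi n i i c0)).
have L2TY i l c : L2 P (fun w => (T n.+1 l c w * Y i w)%:R).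
  apply: (L2_dom _ (L2_T n.+1 l c)).
    by apply: adapted_measurable => D; apply: (@GM n i); exact: aTY.
  by apply/aeW => w; rewrite ger0_norm// ler_nat; case: (Y i w); rewrite ?muln1 ?muln0.
have L1GY i : L1 P (fun w => potential g n.+1 w * (Y i w)%:R).
  have -> : (fun w => potential g n.+1 w * (Y i w)%:R) = fun w =>
      \sum_l \sum_(c < cI + n.+1) g l c * (T n.+1 l c w * Y i w)%:R.
    apply/funext => w; rewrite mulr_suml; apply: eq_bigr => l _.
    by rewrite mulr_suml; apply: eq_bigr => c _; rewrite natrM mulrA.
  by do 2! (apply: L1_sum => ? _); apply: L1Z; exact: L2_L1.
have hC i : eps * \int[P]_w (potential g n.+1 w * (Y i w)%:R) <=
    \int[P]_w (potential g n.+1 w * outflow (fun _ c => (c0 <= c)%N%:R) n.+1 w).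
  have L1GYC : L1 P (fun w => \sum_l \sum_(c < cI + n.+1)
      g l c * ((T n.+1 l c w * Y i w)%:R * (C n i w)%:R)).
    by do 2! (apply: L1_sum => ? _); apply: L1Z; exact: L1_coin_mul.
  apply: (@le_trans _ _ (\int[P]_w (\sum_l \sum_(c < cI + n.+1)
      g l c * ((T n.+1 l c w * Y i w)%:R * (C n i w)%:R)))).
    have -> : (fun w => potential g n.+1 w * (Y i w)%:R) = fun w =>
        \sum_l \sum_(c < cI + n.+1) g l c * (T n.+1 l c w * Y i w)%:R.
      apply/funext => w; rewrite mulr_suml; apply: eq_bigr => l _.
      by rewrite mulr_suml; apply: eq_bigr => c _; rewrite natrM mulrA.
    rewrite EE_sum => [|l _]; last by apply: L1_sum => c _; apply: L1Z; exact: L2_L1.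
    rewrite EE_sum => [|l _]; last by apply: L1_sum => c _; apply: L1Z; exact: L1_coin_mul.
    rewrite mulr_sumr; apply: ler_sum => l _.
    rewrite EE_sum => [|c _]; last by apply: L1Z; exact: L2_L1.
    rewrite EE_sum => [|c _]; last by apply: L1Z; exact: L1_coin_mul.
    rewrite mulr_sumr; apply: ler_sum => c _.
    rewrite EEZ; last exact: L2_L1.
    rewrite EEZ; last exact: L1_coin_mul.
    by rewrite mulrCA ler_wpM2l//; exact: EE_coin_ge.
  apply: EE_le => //; first by apply: L2M; [exact: L2_potential | exact: L2_outflow].
  have := pol n; have := cut n.+1; have := BT n.+1.
  apply: filterS3 => w hBT hcut hpol.
  have -> : \sum_l \sum_(c < cI + n.+1)
      g l c * ((T n.+1 l c w * Y i w)%:R * (C n i w)%:R) =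
      potential g n.+1 w * ((Y i w)%:R * (C n i w)%:R).
    rewrite mulr_suml; apply: eq_bigr => l _; rewrite mulr_suml.
    by apply: eq_bigr => c _; rewrite natrM !mulrA.
  apply: ler_wpM2l; first exact: potential_ge0.
  case: (boolP (Y i w)) => [hY|_]; last by rewrite mul0r outflow_ge0.
  case CE : (C n i w); last by rewrite mulr0 outflow_ge0.
  rewrite mul1r; case: (hpol i) => [hf|].
    have : (hi n.+1 i c0 w <= x0)%N.
      rewrite (leq_trans _ (Q0x0 i (cI + n.+1)))// /hi big_mkcond/=.
      by apply: leq_sum => c' _; case: ifP => // _; exact: hf.
    by rewrite leqNgt -/(Y i w) hY.
  have : (0 < hi n.+1 i c0 w)%N by rewrite (leq_ltn_trans _ hY).
  rewrite lt0n /hi sum_nat_eq0 negb_forall_in => /exists_inP[c' c'c].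
  rewrite -lt0n => Tp /(_ _ Tp); rewrite CE => -[l [c'' [c'c'' Bp]]].
  have c''cut : (c'' < cI + n.+1)%N.
    rewrite ltnNge; apply/negP => /(hcut l) T0'.
    by have := hBT l c''; rewrite T0' leqNgt Bp.
  rewrite /outflow (bigD1 l)//= -[leLHS]addr0; apply: lerD; last first.
    by do 2! (apply: sumr_ge0 => ? _); exact: mulr_ge0.
  rewrite (bigD1 (Ordinal c''cut))//= -[leLHS]addr0; apply: lerD; last first.
    by apply: sumr_ge0 => ? _; exact: mulr_ge0.
  by rewrite (leq_trans c'c c'c'') mul1r ler1n.
have hG : \int[P]_w (potential g n.+1 w) <=
    \sum_i \int[P]_w (potential g n.+1 w * (Y i w)%:R) +
    `|kap| * \int[P]_w (\sum_i (lo n.+1 i c0 w)%:R) + `|kap| * (#|I|%:R * x0%:R).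
  rewrite -EE_sum; last by move=> i _; exact: L1GY.
  have h1 : L1 P (fun w => \sum_i potential g n.+1 w * (Y i w)%:R).
    by apply: L1_sum => i _; exact: L1GY.
  have h2 : L1 P (fun w => `|kap| * (\sum_i (lo n.+1 i c0 w)%:R)) by exact: L1Z.
  have h3 := L1_cst P (`|kap| * (#|I|%:R * x0%:R)).
  rewrite -EEZ// -[X in _ <= _ + _ + X](EE_cst P) -EED// -EED//; last exact: L1D.
  apply: EE_le; [exact: L1_potential | by apply: L1D => //; exact: L1D | apply/aeW => w].
  have [/existsP[i Yi]|/existsPn noY] := boolP [exists i, Y i w].
    rewrite (bigD1 i)//= Yi mulr1 -!addrA lerDl !addr_ge0// ?mulr_ge0// ?sumr_ge0//.
    by move=> l _; rewrite mulr_ge0// potential_ge0.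
  rewrite [X in _ <= X + _ + _]big1 ?add0r => [|i _]; last first.
    by rewrite (negbTE (noY i)) mulr0.
  apply: (@le_trans _ _ (`|kap| * (\sum_i (lo n.+1 i c0 w)%:R +
      \sum_i (hi n.+1 i c0 w)%:R))).
    rewrite -!natr_sum -natrD -total_lo_hi /total_jobs natr_sum mulr_sumr.
    apply: ler_sum => i _; rewrite natr_sum mulr_sumr; apply: ler_sum => c _.
    by rewrite ler_wpM2r.
  rewrite -mulrDr ler_wpM2l// lerD2l.
  apply: (@le_trans _ _ (\sum_(i : I) x0%:R)); last by rewrite sumr_const mulr_natl.
  by apply: ler_sum => i _; rewrite ler_nat leqNgt; exact: noY.
have hS : N1 * \int[P]_w (potential g n.+1 w * outflow (fun _ c => (c0 <= c)%N%:R) n.+1 w) >=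
    eps * \sum_i \int[P]_w (potential g n.+1 w * (Y i w)%:R).
  apply: (@le_trans _ _ (\sum_(i : I)
      \int[P]_w (potential g n.+1 w * outflow (fun _ c => (c0 <= c)%N%:R) n.+1 w))).
    by rewrite mulr_sumr; exact: ler_sum.
  rewrite sumr_const -[_ *+ #|I|]mulr_natl ler_wpM2r ?ler_nat//.
  by apply: EE_ge0 => w; rewrite mulr_ge0// ?potential_ge0// outflow_ge0.
have := ler_wpM2l (ltW N1gt0) (hK _ hn).
have := ler_wpM2l (ltW eps0) hG.
have : 2 * N1 * eta * \int[P]_w (potential g n.+1 w) <= eps * \int[P]_w (potential g n.+1 w).
  by apply: ler_wpM2r => //; apply: EE_ge0 => w; exact: potential_ge0.
rewrite /f; move: hS.
move: (\int[P]_w (potential g n.+1 w)) (\int[P]_w (potential g n.+2 w ^+ 2))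
  (\int[P]_w (potential g n.+1 w ^+ 2))
  (\int[P]_w (potential g n.+1 w * outflow (fun _ c => (c0 <= c)%N%:R) n.+1 w))
  (\sum_i \int[P]_w (potential g n.+1 w * (Y i w)%:R)) => u1 u2 u3 u4 u5.
move: (\int[P]_w (\sum_i (lo n.+1 i c0 w)%:R)) => u6.
lra.
Qed.

Lemma hi_le_potential c0 (g : I -> nat -> R) n :
  (forall i c, (c0 <= c)%N%:R <= g i c) ->
  \int[P]_w (total_jobs n w)%:R <=
  \int[P]_w (\sum_i (lo n i c0 w)%:R) + \int[P]_w (potential g n w).
Proof.
move=> hg.
have h1 : L1 P (fun w => \sum_i (lo n i c0 w)%:R).
  by apply: L1_sum => i _; apply: L2_L1; exact: L2_lo.
have h2 : L1 P (fun w => \sum_i (hi n i c0 w)%:R).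
  by apply: L1_sum => i _; apply: L2_L1; exact: L2_hi.
rewrite -EED//; last exact: L1_potential.
apply: EE_le.
- have -> : (fun w => (total_jobs n w)%:R) =
      fun w => \sum_i (lo n i c0 w)%:R + \sum_i (hi n i c0 w)%:R :> R.
    by apply/funext => w; rewrite (total_lo_hi _ c0) natrD !natr_sum.
  exact: L1D.
- by apply: L1D => //; exact: L1_potential.
- apply/aeW => w; rewrite (total_lo_hi _ c0) natrD !natr_sum lerD2l.
  by rewrite -potential_hi; exact: ler_potential.
Qed.

Lemma L1_total n : L1 P (fun w => (total_jobs n w)%:R).
Proof.
have -> : (fun w => (total_jobs n w)%:R) =
    fun w => \sum_i \sum_(c < cI + n) (T n i c w)%:R :> R.
  by apply/funext => w; rewrite natr_sum; apply: eq_bigr => i _; rewrite natr_sum.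
by do 2! (apply: L1_sum => ? _); apply: L2_L1; exact: L2_T.
Qed.

Lemma avg_bounded_total c0 (g : I -> nat -> R) kap :
  0 < eps ->
  (forall i c, 0 <= g i c <= kap) ->
  (forall i c, (c0 <= c)%N%:R <= g i c) ->
  (forall i c, g i c = (c0 <= c)%N%:R + routed_potential g i c) ->
  2 * #|I|.+1%:R * (\sum_i al i * g i 0%N) <= eps ->
  avg_bounded (fun n => \int[P]_w (\sum_i (lo n i c0 w)%:R)) ->
  avg_bounded (fun n => \int[P]_w (total_jobs n w)%:R).
Proof.
move=> eps0 gk g1 gE heta hlo.
apply: le_avg_bounded (avg_boundedD hlo (high_level eps0 gk gE heta hlo)) => n.
exact: hi_le_potential.
Qed.

(** The initial jobs weigh nothing and new ones bring no weight, so [linear_drift] keeps the mean of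
    the nonnegative potential at 0; the low jobs are all that remains. *)
Lemma avg_bounded_total_bounded_routes c0 (g : I -> nat -> R) :
  (forall i c, 0 <= g i c) ->
  (forall i c, (c0 <= c)%N%:R <= g i c) ->
  (forall i c, g i c = (c0 <= c)%N%:R + routed_potential g i c) ->
  (forall i, g i 0%N = 0) ->
  (forall i c, (c < cI)%N -> g i c = 0) ->
  avg_bounded (fun n => \int[P]_w (\sum_i (lo n i c0 w)%:R)) ->
  avg_bounded (fun n => \int[P]_w (total_jobs n w)%:R).
Proof.
move=> g0 g1 gE gz gcI hlo; apply: le_avg_bounded hlo => n.
apply: le_trans (hi_le_potential n g1) _.
suff : \int[P]_w (potential g n w) <= 0 by lra.
elim: n => [|n]; last first.
  apply: le_trans; apply: (@linear_drift g (fun _ c => (c0 <= c)%N%:R)) => //.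
rewrite (_ : potential g 0 = fun=> 0) ?EE_cst//; apply/funext => w.
rewrite /potential big1// => i _; rewrite big1// => c _.
by rewrite gcI ?mul0r// -[ltnRHS]addn0.
Qed.

End Model.

(** * The routing matrix *)

Lemma cvgn_sum (R : realType) I (r : seq I) (u : I -> nat -> R) (l : I -> R) :
  (forall i, u i @ \oo --> l i) ->
  (fun m => \sum_(i <- r) u i m) @ \oo --> \sum_(i <- r) l i.
Proof.
move=> ul; elim: r => [|i r IH].
  rewrite big_nil (_ : (fun m => _) = fun=> 0); first exact: cvg_cst.
  by apply/funext => m; rewrite big_nil.
rewrite big_cons (_ : (fun m => _) = fun m => u i m + \sum_(j <- r) u j m).
  exact: cvgD.
by apply/funext => m; rewrite big_cons.
Qed.

Section RoutingMatrix.
Context (R : realType) (n : nat) (Pr : 'M[R]_n).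
Hypothesis Pr0 : forall i l, 0 <= Pr i l.
Hypothesis Pr1 : forall i, \sum_l Pr i l <= 1.

Lemma expmxS k i l : (Pr ^+ k.+1) i l = \sum_j Pr i j * (Pr ^+ k) j l.
Proof. by rewrite exprS -[_ * _]/(_ *m _) mxE. Qed.

Lemma expmx0 i l : (Pr ^+ 0) i l = (i == l)%:R.
Proof. by rewrite expr0 -[1]/(1%:M) mxE. Qed.

Lemma expmx_ge0 k i l : 0 <= (Pr ^+ k) i l.
Proof.
elim: k i => [|k IH] i; first by rewrite expmx0.
by rewrite expmxS; apply: sumr_ge0 => j _; exact: mulr_ge0.
Qed.

(** Powers of a substochastic matrix are substochastic; rows may sum to less than 1, hence
    [0 <= b]. *)
Lemma expmx_mul_le k (v : 'I_n -> R) (b : R) i : 0 <= b -> (forall l, v l <= b) ->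
  \sum_l (Pr ^+ k) i l * v l <= b.
Proof.
move=> b0 vb; elim: k i => [|k IH] i.
  rewrite (bigD1 i)//= expmx0 eqxx mul1r big1 ?addr0// => l li.
  by rewrite expmx0 eq_sym (negbTE li) mul0r.
have -> : \sum_l (Pr ^+ k.+1) i l * v l =
    \sum_j Pr i j * \sum_l (Pr ^+ k) j l * v l.
  under eq_bigr do rewrite expmxS mulr_suml.
  rewrite exchange_big/=; apply: eq_bigr => j _.
  by rewrite mulr_sumr; apply: eq_bigr => l _; rewrite mulrA.
apply: (@le_trans _ _ (\sum_j Pr i j * b)).
  by apply: ler_sum => j _; rewrite ler_wpM2l.
by rewrite -mulr_suml -[leRHS]mul1r ler_wpM2r.
Qed.

(* Expected number of visits to [A] before the counter index exceeds [c], for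
   a job in buffer [i] with counter index [c']. *)
Definition low_visits (A : pred 'I_n) (c : nat) (i : 'I_n) (c' : nat) : R :=
  \sum_(r < c.+1 - c') \sum_l (Pr ^+ r) i l * (A l)%:R.

Lemma low_visits_bound A c i c' : 0 <= low_visits A c i c' <= c.+1%:R.
Proof.
apply/andP; split.
  by do 2! (apply: sumr_ge0 => ? _); rewrite mulr_ge0// expmx_ge0.
apply: (@le_trans _ _ (\sum_(r < c.+1 - c') 1)).
  by apply: ler_sum => r _; apply: expmx_mul_le => // l; rewrite lern1 leq_b1.
by rewrite sumr_const card_ord ler_nat leq_subr.
Qed.

(** First-step analysis: the term [r = 0] is the present visit, the others begin after one
    routing. *)
Lemma low_visits_rec A c i c' : low_visits A c i c' =
  (A i && (c' < c.+1)%N)%:R + \sum_l Pr i l * low_visits A c l c'.+1.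
Proof.
rewrite /low_visits subSS; have [cc'|cc'] := ltnP c c'.
  have [-> ->] : (c.+1 - c' = 0 /\ c - c' = 0)%N by lia.
  rewrite ltnS leqNgt cc' andbF big_ord0 add0r big1// => l _.
  by rewrite big_ord0 mulr0.
rewrite subSn// big_ord_recl/= ltnS cc' andbT; congr (_ + _).
  rewrite (bigD1 i)//= expmx0 eqxx mul1r big1 ?addr0// => l li.
  by rewrite expmx0 eq_sym (negbTE li) mul0r.
under [RHS]eq_bigr do rewrite mulr_sumr.
rewrite [RHS]exchange_big/=; apply: eq_bigr => r _.
under eq_bigr do rewrite expmxS mulr_suml.
rewrite exchange_big/=; apply: eq_bigr => j _.
by rewrite mulr_sumr; apply: eq_bigr => l _; rewrite mulrA.
Qed.

Lemma low_visits_eq0 A c i c' : (c < c')%N -> low_visits A c i c' = 0.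
Proof.
move=> cc'; rewrite /low_visits; have -> : (c.+1 - c' = 0)%N by lia.
by rewrite big_ord0.
Qed.

Hypothesis Prc : forall i l, cvgn (series (fun k => (Pr ^+ k) i l)).

Variable al : 'cV[R]_n.
Hypothesis al0 : forall i, 0 <= al i 0.

(** For the routing matrix and arrival rates of a network this is [eff_rate]. *)
Definition flow_rate i := limn (series (fun k => (((Pr)^T ^+ k) *m al) i 0)).

Lemma trmx_exp k : (Pr^T ^+ k) = (Pr ^+ k)^T.
Proof.
elim: k => [|k IH]; first by rewrite !expr0 -[1]/(1%:M) trmx1.
by rewrite exprS IH exprSr -[_ * _ in RHS]/(_ *m _) trmx_mul.
Qed.

Lemma flow_term k l : (((Pr)^T ^+ k) *m al) l 0 = \sum_i al i 0 * (Pr ^+ k) i l.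
Proof.
by rewrite mxE trmx_exp; apply: eq_bigr => i _; rewrite mxE mulrC.
Qed.

Lemma flow_rate_ge m l : \sum_(r < m) \sum_i al i 0 * (Pr ^+ r) i l <= flow_rate l.
Proof.
have -> : \sum_(r < m) \sum_i al i 0 * (Pr ^+ r) i l =
    series (fun k => ((Pr^T ^+ k) *m al) l 0) m.
  by rewrite /series/= big_mkord; apply: eq_bigr => r _; rewrite flow_term.
apply: nondecreasing_cvgn_le.
  apply/nondecreasing_seqP => k; rewrite /series/= big_nat_recr//= lerDl flow_term.
  by apply: sumr_ge0 => i _; rewrite mulr_ge0// expmx_ge0.
have -> : series (fun k => ((Pr^T ^+ k) *m al) l 0) =
    (fun m => \sum_i al i 0 * series (fun k => (Pr ^+ k) i l) m).
  apply/funext => k; rewrite /series/=.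
  under eq_bigr do rewrite flow_term.
  by rewrite exchange_big/=; apply: eq_bigr => i _; rewrite mulr_sumr.
apply: (cvgP (\sum_i al i 0 * limn (series (fun k => (Pr ^+ k) i l)))).
by apply: cvgn_sum => i; apply: cvgM; [exact: cvg_cst | exact: Prc].
Qed.

(** Truncating the counter only discards visits, so the gain is at most the full effective rate into
    [A]. When [A] is the set of buffers that need [k] and services have mean 1, that rate is the
    load of [k]. *)
Lemma low_visits_load A c :
  \sum_i al i 0 * low_visits A c i 0 <= \sum_(l | A l) flow_rate l.
Proof.
have -> : \sum_i al i 0 * low_visits A c i 0 =
    \sum_(l | A l) \sum_(r < c.+1) \sum_i al i 0 * (Pr ^+ r) i l.
  rewrite /low_visits subn0.
  under eq_bigr do rewrite mulr_sumr.
  rewrite exchange_big/= [RHS]exchange_big/=; apply: eq_bigr => r _.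
  rewrite [RHS]exchange_big/=; apply: eq_bigr => i _.
  rewrite mulr_sumr [RHS]big_mkcond; apply: eq_bigr => l _ /=.
  by case: (A l); rewrite ?mulr1 ?mulr0.
by apply: ler_sum => l _; exact: flow_rate_ge.
Qed.

(** The mean number of visits from [i] on, the present one included: the row sums of the fundamental
    matrix. *)
Definition total_visits i := \sum_l limn (series (fun k => (Pr ^+ k) i l)).

Lemma total_visits_rec i : total_visits i = 1 + \sum_l Pr i l * total_visits l.
Proof.
have h l : limn (series (fun k => (Pr ^+ k) i l)) =
    (i == l)%:R + \sum_j Pr i j * limn (series (fun k => (Pr ^+ k) j l)).
  have hc : [sequence series (fun k => (Pr ^+ k) i l) (m + 1)%N]_m @ \oo -->
      limn (series (fun k => (Pr ^+ k) i l)).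
    by rewrite (cvg_shiftn 1 (series (fun k => (Pr ^+ k) i l))); exact: Prc.
  have e : [sequence series (fun k => (Pr ^+ k) i l) (m + 1)%N]_m =
      fun m => (i == l)%:R + \sum_j Pr i j * series (fun k => (Pr ^+ k) j l) m.
    apply/funext => m; rewrite /= addn1 /series/= big_nat_recl//= expmx0; congr (_ + _).
    under eq_bigr do rewrite expmxS.
    by rewrite exchange_big/=; apply: eq_bigr => j _; rewrite mulr_sumr.
  rewrite e in hc; rewrite -[LHS](cvg_lim _ hc)//; apply: cvg_lim => //.
  apply: cvgD; first exact: cvg_cst.
  by apply: cvgn_sum => j; apply: cvgM; [exact: cvg_cst | exact: Prc].
rewrite {1}/total_visits (eq_bigr _ (fun l _ => h l)) big_split/=; congr (_ + _).
  by rewrite (bigD1 i)//= eqxx big1 ?addr0// => l li; rewrite eq_sym (negbTE li).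
by rewrite exchange_big; apply: eq_bigr => j _; rewrite -mulr_sumr.
Qed.

Lemma total_visits_ge0 i : 0 <= total_visits i.
Proof.
apply: sumr_ge0 => l _; apply: limr_ge; first exact: Prc.
by apply: nearW => k; apply: sumr_ge0 => j _; exact: expmx_ge0.
Qed.

(* Expected number of visits with counter index at least [c0]. *)
Definition high_visits c0 i c : R := \sum_l (Pr ^+ (c0 - c)) i l * total_visits l.

Lemma high_visits_bound c0 i c : 0 <= high_visits c0 i c <= \sum_l total_visits l.
Proof.
apply/andP; split.
  by apply: sumr_ge0 => l _; rewrite mulr_ge0 ?expmx_ge0 ?total_visits_ge0.
apply: expmx_mul_le => [|l]; first by apply: sumr_ge0 => l _; exact: total_visits_ge0.
rewrite (bigD1 l)//= lerDl; apply: sumr_ge0 => j _; exact: total_visits_ge0.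
Qed.

Lemma high_visits_rec c0 i c :
  high_visits c0 i c = (c0 <= c)%N%:R + \sum_l Pr i l * high_visits c0 l c.+1.
Proof.
have e0 j : \sum_l (Pr ^+ 0) j l * total_visits l = total_visits j.
  rewrite (bigD1 j)//= expmx0 eqxx mul1r big1 ?addr0// => l li.
  by rewrite expmx0 eq_sym (negbTE li) mul0r.
rewrite /high_visits; have [cc|cc] := leqP c0 c.
  have [-> ->] : (c0 - c = 0 /\ c0 - c.+1 = 0)%N by lia.
  by rewrite e0 total_visits_rec; congr (_ + _); apply: eq_bigr => l _; rewrite e0.
rewrite add0r -(subnSK cc).
under eq_bigr do rewrite expmxS mulr_suml.
rewrite exchange_big/=; apply: eq_bigr => j _.
by rewrite mulr_sumr; apply: eq_bigr => l _; rewrite mulrA.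
Qed.

Lemma high_visits_ge c0 i c : (c0 <= c)%N%:R <= high_visits c0 i c.
Proof.
rewrite high_visits_rec lerDl; apply: sumr_ge0 => l _; rewrite mulr_ge0//.
by case/andP: (high_visits_bound c0 l c.+1).
Qed.

Lemma high_visits_eq0 c0 i c d : Pr ^+ d = 0 -> (d <= c0 - c)%N -> high_visits c0 i c = 0.
Proof.
move=> Pd dc; rewrite /high_visits -(subnKC dc) exprD Pd mul0r.
by rewrite big1// => l _; rewrite mxE mul0r.
Qed.

(** The entries of the powers of [Pr] are terms of convergent series, so they tend to 0. *)
Lemma high_visits_small (e : R) : 0 < e ->
  exists c0, \sum_i al i 0 * high_visits c0 i 0 <= e.
Proof.
move=> e0.
have hc : (fun c0 => \sum_i al i 0 * high_visits c0 i 0) @ \oo -->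
    \sum_(i < n) al i 0 * \sum_(l < n) 0 * total_visits l.
  apply: cvgn_sum => i; apply: cvgM; first exact: cvg_cst.
  have -> : (fun c0 => high_visits c0 i 0) =
      fun c0 => \sum_l (Pr ^+ c0) i l * total_visits l.
    by apply/funext => c0; rewrite /high_visits subn0.
  apply: cvgn_sum => l; apply: cvgM; last exact: cvg_cst.
  exact: (cvg_series_cvg_0 (@Prc i l)).
rewrite big1 in hc; last by move=> i _; rewrite big1 ?mulr0// => l _; rewrite mul0r.
have /cvgrPdist_le /(_ e e0) [c0 _ /(_ c0 (leqnn _))] := hc.
rewrite sub0r normrN => /(le_trans (ler_norm _)) h; by exists c0.
Qed.

End RoutingMatrix.

(** * Sample paths at integer times *)

Section Path.
Context (R : realType) (N : network R).
Local Notation Bf := 'I_(nbuf N).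
Local Notation Ac := 'I_(nact N).
Local Notation Cp := 'I_(ncomp N).
Hypothesis beta1 : forall j : Ac, beta j = 1.
Implicit Types (z : config N) (d e : R).

(** The sign conditions under which [flow 0] is the identity in spite of its truncations. *)
Definition clean (z : config N) :=
  (forall i c j, 0 <= V (st z) i c j) /\ (forall h, 0 <= timer (st z) h).

Lemma flow0 z : clean z -> flow 0 z = z.
Proof.
case: z => [[q v t] s e n] [/= v0 t0]; rewrite /flow/=; congr (Config (State _ _ _) _ _ _).
  apply/funext => i; apply/funext => c; apply/funext => j.
  by rewrite mulr0 subr0; apply/max_idPr.
by apply/funext => h; rewrite subr0; apply/max_idPr.
Qed.

Lemma max0B (x d e : R) : 0 <= d ->
  Num.max 0 (Num.max 0 (x - e) - d) = Num.max 0 (x - (d + e)).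
Proof. by move=> d0; rewrite !maxEle; do ! case: ifPn => //; rewrite -?ltNge; lra. Qed.

Lemma flowD d e z : 0 <= d -> flow d (flow e z) = flow (d + e) z.
Proof.
move=> d0; case: z => [[q v t] s c n]; rewrite /flow/=.
congr (Config (State _ _ _) _ _ _).
  apply/funext => i; apply/funext => c'; apply/funext => j.
  by rewrite !beta1 !mul1r max0B.
by apply/funext => h; rewrite max0B.
Qed.

Lemma finishes_flow d e z i c j : 0 < d -> 0 <= e ->
  finishes (flow e z) d i c j = finishes z (d + e) i c j.
Proof.
move=> d0 e0; rewrite /finishes/= !beta1 !mul1r.
set v := V _ _ _ _; rewrite maxEle; case: ifPn => [h|].
  by apply/idP/idP => /andP[h1 /eqP h2]; apply/andP; split; [lra|apply/eqP; lra|lra|apply/eqP; lra].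
rewrite -ltNge ltxx/= => h; apply/esym/negbTE/negP => /andP[_ /eqP h2]; lra.
Qed.

Variable route : Ac -> nat -> option Bf.
Variable run : Cp -> config N -> config N -> Prop.

Lemma act_finishes_flow d e z j : 0 < d -> 0 <= e ->
  act_finishes (flow e z) d j = act_finishes z (d + e) j.
Proof.
move=> d0 e0; rewrite /act_finishes; congr asbool; apply/propext.
by split=> -[i [c h]]; exists i, c; rewrite finishes_flow in h *.
Qed.

Lemma pre_decision_flow a d e z : 0 < d -> 0 <= e ->
  pre_decision route a (flow e z) d = pre_decision route a z (d + e).
Proof.
move=> d0 e0; rewrite /pre_decision flowD ?ltW//.
congr (Config (State _ _ _) _ _ _).
  apply/funext => i; apply/funext => c; congr (_ + _)%N.
  case: c => [|c] //=; apply: eq_bigr => j _.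
  by rewrite finishes_flow.
by apply/funext => j; rewrite /= act_finishes_flow.
Qed.

Lemma comp_event_flow a d e z h : 0 < d -> 0 <= e ->
  comp_event route a (flow e z) d h = comp_event route a z (d + e) h.
Proof.
move=> d0 e0; apply: eq_existsb => i; congr (_ && (_ || _)).
by apply: eq_existsb => j; rewrite act_finishes_flow.
Qed.

Lemma jump_flow a d e z z' : 0 < d -> 0 <= e ->
  jump route run a (flow e z) d z' -> jump route run a z (d + e) z'.
Proof.
move=> d0 e0 [y [y0 yn hy]]; exists y; split => //.
  by rewrite y0 pre_decision_flow.
by move=> h; have := hy h; rewrite comp_event_flow.
Qed.

Lemma flow_jump a d e z z' : 0 < d -> 0 <= e ->
  jump route run a z (d + e) z' -> jump route run a (flow e z) d z'.
Proof.
move=> d0 e0 [y [y0 yn hy]]; exists y; split => //.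
  by rewrite y0 pre_decision_flow.
by move=> h; have := hy h; rewrite comp_event_flow.
Qed.

Definition V01 (z : config N) :=
  forall i c j, V (st z) i c j = 0 \/ V (st z) i c j = 1.

(** A requirement of 0 or 1 cannot run out strictly inside a unit slot, so no component has an event
    and the jump rule reduces to the flow. *)
Lemma jump_noevent z d z' : V01 z -> 0 < d < 1 ->
  jump route run (fun=> 0%N) z d z' -> z' = flow d z.
Proof.
move=> v01 /andP[d0 d1] [y [y0 yn hy]].
have nf i c j : finishes z d i c j = false.
  apply/negP; rewrite /finishes beta1 mul1r => /andP[h /eqP h'].
  by case: (v01 i c j) => e; lra.
have naf j : act_finishes z d j = false.
  by apply/asboolPn => -[i [c]]; rewrite nf.
have e m : (m <= ncomp N)%N -> y m = y 0%N.
  elim: m => // m IH mn; have := hy (Ordinal mn).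
  rewrite /= IH ?(ltnW mn)//; case: ifPn => // /existsP[i /andP[_ /=]].
  by move=> /existsP[j]; rewrite naf.
rewrite -yn e// y0 /pre_decision /flow/=; congr (Config (State _ _ _) _ _ _).
  apply/funext => i; apply/funext => c; case: c => [|c] //=; rewrite ?addn0//.
  by rewrite big1 ?addn0// => j _; rewrite nf.
by apply/funext => j; rewrite naf addn0.
Qed.

(** Continuous induction. Consider the supremum of the times up to which the path is the flow from
    [n]. Below [n.+1] it is attained, because the jump there is void, and then passed, because the
    path flows on a right neighbourhood. *)
Lemma evolves_slot (a : Bf -> R -> nat) (Z : R -> config N) (n : nat) :
  evolves route run a Z -> V01 (Z n%:R) ->
  (forall i t, n%:R < t < n.+1%:R -> a i t = 0%N) ->
  (forall u, n%:R <= u < n.+1%:R -> Z u = flow (u - n%:R) (Z n%:R)) /\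
  jump route run (a ^~ n.+1%:R) (Z n%:R) 1 (Z n.+1%:R).
Proof.
move=> [hs hr hl] v01 ha.
have n0 : 0 <= n%:R :> R by [].
have nS : n.+1%:R = n%:R + 1 :> R by rewrite -natr1.
have cl t : 0 <= t -> clean (Z t).
  by move=> /hs[[hv ht] _]; split => // h; case/andP: (ht h).
(* The jump rule at [t] starts from some [s] on either side of [n]; the semigroup property of the
   flow moves the start to [n]. *)
have left t : n%:R < t -> t <= n.+1%:R ->
    (forall u, n%:R <= u < t -> Z u = flow (u - n%:R) (Z n%:R)) ->
    jump route run (a ^~ t) (Z n%:R) (t - n%:R) (Z t).
  move=> nt tn hu; have [|s [/andP[s0 st] hst hj]] := hl t; first lra.
  have [sn|ns] := ltP s n%:R.
    have -> : Z n%:R = flow (n%:R - s) (Z s) by apply: hst; apply/andP; split; lra.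
    apply: flow_jump; [lra|lra|].
    by have -> : t - n%:R + (n%:R - s) = t - s by ring.
  have -> : t - n%:R = (t - s) + (s - n%:R) by ring.
  apply: jump_flow; [lra|lra|]; rewrite -hu//; apply/andP; split; lra.
pose S := [set u | n%:R <= u < n.+1%:R /\
  forall v, n%:R <= v <= u -> Z v = flow (v - n%:R) (Z n%:R)].
have Sn : S n%:R.
  split; first by apply/andP; split; lra.
  move=> v hv; have -> : v = n%:R by lra.
  by rewrite subrr flow0//; exact: cl.
have Sub : ubound S n.+1%:R by move=> u [/andP[_ /ltW]].
have hS : has_sup S by split; [exists n%:R | exists n.+1%:R].
have s1 : n%:R <= sup S by apply: ub_le_sup => //; case: hS.
have s2 : sup S <= n.+1%:R by apply: ge_sup => //; exists n%:R.
have below u : n%:R <= u < sup S -> Z u = flow (u - n%:R) (Z n%:R).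
  move=> /andP[nu uS]; have [v [_ Sv] uv] := sup_adherent (ltac:(lra) : 0 < sup S - u) hS.
  by apply: Sv; apply/andP; split => //; lra.
have seq : sup S = n.+1%:R.
  apply/eqP; rewrite eq_le s2 leNgt; apply/negP => sn.
  have Zs : Z (sup S) = flow (sup S - n%:R) (Z n%:R).
    have [<-|ne] := eqVneq n%:R (sup S); first by rewrite subrr flow0//; exact: cl.
    have ns : n%:R < sup S by rewrite lt_neqAle ne.
    have := left _ ns s2 below.
    have -> : a^~ (sup S) = fun=> 0%N.
      by apply/funext => i; apply: ha; rewrite ns sn.
    by apply: jump_noevent => //; apply/andP; split; lra.
  have [|dl dl0 hdl] := hr (sup S); first lra.
  (* A time beyond the supremum that stays inside both the right neighbourhood and the slot. *)
  pose u := Num.min (sup S + dl / 2) ((sup S + n.+1%:R) / 2).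
  have u1 : sup S < u by rewrite lt_min; apply/andP; split; lra.
  have u2 : u < n.+1%:R by rewrite gt_min; apply/orP; right; lra.
  have u3 : u < sup S + dl by rewrite gt_min; apply/orP; left; lra.
  suff : S u by move=> /(ub_le_sup (proj2 hS)); lra.
  split; first by apply/andP; split; lra.
  move=> v /andP[nv vu]; have [vs|sv] := ltP v (sup S).
    by apply: below; rewrite nv.
  rewrite hdl; last by apply/andP; split; lra.
  rewrite Zs flowD; last lra.
  by congr flow; ring.
rewrite seq in below; split => //.
have /left : n%:R < n.+1%:R :> R by lra.
move=> /(_ (lexx _) below); have -> // : n.+1%:R - n%:R = 1 :> R by lra.
Qed.

End Path.

(** * Decisions of one component *)

Section Decision.
Context (R : realType) (N : network R).
Local Notation Bf := 'I_(nbuf N).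
Local Notation Ac := 'I_(nact N).
Local Notation Cp := 'I_(ncomp N).
Local Notation comp := (@Defs.comp R N).
Hypothesis HN : network_ok N.
Hypothesis beta1 : forall j : Ac, beta j = 1.
Variable act : Bf -> Ac.
Hypothesis HB1 : forall i, buffer_acts i = [set act i]%SET.
Implicit Types (z : config N) (i : Bf) (j : Ac) (h : Cp).

Lemma buf_act i : buf (act i) = i.
Proof.
have : act i \in buffer_acts i by rewrite HB1 finset.in_set1.
by rewrite finset.inE => /eqP.
Qed.

Lemma act_buf j : act (buf j) = j.
Proof.
have : j \in buffer_acts (buf j) by rewrite finset.inE.
by rewrite HB1 finset.in_set1 => /eqP.
Qed.

Lemma buffer_procs_act i : buffer_procs i = procs (act i).
Proof. by rewrite /buffer_procs HB1 finset.big_set1. Qed.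

Lemma shared_comp i l k : k \in procs (act i) -> k \in procs (act l) -> comp i = comp l.
Proof.
move=> ki kl; apply/eqP/negP => /negP /(comp_indep HN).
rewrite /processor_independent !buffer_procs_act => /fintype.disjointFr.
by move=> /(_ _ ki); rewrite kl.
Qed.

Definition in_service (x : state N) i c : bool := 0 < V x i c (act i).

Definition jobs (x : state N) i c : nat := (Q x i c + in_service x i c)%N.

Lemma in_service_le1 (x : state N) i m : admissible x ->
  (\sum_(c < m) in_service x i c <= 1)%N.
Proof.
move=> [_ uni _].
have [/existsP[c hc]|/existsPn hn] := boolP [exists c : 'I_m, in_service x i c].
  rewrite (bigD1 c)//= hc big1// => c' c'c; apply/eqP; rewrite eqb0; apply/negP => hc'.
  have [/val_inj e] := uni _ _ _ _ _ hc hc'; by rewrite e eqxx in c'c.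
by rewrite big1// => c _; apply/eqP; rewrite eqb0.
Qed.

Lemma active_in_service (x : state N) j : admissible x -> activity_level x j ->
  exists c, in_service x (buf j) c.
Proof.
move=> [own _ _] /asboolP[i [c h]]; exists c.
by rewrite /in_service act_buf -(own _ _ _ h).
Qed.

Lemma nonmaximal_use (x : state N) j k : admissible x ->
  ~~ maximal (activity_level x) j -> k \in procs j -> proc_use (activity_level x) k = 0%N.
Proof.
move=> [_ _ use] /existsPn nm kj; have := use k; have := nm k.
by rewrite kj/=; case: proc_use => [|[|]].
Qed.

Lemma proc_use0 (x : state N) j k : proc_use (activity_level x) k = 0%N ->
  k \in procs j -> ~~ activity_level x j.
Proof.
move=> /eqP; rewrite /proc_use sum_nat_eq0 => /forall_inP h kj.
by have := h j kj; rewrite eqb0.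
Qed.

Lemma nonmaximal_inactive (x : state N) j : admissible x ->
  ~~ maximal (activity_level x) j -> ~~ activity_level x j.
Proof.
move=> ax nm; have /finset.set0Pn[k kj] := procs_neq0 HN j.
exact: (proc_use0 (nonmaximal_use ax nm kj) kj).
Qed.

Lemma unused_nonmaximal (x : state N) j :
  (forall k, k \in procs j -> proc_use (activity_level x) k = 0%N) ->
  ~~ maximal (activity_level x) j.
Proof. by move=> h; apply/existsPn => k; apply/negP => /andP[/h ->]. Qed.

(** The footprint of a decision of [h]: it composes along a run, and it shows that the other
    components are left alone, so that decisions can be chained. *)
Definition decides h z z' : Prop :=
  [/\ admissible (st z'),
      forall i c, jobs (st z') i c = jobs (st z) i c,
      forall i c, in_service (st z) i c -> in_service (st z') i c,
      forall i, comp i != h ->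
        (forall c, Q (st z') i c = Q (st z) i c) /\
        (forall c j, V (st z') i c j = V (st z) i c j) &
      [/\ completed z' = completed z,
          forall h', h' != h -> timer (st z') h' = timer (st z) h' &
          forall h', h' != h -> trials z' h' = trials z h']].

Lemma decides_refl h z : admissible (st z) -> decides h z z.
Proof. by []. Qed.

Lemma decides_trans h z1 z2 z3 : decides h z1 z2 -> decides h z2 z3 -> decides h z1 z3.
Proof.
move=> [a1 b1 c1 d1 [e1 f1 g1]] [a2 b2 c2 d2 [e2 f2 g2]]; split => //.
- by move=> i c; rewrite b2.
- by move=> i c /c1 /c2.
- move=> i hi; have [p1 q1] := d1 i hi; have [p2 q2] := d2 i hi.
  by split => *; rewrite ?p2 ?q2.
- by split; [rewrite e2 | move=> h' hh; rewrite f2// f1 | move=> h' hh; rewrite g2// g1].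
Qed.

Variable serv : Ac -> nat -> R.
Hypothesis serv0 : forall j n, 0 < serv j n.

Lemma start_in_service j c z i c' : in_service (st (start serv j c z)) i c' =
  ((i == buf j) && (c' == c)) || in_service (st z) i c'.
Proof.
rewrite /in_service/=; have [->|ij] := eqVneq i (buf j) => //=.
by rewrite act_buf eqxx andbT; case: eqP => //= _; rewrite serv0.
Qed.

Lemma start_active j c z j' : activity_level (st (start serv j c z)) j' =
  (j' == j) || activity_level (st z) j'.
Proof.
apply/idP/idP.
  move=> /asboolP[i [c' /=]]; case: ifP => [/and3P[_ _ ->]//|_ h].
  by apply/orP; right; apply/asboolP; exists i, c'.
case: eqVneq => [-> _|j'j /= /asboolP[i [c' h]]].
  by apply/asboolP; exists (buf j), c; rewrite /= !eqxx/=.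
by apply/asboolP; exists i, c'; rewrite /= (negbTE j'j) !andbF.
Qed.

Lemma start_decides h j c z : admissible (st z) -> comp (buf j) = h ->
  ~~ maximal (activity_level (st z)) j -> (0 < Q (st z) (buf j) c)%N ->
  decides h z (start serv j c z) /\ in_service (st (start serv j c z)) (buf j) c.
Proof.
move=> az jh nm Qp; have ina := nonmaximal_inactive az nm.
have nob i c' : 0 < V (st z) i c' j -> False.
  by move=> hV; move/negP: ina; apply; apply/asboolP; exists i, c'.
split; last by rewrite start_in_service !eqxx.
have [own uni use] := az.
split.
- split.
  + by move=> i c' j' /=; case: ifP => [/and3P[/eqP -> _ /eqP ->]|_ /own].
  + move=> j' i c1 i' c1' /=.
    case: ifP => [/and3P[/eqP -> /eqP -> /eqP ->] _|n1 h1].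
      by case: ifP => [/and3P[/eqP -> /eqP -> _]//|_ /nob].
    case: ifP => [/and3P[_ _ /eqP ej]|n2 h2]; first by rewrite ej in h1; case: (nob _ _ h1).
    exact: uni h1 h2.
  + move=> k; rewrite /proc_use.
    under eq_bigr do rewrite start_active.
    have [kj|kj] := boolP (k \in procs j).
      have := nonmaximal_use az nm kj; rewrite /proc_use (bigD1 j)//= => /eqP.
      rewrite addn_eq0 => /andP[_ /eqP h0].
      rewrite (bigD1 j)//= eqxx/= (eq_bigr (fun j' => activity_level (st z) j' : nat)).
        by rewrite h0.
      by move=> j' /andP[_ /negbTE ->].
    rewrite (eq_bigr (fun j' => activity_level (st z) j' : nat)); first exact: use.
    by move=> j' kj'; case: eqVneq kj kj' => //= -> /negP.
- move=> i c'; rewrite /jobs start_in_service /=.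
  case: ifP => //= /andP[/eqP -> /eqP ->].
  have -> : in_service (st z) (buf j) c = false.
    by apply/negP; rewrite /in_service act_buf => /nob.
  by rewrite addn0 addn1 prednK.
- by move=> i c' hs; rewrite start_in_service hs orbT.
- move=> i hi; have ij : i == buf j = false.
    by apply/negP => /eqP e; rewrite e jh eqxx in hi.
  by split => * /=; rewrite ij.
- by split.
Qed.

Lemma lrfs_nonmaxP h z j : lrfs_nonmax h z j ->
  comp (buf j) = h /\ ~~ maximal (activity_level (st z)) j.
Proof.
rewrite /lrfs_nonmax /maximal_wrt negb_or => /andP[+ ->].
by rewrite /comp_queue; case: (comp (buf j) =P h) => [-> //|_]; rewrite eqxx.
Qed.

Lemma lrfs_decides h z z' : lrfs_run serv h z z' -> admissible (st z) -> decides h z z'.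
Proof.
elim=> [x _|x j c y nm Qp _ _ IH] ax; first exact: decides_refl.
have [jh nmx] := lrfs_nonmaxP nm.
have [d1 _] := start_decides ax jh nmx Qp.
by apply: (decides_trans d1); apply: IH; case: d1.
Qed.

Lemma queue_gt0 (x : state N) i c : (0 < Q x i c)%N -> queue x i != 0%E.
Proof.
move=> Qp; rewrite gt_eqF// /queue.
apply: (@lt_le_trans _ _ (\sum_(0 <= c' < c.+1) (Q x i c')%:R%:E)%E).
  rewrite sumEFin lte_fin big_nat_recr//= ltr_wpDl ?ltr0n//.
  by apply: sumr_ge0.
by apply: nneseries_lim_ge => n _ _; rewrite lee_fin.
Qed.

(** By induction on the run. If the first job started shares a processor with [act i], it is the
    witness, its counter being minimal among the eligible jobs. Otherwise the processors of [act i]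
    stay free, the job of [i] keeps waiting, and the rest of the run applies. *)
Lemma lrfs_priority h z z' i c : lrfs_run serv h z z' -> admissible (st z) ->
  comp i = h -> (0 < Q (st z) i c)%N -> ~~ maximal (activity_level (st z)) (act i) ->
  exists l c' k, [/\ (c' <= c)%N, k \in procs (act l), k \in procs (act i) &
    in_service (st z') l c'].
Proof.
move=> run; elim: run => [x hx|x j c1 y nm Qp cmin hrun IH] ax ih Qi nmi.
  have := hx (act i); rewrite /lrfs_nonmax /maximal_wrt (negbTE nmi) orbF negbK.
  by rewrite /comp_queue buf_act ih eqxx (negbTE (queue_gt0 Qi)).
have [jh nmx] := lrfs_nonmaxP nm.
have [d1 s1] := start_decides ax jh nmx Qp.
have ax1 : admissible (st (start serv j c1 x)) by case: d1.
have [_ _ mono _ _] := lrfs_decides hrun ax1.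
have c1c : (c1 <= c)%N.
  apply: (cmin (act i)); last by rewrite buf_act.
  by rewrite /lrfs_nonmax /maximal_wrt negb_or nmi andbT /comp_queue buf_act ih eqxx (queue_gt0 Qi).
have [/existsP[k /andP[kj ki]]|/existsPn nk] :=
    boolP [exists k, (k \in procs j) && (k \in procs (act i))].
  by exists (buf j), c1, k; rewrite act_buf; split => //; exact: mono.
apply: IH => //.
  (* The job started does not come from [i]: otherwise [j] would be [act i], which shares its
     nonempty set of processors with itself. *)
  rewrite /=; case: ifP => // /andP[/eqP e _]; move: (nk).
  have /finset.set0Pn[k kj] := procs_neq0 HN j.
  by move=> /(_ k); rewrite e act_buf kj.
apply: unused_nonmaximal => k ki; rewrite -[RHS](nonmaximal_use ax nmi ki).
rewrite /proc_use; apply: eq_bigr => j' kj'; rewrite start_active.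
by case: eqVneq kj' => //= -> kj; have := nk k; rewrite kj ki.
Qed.

Variable coin : Cp -> nat -> bool.

Definition coin_outcome (p : policy R) h z : bool :=
  if p is EpsLRFS _ then coin h (trials z h) else false.

(* Guaranteed by the policy whenever a job with counter index [c] waits in
   buffer [i] just before the decision; [b] is the outcome of the coin. *)
Definition served (b : bool) (x : state N) i c : Prop :=
  if b then exists l c', [/\ (c <= c')%N, comp l = comp i & in_service x l c']
  else exists l c' k, [/\ (c' <= c)%N, k \in procs (act l), k \in procs (act i) &
                          in_service x l c'].

(** The conditions on [V] and the timer are what a full unit of time brings about in a synchronized
    network: all processors of the component are free, and the timer has expired, so that a waiting
    job always triggers the coin. *)
Lemma policy_decides (p : policy R) h z z' :
  policy_run p serv coin h z z' -> admissible (st z) ->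
  (forall i, comp i = h -> forall c j, V (st z) i c j = 0) -> timer (st z) h = 0 ->
  decides h z z' /\ forall i c, comp i = h -> (0 < Q (st z) i c)%N ->
    served (coin_outcome p h z) (st z') i c.
Proof.
move=> hrun az V0 t0.
have unused i : comp i = h -> ~~ maximal (activity_level (st z)) (act i).
  move=> ih; apply: unused_nonmaximal => k ki.
  rewrite /proc_use big1// => j kj; apply/eqP; rewrite eqb0; apply/negP.
  move=> /(active_in_service az)[c]; rewrite /in_service V0 ?ltxx//.
  by rewrite -ih; apply: (@shared_comp _ _ k) => //; rewrite act_buf.
case: p hrun => [|eps] /= hrun.
  split; first exact: lrfs_decides hrun az.
  by move=> i c ih Qi; exact: lrfs_priority hrun az ih Qi (unused i ih).
case: hrun => y htr hl.
(* After a success a job with the largest counter is in service; after a failure all that LRFS looks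
   at is unchanged, so [lrfs_priority] applies from [y]. *)
suff [dy hy] : decides h z y /\ forall i c, comp i = h -> (0 < Q (st z) i c)%N ->
    if coin h (trials z h) then
      exists l c', [/\ (c <= c')%N, comp l = h & in_service (st y) l c']
    else Q (st y) = Q (st z) /\ V (st y) = V (st z).
  have ay : admissible (st y) by case: dy.
  have dl := lrfs_decides hl ay.
  split=> [|i c ih Qi]; first exact: decides_trans dy dl.
  rewrite /served; have := hy i c ih Qi; case: (coin _ _).
    move=> [l [c' [cc' lh s']]]; exists l, c'; split => //; first by rewrite lh ih.
    by case: dl => _ _ mono _ _; exact: mono.
  move=> [eQ eV].
  have eA : activity_level (st y) = activity_level (st z).
    by rewrite /activity_level eV.
  by apply: (lrfs_priority hl ay ih); rewrite ?eQ ?eA// unused.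
have start_all i c j : largest_counter h (st z) i c -> nonmax_act z i j ->
    decides h z (start serv j c z) /\ in_service (st (start serv j c z)) i c.
  move=> [ih Qi _] /andP[]; rewrite finset.inE => /eqP ji nm.
  by rewrite -ji in ih Qi *; exact: start_decides.
have use_all z1 : decides h z z1 -> decides h z (use_trial h z1).
  move=> [a b c e [f g k]]; split => //; split => // h' hh /=.
    by rewrite (negbTE hh) g.
  by rewrite (negbTE hh) addn0 k.
case: htr start_all use_all unused V0 t0 az => {z hl}.
- by move=> z Q0 _ _ _ _ _ az; split=> // i c /Q0 ->.
- move=> z i c [ih Qi _] hno _ _ unused _ t0 _; exfalso; case: hno => [/(_ (act i))|].
    by rewrite /nonmax_act finset.inE buf_act eqxx unused.
  by rewrite t0 eqxx.
- move=> z i c j hlc _ hj hc start_all use_all _ _ _ _.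
  have [d1 s1] := start_all _ _ _ hlc hj.
  split; first exact: (use_all _ d1).
  move=> i' c' i'h Qi'; rewrite hc; exists i, c.
  by case: hlc => ih _ hmax; split => //; exact: hmax Qi'.
- move=> z i c j hlc _ hj hc start_all use_all _ _ _ az.
  split; first by apply: use_all; exact: decides_refl.
  by move=> i' c' _ _; rewrite (negbTE hc).
Qed.

End Decision.

(** * From one integer time to the next *)

Section Trajectory.
Context (R : realType) (N : network R).
Local Notation Bf := 'I_(nbuf N).
Local Notation Ac := 'I_(nact N).
Local Notation Cp := 'I_(ncomp N).
Local Notation comp := (@Defs.comp R N).
Hypothesis HN : network_ok N.
Hypothesis beta1 : forall j : Ac, beta j = 1.
Variable act : Bf -> Ac.
Hypothesis HB1 : forall i, buffer_acts i = [set act i]%SET.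
Implicit Types (z : config N) (i : Bf) (j : Ac) (h : Cp).
Variables (route : Ac -> nat -> option Bf) (serv : Ac -> nat -> R).
Variables (coin : Cp -> nat -> bool) (p : policy R).
Hypothesis serv0 : forall j n, 0 < serv j n.

Local Notation in_service := (in_service act).
Local Notation jobs := (jobs act).
Local Notation served := (served act).

Lemma served_mono b (x y : state N) i c :
  (forall l c', in_service x l c' -> in_service y l c') ->
  served b x i c -> served b y i c.
Proof.
move=> mono; case: b => /=.
  by move=> [l [c' [h1 h2 /mono h3]]]; exists l, c'.
by move=> [l [c' [k [h1 h2 h3 /mono h4]]]]; exists l, c', k.
Qed.

Lemma pre_decision_V (a : Bf -> nat) z i c j : V01 z ->
  V (st (pre_decision route a z 1)) i c j = 0.
Proof.
move=> v01 /=; rewrite beta1 mulr1; apply/max_idPl.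
by case: (v01 i c j) => ->; lra.
Qed.

Lemma finishes1 z i c j : V01 z -> finishes z 1 i c j = (0 < V (st z) i c j).
Proof.
move=> v01; rewrite /finishes beta1 mulr1.
by case: (v01 i c j) => ->; rewrite ?ltxx// eqxx andbT.
Qed.

Lemma act_finishes1 z i c : V01 z -> in_service (st z) i c -> act_finishes z 1 (act i).
Proof. by move=> v01 s; apply/asboolP; exists i, c; rewrite finishes1. Qed.

Lemma pre_decision_Q (a : Bf -> nat) z i c : V01 z ->
  Q (st (pre_decision route a z 1)) i c = (Q (st z) i c +
    (if c is c'.+1 then \sum_l in_service (st z) l c' *
        (route (act l) (completed z (act l)) == Some i) else a i))%N.
Proof.
move=> v01 /=; case: c => [|c] /=; rewrite addn0//; congr addn.
rewrite /next_buf (reindex_onto act (@buf R N)) => [|j _]; last exact: act_buf.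
rewrite [LHS]big_mkcond; apply: eq_bigr => l _.
rewrite (buf_act HB1) eqxx andbT finishes1//.
by case: ifP => _; rewrite ?muln1 ?muln0.
Qed.

(** Decisions change no number of jobs, so the balance is that of arrivals, completions and routing.
    In a component without an event nothing was in service, since any service would end with the
    slot. *)
Lemma jump_jobs (a : Bf -> nat) z z' : V01 z -> admissible (st z) ->
  in_state_space (st z) -> jump route (policy_run p serv coin) a z 1 z' ->
  (forall i c, jobs (st z') i c + in_service (st z) i c = jobs (st z) i c +
    (if c is c'.+1 then \sum_l in_service (st z) l c' *
        (route (act l) (completed z (act l)) == Some i) else a i))%N /\
  (forall i, ((forall l c, comp l = comp i -> in_service (st z) l c = false) /\
              (forall c, jobs (st z') i c = jobs (st z) i c)) \/
             forall c, (0 < jobs (st z') i c)%N ->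
               served (coin_outcome coin p (comp i) z) (st z') i c).
Proof.
move=> v01 az [_ tz] [y [y0 yn hy]].
set z0 := pre_decision route a z 1 in y0.
have V0 i c j : V (st z0) i c j = 0 by exact: pre_decision_V.
have B0 i c : in_service (st z0) i c = false by rewrite /in_service V0 ltxx.
have az0 : admissible (st z0).
  split=> [i c j|j i c i' c'|k]; rewrite ?V0 ?ltxx//.
  rewrite /proc_use big1// => j _; apply/eqP; rewrite eqb0; apply/asboolPn.
  by move=> [i [c]]; rewrite V0 ltxx.
have jE i c : jobs (st z0) i c = Q (st z0) i c by rewrite /jobs B0 addn0.
(* Components from [m] on still look as before any decision; earlier ones keep what they were
   granted, because decisions never take a job out of service. *)
have inv m : (m <= ncomp N)%N -> [/\ admissible (st (y m)),
    forall i c, jobs (st (y m)) i c = jobs (st z0) i c,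
    forall h, (m <= h)%N ->
      [/\ forall i, comp i = h -> (forall c, Q (st (y m)) i c = Q (st z0) i c) /\
             (forall c j, V (st (y m)) i c j = 0),
          timer (st (y m)) h = 0 & trials (y m) h = trials z h] &
    forall h, (h < m)%N -> comp_event route a z 1 h ->
      forall i c, comp i = h -> (0 < Q (st z0) i c)%N ->
      served (coin_outcome coin p h z) (st (y m)) i c].
  elim: m => [_|m IH mn].
    rewrite y0; split => // h _; split => //.
    by rewrite /=; apply/max_idPl; case/andP: (tz h) => _; lra.
  have [a1 b1 c1 d1] := IH (ltnW mn).
  have := hy (Ordinal mn); case: ifPn => [hev hrun|hev /= ->].
    have [V1 t1 n1] := c1 (Ordinal mn) (leqnn m).
    have [|[a2 b2 c2 d2 [e2 f2 g2]] hs] := policy_decides HN HB1 serv0 hrun a1 _ t1.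
      by move=> i /V1[].
    split => //.
    - by move=> i c; rewrite b2.
    - move=> h mh; have [V1' t1' n1'] := c1 h (ltnW mh).
      have hm : h != Ordinal mn by apply/eqP => e; rewrite e/= ltnn in mh.
      split; [|by rewrite f2|by rewrite g2].
      move=> i ih; have [q1 v1] := V1' i ih.
      have [|q2 v2] := d2 i; first by rewrite ih.
      by split=> *; rewrite ?q2 ?v2.
    - move=> h; rewrite ltnS leq_eqVlt => /orP[/eqP hm|hm] hevh i c ih Qi.
        have eh : h = Ordinal mn by apply: val_inj.
        rewrite eh; have /= := hs i c; rewrite -eh => /(_ ih).
        have [/(_ i ih)[-> _] _ _] := c1 h (eq_leq (esym hm)).
        move=> /(_ Qi); rewrite /coin_outcome; case: (p) => [|?] //.
        by have [_ _ ->] := c1 h (eq_leq (esym hm)).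
      by apply: (served_mono c2); exact: d1.
  split => //; first by move=> h mh; exact: c1 (ltnW mh).
  move=> h; rewrite ltnS leq_eqVlt => /orP[/eqP hm|hm] hevh; last exact: d1.
  have eh : h = Ordinal mn by apply: val_inj.
  by rewrite eh (negbTE hev) in hevh.
have [a1 b1 _ d1] := inv _ (leqnn _).
rewrite yn in a1 b1 d1.
have T i c : (jobs (st z') i c + in_service (st z) i c = jobs (st z) i c +
    (if c is c'.+1 then \sum_l in_service (st z) l c' *
        (route (act l) (completed z (act l)) == Some i) else a i))%N.
  by rewrite b1 jE pre_decision_Q// /jobs addnAC.
split=> // i; have [hev|hev] := boolP (comp_event route a z 1 (comp i)).
  right=> c; rewrite b1 jE => Qi; apply: d1 => //; exact: ltn_ord.
left.
have nev l : comp l = comp i -> a l = 0%N /\ forall j, act_finishes z 1 j ->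
    buf j != l /\ next_buf route z j != Some l.
  move=> li; move/existsPn: hev => /(_ l); rewrite li eqxx /= negb_or.
  rewrite -eqn0Ngt => /andP[/eqP -> /existsPn h]; split => // j fj.
  by have := h j; rewrite fj /= negb_or => /andP[].
have nos l c : comp l = comp i -> in_service (st z) l c = false.
  move=> li; apply/negP => /(act_finishes1 v01) fl.
  by have [_ /(_ _ fl)[]] := nev l li; rewrite (buf_act HB1) eqxx.
split=> // c; have := T i c; rewrite nos// addn0 => ->.
have [ai hn] := nev i erefl.
case: c => [|c]; first by rewrite ai addn0.
rewrite big1 ?addn0// => l _; case sl : (in_service (st z) l c); rewrite ?mul0n//.
by have [_ /negbTE] := hn _ (act_finishes1 v01 sl); rewrite /next_buf => ->; rewrite muln0.
Qed.

Variables (a : nat -> Bf -> nat) (Z : nat -> config N).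
Hypothesis Z01 : forall n, V01 (Z n).
Hypothesis Zadm : forall n, admissible (st (Z n)).
Hypothesis Zsp : forall n, in_state_space (st (Z n)).
Hypothesis Zjump : forall n, jump route (policy_run p serv coin) (a n) (Z n) 1 (Z n.+1).

(** New jobs come with an event, and a decision in the presence of a waiting job leaves some service
    in the component. So an idle component holds only jobs that have waited since the start. *)
Lemma jobs_or_initial n h : (exists i c, comp i = h /\ in_service (st (Z n)) i c) \/
  forall i c, comp i = h -> (jobs (st (Z n)) i c <= Q (st (Z 0)) i c)%N.
Proof.
elim: n => [|n IH].
  have [[i [c hb]]|hn] := pselect (exists i c, comp i = h /\ in_service (st (Z 0)) i c).
    by left; exists i, c.
  right=> i c ih; rewrite /jobs; case sl : in_service; last by rewrite addn0.
  by exfalso; apply: hn; exists i, c.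
have [_ hp] := jump_jobs (Z01 n) (Zadm n) (Zsp n) (Zjump n).
have [hb|hn] := pselect (exists i c, comp i = h /\ in_service (st (Z n.+1)) i c).
  by left.
right=> i c ih; have [[nos ->]|hs] := hp i.
  case: IH => [[l [c' [lh]]]|->//]; rewrite nos//; by rewrite lh ih.
have [->//|jp] := posnP (jobs (st (Z n.+1)) i c).
exfalso; apply: hn; have := hs c jp; rewrite /served; case: coin_outcome.
  by move=> [l [c' [_ li s]]]; exists l, c'; rewrite li.
move=> [l [c' [k [_ kl ki s]]]]; exists l, c'; split=> //.
by rewrite -ih; exact: (shared_comp HN HB1 kl ki).
Qed.

Lemma frozen_or_served n i :
  (forall c, (jobs (st (Z n.+1)) i c <= Q (st (Z 0)) i c)%N) \/
  forall c, (0 < jobs (st (Z n.+1)) i c)%N ->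
    served (coin_outcome coin p (comp i) (Z n)) (st (Z n.+1)) i c.
Proof.
have [_ hp] := jump_jobs (Z01 n) (Zadm n) (Zsp n) (Zjump n).
have [[nos hj]|hs] := hp i; last by right.
left=> c; rewrite hj; have [[l [c' [lh]]]|h] := jobs_or_initial n (comp i).
  by rewrite nos.
exact: h.
Qed.

Lemma jobs_counter_bound cI : (forall i c, (cI <= c)%N -> jobs (st (Z 0)) i c = 0%N) ->
  forall n i c, (cI + n <= c)%N -> jobs (st (Z n)) i c = 0%N.
Proof.
move=> h0; elim=> [|n IH] i c; first by rewrite addn0; exact: h0.
rewrite addnS; case: c => // c cc.
have [/(_ i c.+1) h _] := jump_jobs (Z01 n) (Zadm n) (Zsp n) (Zjump n).
have ns l c' : (cI + n <= c')%N -> in_service (st (Z n)) l c' = false.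
  by move=> /(IH l) /eqP; rewrite /jobs addn_eq0 eqb0 => /andP[_ /negbTE].
move: h; rewrite (IH i c.+1) ?ns ?addn0 ?add0n//; try by rewrite ltnW.
by move=> ->; rewrite big1// => l _; rewrite ns.
Qed.

End Trajectory.

(** * The norm of the state within a slot *)

Section StateNorm.
Context (R : realType) (N : network R).
Hypothesis beta1 : forall j : 'I_(nact N), beta j = 1.
Variable act : 'I_(nbuf N) -> 'I_(nact N).
Hypothesis HB1 : forall i, buffer_acts i = [set act i]%SET.

(** A waiting job counts for 1, and a job in service for its remaining requirement, which is at most
    1. *)
Lemma state_norm_flow (z : config N) (d : R) m : V01 z -> admissible (st z) ->
  0 <= d -> (forall i c, (m <= c)%N -> jobs act (st z) i c = 0%N) ->
  (state_norm (st (flow d z)) <= (\sum_i \sum_(c < m) jobs act (st z) i c)%N%:R%:E)%E.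
Proof.
move=> v01 [own _ _] d0 hm.
have fin (u : nat -> R) : (forall c, (m <= c)%N -> u c = 0) ->
    (\sum_(0 <= c <oo) (u c)%:E = EFin (\sum_(c < m) u c)%R)%E.
  move=> u0; apply/cvg_lim => //; apply: cvg_near_cst; exists m => // k /= mk.
  rewrite sumEFin (big_cat_nat _ (n := m))//= big_mkord.
  by rewrite [X in _ + X]big_nat [X in _ + X]big1 ?addr0// => c /andP[mc _]; exact: u0.
have Q0 i c : (m <= c)%N -> Q (st z) i c = 0%N.
  by move=> /(hm i) /eqP; rewrite /jobs addn_eq0 => /andP[/eqP].
have B0 i c : (m <= c)%N -> in_service act (st z) i c = false.
  by move=> /(hm i) /eqP; rewrite /jobs addn_eq0 eqb0 => /andP[_ /negbTE].
have Vle i c j : V (st (flow d z)) i c j <=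
    (if j == act i then (in_service act (st z) i c)%:R else 0).
  rewrite /= beta1 mul1r ge_max; case: eqVneq => [->|ji].
    rewrite ler0n/= /in_service; case: (v01 i c (act i)) => ->; rewrite ?ltxx ?ltr01/=; lra.
  rewrite lexx/=; suff -> : V (st z) i c j = 0 by lra.
  case: (v01 i c j) => // e; have /own ib : 0 < V (st z) i c j by rewrite e.
  by rewrite ib (act_buf HB1) eqxx in ji.
have V0 i c j : 0 <= V (st (flow d z)) i c j by rewrite /= le_max lexx.
rewrite /state_norm.
have -> : (\sum_i \sum_(0 <= c <oo) (Q (st (flow d z)) i c)%:R%:E =
    EFin (\sum_i \sum_(c < m) (Q (st z) i c)%:R)%R :> \bar R)%E.
  rewrite -sumEFin; apply: eq_bigr => i _; rewrite fin// => c mc /=.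
  by rewrite Q0.
have -> : (\sum_i \sum_j \sum_(0 <= c <oo) (V (st (flow d z)) i c j)%:E =
    EFin (\sum_i \sum_j \sum_(c < m) V (st (flow d z)) i c j)%R)%E.
  rewrite -sumEFin; apply: eq_bigr => i _; rewrite -sumEFin; apply: eq_bigr => j _.
  rewrite fin// => c mc; apply/eqP; rewrite eq_le V0 andbT (le_trans (Vle i c j))//.
  by rewrite B0//; case: ifP.
rewrite -EFinD lee_fin natr_sum -big_split; apply: ler_sum => i _ /=.
rewrite natr_sum.
have -> : \sum_(c < m) (jobs act (st z) i c)%:R =
    \sum_(c < m) (Q (st z) i c)%:R + \sum_(c < m) (in_service act (st z) i c)%:R :> R.
  by rewrite -big_split; apply: eq_bigr => c _; rewrite natrD.
rewrite lerD2l exchange_big; apply: ler_sum => c _ /=.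
apply: (@le_trans _ _ (\sum_j (if j == act i then (in_service act (st z) i c)%:R else 0))).
  by apply: ler_sum => j _; exact: Vle.
by rewrite -big_mkcond big_pred1_eq.
Qed.

End StateNorm.

(** * Information and independence *)

Section IndependentIntegral.
Context (R : realType) (d : measure_display) (Om : measurableType d).
Variable P : probability Om R.

Lemma integral_mrestr_ge0 (K : set Om) (mK : measurable K) (f : Om -> \bar R) :
  measurable_fun setT f -> (forall w, 0 <= f w)%E ->
  (\int[mrestr P mK]_w f w = \int[P]_(w in K) f w)%E.
Proof.
move=> mf f0.
rewrite (@ge0_negligible_integral _ _ _ _ setT (~` K))//; last 2 first.
- exact: measurableC.
- by rewrite /= /mrestr setICl measure0.
rewrite setTD setCK; apply: eq_measure_integral => A mA AK.
by rewrite /= /mrestr setIidl.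
Qed.

(** Both sides are integrals of [h] over a law of [f]: restricting [P] to [K] only scales that law
    by [P K]. *)
Lemma integral_independent_ge0 (K : set Om) (f : Om -> R) (h : R -> \bar R) :
  measurable K -> measurable_fun setT f -> measurable_fun setT h ->
  (forall r, 0 <= h r)%E ->
  (forall D : set R, measurable D -> P (f @^-1` D `&` K) = P K * P (f @^-1` D))%E ->
  (\int[P]_(w in K) h (f w) = P K * \int[P]_w h (f w))%E.
Proof.
move=> mK mf mh h0 ind.
have hPK : (0 <= fine (P K))%R by exact: fine_ge0.
have ePK : (fine (P K))%:E = P K by rewrite fineK// fin_num_measure.
pose F : {mfun Om >-> R} := mfun_Sub (mem_set mf : f \in mfun).
rewrite -(integral_mrestr_ge0 mK); [|exact: measurableT_comp|by []].
have -> : (\int[mrestr P mK]_w h (f w) = \int[pushforward (mrestr P mK) F]_y h y)%E.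
  by rewrite ge0_integral_pushforward//= preimage_setT.
have -> : (\int[P]_w h (f w) = \int[pushforward P F]_y h y)%E.
  by rewrite ge0_integral_pushforward//= preimage_setT.
rewrite -[in RHS]ePK -(@ge0_integral_mscale _ _ _ _ _ measurableT (NngNum hPK))//.
apply: eq_measure_integral => A mA _.
by rewrite /= /mscale/= ePK /pushforward -ind// /mrestr.
Qed.

Lemma integral_independent (K : set Om) (f : Om -> R) :
  measurable K -> L1 P f ->
  (forall D : set R, measurable D -> P (f @^-1` D `&` K) = P K * P (f @^-1` D))%E ->
  (\int[P]_(w in K) (f w)%:E = P K * \int[P]_w (f w)%:E)%E.
Proof.
move=> mK hf ind; have mf := L1_measurable hf.
have e (D : set Om) : (\int[P]_(w in D) (f w)%:E =
    \int[P]_(w in D) ((EFin : R -> \bar R)^\+ (f w)) -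
    \int[P]_(w in D) ((EFin : R -> \bar R)^\- (f w)))%E.
  rewrite integralE; congr (_ - _)%E; apply: eq_integral => w _.
    by rewrite !funeposE.
  by rewrite !funenegE.
have hp : (\int[P]_(w in K) ((EFin : R -> \bar R)^\+ (f w)) =
    P K * \int[P]_w ((EFin : R -> \bar R)^\+ (f w)))%E.
  by apply: integral_independent_ge0 => //; exact: measurable_funepos.
have hn : (\int[P]_(w in K) ((EFin : R -> \bar R)^\- (f w)) =
    P K * \int[P]_w ((EFin : R -> \bar R)^\- (f w)))%E.
  by apply: integral_independent_ge0 => //; exact: measurable_funeneg.
have ep : (\int[P]_w (EFin \o f)^\+ w = \int[P]_w ((EFin : R -> \bar R)^\+ (f w)))%E.
  by apply: eq_integral => w _; rewrite !funeposE.
have en : (\int[P]_w (EFin \o f)^\- w = \int[P]_w ((EFin : R -> \bar R)^\- (f w)))%E.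
  by apply: eq_integral => w _; rewrite !funenegE.
have hd := integrable_add_def measurableT hf; rewrite ep en in hd.
have fK : P K \is a fin_num by exact: fin_num_measure.
by rewrite (e K) hp hn -muleBr//; congr (_ * _)%E; exact: esym (e setT).
Qed.

End IndependentIntegral.

(** * Events known up to a null set *)

Section NullExtension.
Context (R : realType) (d : measure_display) (Om : measurableType d).
Variable P : probability Om R.

(* The jobs present after a decision are determined by what was known before it
   only almost surely, because the dynamics hold almost surely. *)
Definition null_ext (G : set (set Om)) : set (set Om) :=
  [set E | measurable E /\ exists2 E', G E' & {ae P, forall w, E w <-> E' w}].

Lemma null_ext_sigma_algebra G : sigma_algebra setT G ->
  sigma_algebra setT (null_ext G).
Proof.
move=> sG; have [G0 _ GU] := sG; split.
- by split=> //; exists set0 => //; exact: aeW.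
- move=> E [mE [E' GE' EE']]; rewrite setTD; split; first exact: measurableC.
  exists (~` E'); first exact: sigma_algebra_setC.
  by apply: filterS EE' => w [h1 h2]; split=> h /=; [move=> /h2|move=> /h1].
- move=> E hE; split; first by apply: bigcupT_measurable => n; case: (hE n).
  have /choice[E' hE'] : forall n, exists E', G E' /\ {ae P, forall w, E n w <-> E' w}.
    by move=> n; case: (hE n) => _ [E' h1 h2]; exists E'.
  exists (\bigcup_n E' n); first by apply: GU => n; case: (hE' n).
  have : {ae P, forall w, forall n, E n w <-> E' n w}.
    by apply: ae_foralln => n; case: (hE' n).
  by apply: filterS => w h; split=> -[n _ /h]; exists n.
Qed.

Lemma ae_eq_set_integral (E E' : set Om) (A : Om -> R) :
  measurable E -> measurable E' -> measurable_fun setT A -> (forall w, 0 <= A w) ->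
  {ae P, forall w, E w <-> E' w} ->
  (\int[P]_(w in E) (A w)%:E = \int[P]_(w in E') (A w)%:E)%E.
Proof.
move=> mE mE' mA A0 h.
have mr (D : set Om) : measurable D -> measurable_fun setT ((fun w => (A w)%:E) \_ D).
  move=> mD; apply/(measurable_restrictT (fun w => (A w)%:E) mD).
  by apply: measurable_funTS; exact/measurable_EFinP.
rewrite [LHS]integral_mkcond [RHS]integral_mkcond; apply: ge0_ae_eq_integral => //.
- exact: mr.
- exact: mr.
- by move=> w _; rewrite patchE; case: ifP => // _; rewrite lee_fin.
- by move=> w _; rewrite patchE; case: ifP => // _; rewrite lee_fin.
apply: filterS h => w [h1 h2] _; rewrite !patchE.
by congr (if _ then _ else _); apply/idP/idP; rewrite !inE.
Qed.

Lemma ae_eq_set_measure (E E' : set Om) : measurable E -> measurable E' ->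
  {ae P, forall w, E w <-> E' w} -> P E = P E'.
Proof.
move=> mE mE' h.
have := @ae_eq_set_integral E E' (fun=> 1) mE mE' (measurable_cst _) (fun=> ler01) h.
by rewrite !integral_cst// !mul1e.
Qed.

Lemma cdom_null_ext G (A : Om -> R) (c : R) : G `<=` measurable ->
  measurable_fun setT A -> (forall w, 0 <= A w) ->
  cdom P G A c -> cdom P (null_ext G) A c.
Proof.
move=> GM mA A0 hA E [mE [E' GE' h]].
rewrite (ae_eq_set_integral mE (GM _ GE') mA A0 h) (ae_eq_set_measure mE (GM _ GE') h).
exact: hA.
Qed.

Lemma adapted_null_ext G (f g : Om -> nat) : adapted G g ->
  adapted (@measurable _ Om) f -> {ae P, forall w, f w = g w} ->
  adapted (null_ext G) f.
Proof.
move=> ag af fg D; split; first exact: af.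
exists (g @^-1` D); first exact: ag.
by apply: filterS fg => w /= ->.
Qed.

End NullExtension.

(** * Independent sources of randomness *)

Section Sources.
Context (R : realType) (d : measure_display) (Om : measurableType d).
Variable P : probability Om R.
Context (S : eqType) (src : S -> set (set Om)).
Hypothesis srcM : forall x, src x `<=` measurable.
Hypothesis srcI : forall x, setI_closed (src x).
Hypothesis srcT : forall x, src x setT.
Hypothesis ind : forall (s : seq S) (E : S -> set Om), uniq s ->
  (forall x, x \in s -> src x (E x)) ->
  P (\big[setI/setT]_(x <- s) E x) = (\prod_(x <- s) fine (P (E x)))%:E.

Definition others (x : S) : set (set Om) := [set E | exists2 y, y != x & src y E].

(** A pi-system that generates the information of all sources other than [x]; [ind] speaks about
    exactly such finite intersections. *)
Definition rectangles (x : S) : set (set Om) :=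
  [set F | exists s E, [/\ uniq s, x \notin s, forall y, y \in s -> src y (E y) &
                         F = \big[setI/setT]_(y <- s) E y]].

Lemma rectangles_measurable x : rectangles x `<=` measurable.
Proof.
move=> F [s [E [_ _ hE ->]]]; rewrite big_seq; apply: bigsetI_measurable => y ys.
exact: (srcM (hE y ys)).
Qed.

Lemma others_rectangles x : others x `<=` rectangles x.
Proof.
move=> F [y yx Fy]; exists [:: y], (fun=> F); split => //.
- by rewrite inE eq_sym.
- by move=> z; rewrite inE => /eqP ->.
- by rewrite big_seq1.
Qed.

Lemma rectanglesI x : setI_closed (rectangles x).
Proof.
move=> F1 F2 [s1 [E1 [u1 n1 h1 ->]]] [s2 [E2 [u2 n2 h2 ->]]].
(* Padding each family by [setT] outside its own list lets both run over the merged list. *)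
pose F (s : seq S) (E : S -> set Om) y := if y \in s then E y else setT.
have e s E t : uniq s -> uniq t -> {subset s <= t} ->
    \big[setI/setT]_(y <- s) E y = \big[setI/setT]_(y <- t) F s E y.
  move=> us ut st; rewrite -[RHS](big_mkcond (fun y => y \in s)) -[RHS]big_filter.
  apply: perm_big; apply: uniq_perm => //; first exact: filter_uniq.
  move=> y; rewrite mem_filter; apply/idP/andP => [ys|[]//]; split=> //; exact: st.
exists (undup (s1 ++ s2)), (fun y => F s1 E1 y `&` F s2 E2 y); split.
- exact: undup_uniq.
- by rewrite mem_undup mem_cat negb_or n1.
- move=> y _; apply: srcI; rewrite /F; case: ifP => //; [exact: h1|exact: h2].
rewrite big_split/= (e s1 E1 (undup (s1 ++ s2)))// ?(e s2 E2 (undup (s1 ++ s2)))//.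
- exact: undup_uniq.
- by move=> y ys; rewrite mem_undup mem_cat ys orbT.
- exact: undup_uniq.
- by move=> y ys; rewrite mem_undup mem_cat ys.
Qed.

Lemma rectangles_independent x A F : src x A -> rectangles x F ->
  P (A `&` F) = (P A * P F)%E.
Proof.
move=> xA [s [E [us ns hE ->]]].
pose E' y := if y == x then A else E y.
have e : \big[setI/setT]_(y <- s) E y = \big[setI/setT]_(y <- s) E' y.
  apply: eq_big_seq => y ys; rewrite /E'; case: eqP => // yx.
  by rewrite -yx ys in ns.
have hE' y : y \in s -> src y (E' y).
  by rewrite /E'; case: eqP => [-> _//|_ /hE].
have -> : A `&` \big[setI/setT]_(y <- s) E y = \big[setI/setT]_(y <- x :: s) E' y.
  by rewrite big_cons -e /E' eqxx.
rewrite ind => [||y]; last 2 first.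
- by rewrite /= ns us.
- by rewrite inE => /predU1P[->|/hE'//]; rewrite /E' eqxx.
rewrite big_cons EFinM -ind// -e /E' eqxx fineK// fin_num_measure//.
exact: (srcM xA).
Qed.

Lemma sub_sigma_measurable (G : set (set Om)) : G `<=` measurable -> <<s G >> `<=` measurable.
Proof. by apply: smallest_sub; exact: sigma_algebra_measurable. Qed.

(** The pi-lambda theorem carries independence from rectangles to the generated sigma-algebra. *)
Lemma others_independent x A F : src x A -> <<s others x >> F ->
  P (A `&` F) = (P A * P F)%E.
Proof.
move=> xA hF.
have mA : measurable A := srcM xA.
suff : [set F | measurable F /\ P (A `&` F) = (P A * P F)%E] F by case.
have : <<s rectangles x >> F.
  by apply: sub_smallest2r hF; [exact: smallest_sigma_algebra|exact: others_rectangles].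
rewrite -setI_closed_g_dynkin_g_sigma_algebra; last exact: rectanglesI.
apply: smallest_sub => [|E hE]; last first.
  by split; [exact: rectangles_measurable hE | exact: (rectangles_independent xA)].
split.
- by split=> //; rewrite setIT probability_setT mule1.
- move=> E [mE hE]; split; first exact: measurableC.
  have -> : P (A `&` ~` E) = (P A - P (A `&` E))%E.
    by rewrite -setDE measureD// ltey_eq fin_num_measure.
  have -> : P (~` E) = (1 - P E)%E by rewrite probability_setC.
  by rewrite hE muleBr ?mule1 ?fin_num_measure.
- move=> E tE hE; split; first by apply: bigcupT_measurable => n; case: (hE n).
  have mE n : measurable (E n) by case: (hE n).
  rewrite setI_bigcupr measure_bigcup//; last first.
  + apply/trivIsetP => i j _ _ ij; rewrite setIACA.
    by move/trivIsetP: tE => /(_ i j I I ij) ->; rewrite setI0.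
  + by move=> n _; exact: measurableI.
  rewrite measure_bigcup// -(fineK (fin_num_measure P _ mA)) -nneseriesZl//.
  by apply: eq_eseriesr => n _; rewrite fineK ?fin_num_measure//; case: (hE n).
Qed.


Lemma setT_rectangles x : rectangles x setT.
Proof. by exists [::], (fun=> setT); rewrite big_nil. Qed.

Lemma integral_indic_mul (f : Om -> R) (G K : set Om) :
  (\int[P]_(w in K) (f w * \1_G w)%:E = \int[P]_(w in G `&` K) (f w)%:E)%E.
Proof.
rewrite setIC integral_mkcondr; apply: eq_integral => w _; rewrite patchE indicE.
by case: (w \in G); rewrite ?mulr1 ?mulr0.
Qed.

Lemma rectangle_integral x (f : Om -> R) (G K : set Om) :
  sigma_algebra setT (src x) -> src x G -> rectangles x K -> L1 P f ->
  (forall D : set R, measurable D -> src x (f @^-1` D)) ->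
  (\int[P]_(w in G `&` K) (f w)%:E = P K * \int[P]_(w in G) (f w)%:E)%E.
Proof.
move=> sx xG rK hf fx.
have mG := srcM xG; have mK := rectangles_measurable rK.
rewrite -integral_indic_mul -[G in RHS]setIT -integral_indic_mul.
have mf : measurable_fun setT (fun w => f w * \1_G w).
  by apply: measurable_funM; [exact: L1_measurable hf|exact: measurable_indic].
apply: integral_independent => //.
  apply: (le_integrable measurableT _ _ hf); first exact/measurable_EFinP.
  move=> w _ /=; rewrite lee_fin indicE.
  by case: (w \in G); rewrite ?mulr1// mulr0 normr0.
move=> D mD; rewrite setIC muleC setIC; apply: rectangles_independent rK.
have -> : (fun w => f w * \1_G w) @^-1` D =
    (G `&` f @^-1` D) `|` (~` G `&` (fun=> 0) @^-1` D).
  apply/seteqP; split=> w /=.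
    rewrite indicE; case: (boolP (w \in G)) => wG; rewrite ?mulr1 ?mulr0 => Dw.
      by left; split => //; rewrite inE in wG.
    by right; split => //; rewrite notin_setE in wG.
  move=> [[wG Dw]|[nG Dw]]; rewrite indicE; first by rewrite mem_set// mulr1.
  by rewrite memNset// mulr0.
rewrite -[_ `|` _]setCK setCU; apply: (sigma_algebra_setC sx).
apply: (sigma_algebra_setI sx); apply: (sigma_algebra_setC sx).
  by apply: (sigma_algebra_setI sx) => //; exact: fx.
apply: (sigma_algebra_setI sx); first exact: (sigma_algebra_setC sx).
exact: (adapted_cst sx).
Qed.

(** Adding independent information does not change a conditional mean. [A - Z] integrates to 0 over
    each intersection of a set of [H] with a rectangle, because both variables come from source [x],
    and the pi-lambda theorem extends this to the joined sigma-algebra. *)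
Lemma sigma_join_cdom x (H : set (set Om)) (A Z : Om -> R) (c : R) :
  sigma_algebra setT (src x) -> sigma_algebra setT H -> H `<=` src x ->
  L1 P A -> L1 P Z ->
  (forall D : set R, measurable D -> src x (A @^-1` D)) ->
  (forall D : set R, measurable D -> H (Z @^-1` D)) ->
  (forall E, H E -> \int[P]_(w in E) (Z w)%:E = \int[P]_(w in E) (A w)%:E)%E ->
  {ae P, forall w, Z w <= c} ->
  cdom P <<s H `|` others x >> A c.
Proof.
move=> sx sH Hx hA hZ Ax Zx AZ Zc F hF.
pose U w := A w - Z w.
have hU : L1 P U by exact: L1B.
have mU := L1_measurable hU.
have sub (f : Om -> R) E : L1 P f -> measurable E -> P.-integrable E (EFin \o f).
  by move=> hf mE; exact: (integrableS measurableT mE).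
have splitU E : measurable E ->
    (\int[P]_(w in E) (U w)%:E = \int[P]_(w in E) (A w)%:E - \int[P]_(w in E) (Z w)%:E)%E.
  by move=> mE; rewrite integralB_EFin//; exact: sub.
have fin (f : Om -> R) E : L1 P f -> measurable E -> (\int[P]_(w in E) (f w)%:E \is a fin_num)%E.
  by move=> hf mE; apply: integrable_fin_num => //; exact: sub.
pose rect := [set E | exists G K, [/\ H G, rectangles x K & E = G `&` K]].
have rectI : setI_closed rect.
  move=> _ _ [G1 [K1 [hG1 hK1 ->]]] [G2 [K2 [hG2 hK2 ->]]].
  exists (G1 `&` G2), (K1 `&` K2); split; last by rewrite setIACA.
  - exact: sigma_algebra_setI.
  - exact: rectanglesI.
suff [mF eF] : [set F | measurable F /\ (\int[P]_(w in F) (U w)%:E = 0)%E] F.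
  have -> : (\int[P]_(w in F) (A w)%:E = \int[P]_(w in F) (Z w)%:E)%E.
    move: eF; rewrite splitU// -(fineK (fin _ _ hA mF)) -(fineK (fin _ _ hZ mF)) -EFinB.
    by move=> -[/eqP]; rewrite subr_eq0 => /eqP ->.
  (* [Z <= c] holds only almost everywhere; for the minimum it holds everywhere. *)
  have mZc : measurable_fun setT (fun w => Num.min (Z w) c).
    by apply: measurable_minr => //; exact: L1_measurable hZ.
  have -> : (\int[P]_(w in F) (Z w)%:E = \int[P]_(w in F) (Num.min (Z w) c)%:E)%E.
    apply: ae_eq_integral => //.
    - by apply: measurable_funTS; apply/measurable_EFinP; exact: L1_measurable hZ.
    - by apply: measurable_funTS; exact/measurable_EFinP.
    - by apply: filterS Zc => w h _; congr EFin; apply/esym/min_idPl.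
  rewrite -integral_cst//; apply: le_integral => //.
  - apply: sub => //; apply: (L1_dom mZc (L1D (_ : L1 P (fun w => `|Z w|)) (L1_cst P `|c|))).
      exact: integrable_norm hZ.
    apply/aeW => w; rewrite minEle; case: ifP => _; first by rewrite lerDl.
    by rewrite lerDr.
  - by apply: (sub (fun=> c)) => //; exact: L1_cst.
  - by move=> w _; rewrite lee_fin ge_min lexx orbT.
have : <<s rect >> F.
  apply: sub_smallest2r hF; first exact: smallest_sigma_algebra.
  move=> E [HE|/others_rectangles rE].
    by exists E, setT; split => //; [exact: setT_rectangles|rewrite setIT].
  by exists setT, E; split => //; [exact: sigma_algebra_setT|rewrite setTI].
rewrite -setI_closed_g_dynkin_g_sigma_algebra//.
apply: smallest_sub => [|_ [G [K [HG rK ->]]]]; last first.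
  have mG : measurable G by apply: (@srcM x); exact: Hx.
  have mK := rectangles_measurable rK.
  have mGK : measurable (G `&` K) by exact: measurableI.
  split=> //; rewrite splitU//.
  rewrite (rectangle_integral (f := A) sx (Hx _ HG) rK)//.
  rewrite (rectangle_integral (f := Z) sx (Hx _ HG) rK)//; last first.
    by move=> D /Zx /Hx.
  by rewrite AZ// subee// fin_numM ?fin_num_measure// fin.
have HT := sigma_algebra_setT sH.
have UT : (\int[P]_w (U w)%:E = 0)%E by rewrite splitU// AZ// subee// fin.
split=> //.
- move=> E [mE hE]; split; first exact: measurableC.
  have : (\int[P]_(w in E `|` ~` E) (U w)%:E = 0)%E by rewrite setUv.
  rewrite integral_setU ?hE ?add0e//; first exact: measurableC.
  + by rewrite setUv; exact/measurable_EFinP.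
  + by apply/disj_setPS; rewrite setICr.
- move=> E tE hE; have mE n : measurable (E n) by case: (hE n).
  split; first exact: bigcupT_measurable.
  rewrite integral_bigcup//; last by apply: sub => //; exact: bigcupT_measurable.
  by apply: eseries0 => n _ _; case: (hE n).
Qed.

End Sources.

(** * Counting arrivals *)

Section ArrivalCounts.
Context (R : realType) (N : network R) (d : measure_display) (Om : measurableType d).
Variables (P : probability Om R) (W : primitives N Om).
Hypothesis HW : primitives_ok P W.

Lemma arrivals_in_supp i (D : set R) w :
  arrivals_in W i D w =
  \big[addn/0%N]_(u \in D `&` [set u | arr W i u w <> 0%N]) arr W i u w.
Proof. exact: fsbig_supp. Qed.

Lemma finite_arrivals i (t : R) (D : set R) w : D `<=` [set u | 0 <= u < t] ->
  finite_set (D `&` [set u | arr W i u w <> 0%N]).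
Proof.
move=> Dt; apply: sub_finite_set (arr_finite HW i t w) => u [/Dt ut un].
by split.
Qed.

Lemma arrivals_split i (s t u : R) w : 0 <= s -> s <= t -> t <= u ->
  arrivals W i s u w = (arrivals W i s t w + arrivals W i t u w)%N.
Proof.
move=> s0 st tu; rewrite /arrivals !arrivals_in_supp.
rewrite -fsbigU0; first last.
- by move=> v [[/= h1 _] [/= h2 _]]; lra.
- by apply: (@finite_arrivals _ u) => v /= h; lra.
- by apply: (@finite_arrivals _ u) => v /= h; lra.
rewrite -setIUl; congr (\big[addn/0%N]_(v \in _ `&` _) _).
apply/seteqP; split => v /=; last by case=> h; lra.
by move=> h; case: (ltP v t) => vt; [left|right]; lra.
Qed.

Lemma arrivals_eq0 i (s t u : R) w : 0 <= s -> s <= u < t ->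
  arrivals W i s t w = 0%N -> arr W i u w = 0%N.
Proof.
move=> s0 ut; rewrite /arrivals arrivals_in_supp => h.
apply/eqP; apply: contraT => /eqP un.
have fin := @finite_arrivals i t [set v | s <= v < t] w.
move: h; rewrite (fsbigD1 u)/=; last by split.
  by move=> /eqP; rewrite addn_eq0 => /andP[/eqP].
by apply: fin => v /= h; lra.
Qed.

Lemma arrivals_single i (s t u : R) w : s <= u < t ->
  (forall v, s <= v < t -> v <> u -> arr W i v w = 0%N) ->
  arrivals W i s t w = arr W i u w.
Proof.
move=> ut h; rewrite /arrivals /arrivals_in -[RHS](@fsbig_set1 _ _ addn _ u (arr W i ^~ w)).
apply/esym/fsbig_widen; first by move=> v ->.
by move=> v [/= vt vu]; exact: h.
Qed.

Lemma finite_gap (S : set R) (u : R) : finite_set S -> (forall v, S v -> u < v) ->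
  exists2 e, 0 < e & forall v, S v -> u + e <= v.
Proof.
move=> /finite_seqP[s ->]; elim: s => [|x s IH] h; first by exists 1.
have [|e e0 he] := IH; first by move=> v /= vs; apply: h; rewrite /= inE vs orbT.
have ux : u < x by apply: h; rewrite /= inE eqxx.
exists (Num.min e (x - u)); first by rewrite lt_min e0 subr_gt0.
move=> v /=; rewrite inE => /predU1P[->|vs].
  by rewrite -lerBrDl ge_min lexx orbT.
by apply: le_trans (he v vs); rewrite lerD2l ge_min lexx.
Qed.

(** Finitely many arrivals occur before [u + 1], so a short enough interval to the right of [u]
    contains none. *)
Lemma arrivals_closed_lim i (u : R) w : 0 <= u -> exists k0, forall k, (k0 <= k)%N ->
  arrivals W i 0 (u + k.+1%:R^-1) w = arrivals_in W i [set v | 0 <= v <= u] w.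
Proof.
move=> u0.
have [||e e0 he] := @finite_gap ([set v | u < v < u + 1] `&` [set v | arr W i v w <> 0%N]) u.
- by apply: (@finite_arrivals _ (u + 1)) => v /= h; lra.
- by move=> v [/= h _]; lra.
exists (Num.truncn e^-1) => k hk.
have kpos : 0 < k.+1%:R^-1 :> R by rewrite invr_gt0.
have k1 : k.+1%:R^-1 <= 1 :> R by rewrite invf_le1// ler1n.
have ke : k.+1%:R^-1 < e.
  rewrite invf_plt ?posrE//; apply: lt_le_trans (truncnS_gt _) _.
  by rewrite ler_nat.
rewrite /arrivals /arrivals_in; move: (k.+1%:R^-1) kpos k1 ke => ek kpos k1 ke.
apply/esym/fsbig_widen; first by move=> v /= h; lra.
move=> v [/= vk /negP nv]; apply/eqP; apply: contraT => /eqP vn.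
have vu : u < v by move: nv; rewrite negb_and -!ltNge; case/orP; lra.
have : u + e <= v by apply: he; split => //=; lra.
lra.
Qed.

Local Notation B := 'I_(nbuf N).

(** [arrival_history] is generated by counts on half-open intervals, [revealed] by counts on closed
    ones. A closed count is the eventual value of half-open counts ending just after [u], hence the
    strict [u < t]. *)
Lemma arrivals_closed_history i (u t : R) : 0 <= u -> u < t ->
  adapted (arrival_history W t) (arrivals_in W i [set v | 0 <= v <= u]).
Proof.
move=> u0 ut D.
have [K hK] : exists K : nat, forall k, (K <= k)%N -> u + k.+1%:R^-1 <= t.
  exists (Num.truncn (t - u)^-1) => k hk; rewrite -lerBrDl ltW//.
  rewrite invf_plt ?posrE ?subr_gt0//; apply: lt_le_trans (truncnS_gt _) _.
  by rewrite ler_nat.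
have sH := smallest_sigma_algebra setT [set E | exists i (s : R) (D : set nat),
         0 <= s <= t /\ E = arrivals W i 0 s @^-1` D].
(* A limit inferior of events; the offset [K] keeps all the times involved at most [t]. *)
have -> : arrivals_in W i [set v | 0 <= v <= u] @^-1` D =
    \bigcup_m \bigcap_k (arrivals W i 0 (u + (K + m + k).+1%:R^-1) @^-1` D).
  apply/seteqP; split=> w.
    move=> Dw; have [k0 hk0] := arrivals_closed_lim i w u0.
    exists k0 => // k _; rewrite /preimage/= hk0//.
    by rewrite addnAC leq_addl.
  move=> [m _ hm]; have [k0 hk0] := arrivals_closed_lim i w u0.
  have := hm k0 I; rewrite /preimage/= hk0//; exact: leq_addl.
have hg k : arrival_history W t (arrivals W i 0 (u + (K + k).+1%:R^-1) @^-1` D).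
  apply: sub_gen_smallest; exists i, (u + (K + k).+1%:R^-1), D; split => //.
  by rewrite hK ?leq_addr// addr_ge0// invr_ge0.
apply: (sigma_algebra_bigcup (G := _)) => m.
rewrite -[X in <<s _>> X]setCK setC_bigcap; apply: (sigma_algebra_setC sH).
apply: (sigma_algebra_bigcup (G := _)) => k; apply: (sigma_algebra_setC sH).
by rewrite -addnA; exact: hg.
Qed.

Lemma arrivals_preimage_measurable i (s t : R) (D : set nat) : 0 <= s ->
  measurable (arrivals W i s t @^-1` D).
Proof.
move=> s0; have := arrivals_measurable HW i t s0 measurableT.
by rewrite -[X in measurable X]setTI; exact.
Qed.

(* Arrivals occur at integers only, so these are the arrivals at [n.+1], and the
   history up to the left end contains the arrivals at [n]. *)
Definition batch n i w := arrivals W i (n%:R + 2^-1) (n%:R + 2^-1 + 1) w.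

Lemma L2_batch n i : L2 P (fun w => (batch n i w)%:R).
Proof.
have n0 : 0 <= n%:R + 2^-1 :> R by rewrite addr_ge0 ?invr_ge0.
have m s t : 0 <= s -> measurable_fun setT (fun w => (arrivals W i s t w)%:R : R).
  move=> s0; apply: adapted_measurable => D; exact: arrivals_preimage_measurable.
apply: (@L2_dom _ _ _ _ _ (fun w => (arrivals W i 0 (n%:R + 2^-1 + 1) w)%:R)).
- exact: m.
- split; first exact: m.
  apply/integrableP; split.
    by apply/measurable_EFinP; apply: measurable_funX; exact: m.
  have := arrivals_sqr HW i (n%:R + 2^-1 + 1); congr (_ < _)%E.
  by apply: eq_integral => w _ /=; rewrite ger0_norm// sqr_ge0.
- apply/aeW => w; rewrite ger0_norm// ler_nat /batch.
  rewrite (@arrivals_split i 0 (n%:R + 2^-1) (n%:R + 2^-1 + 1))//; last by rewrite lerDl.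
  exact: leq_addl.
Qed.

Hypothesis Hsync : synchronized P W.

(** Synchronization is almost sure at each fixed time only. Countably many times decreasing to [n]
    share one null set, and an arrival inside the slot would come after one of them. *)
Lemma arrivals_at_integers : {ae P, forall w, forall i n t,
  n%:R < t < n.+1%:R -> arr W i t w = 0%N}.
Proof.
have [hA _ _ _] := Hsync.
have h1 : {ae P, forall w, forall n k i, arrivals W i 0 (n%:R + k.+2%:R^-1) w =
    arrivals W i 0 n.+1%:R w}.
  apply: ae_foralln => n; apply: ae_foralln => k.
  apply: filter_forall => i.
  have k0 : 0 < k.+2%:R^-1 :> R by rewrite invr_gt0.
  have k1 : k.+2%:R^-1 <= 1 :> R by rewrite invf_le1// ler1n.
  have n0 : 0 <= n%:R :> R by [].
  have ce : (Num.ceil (n%:R + k.+2%:R^-1 : R))%:~R = n.+1%:R :> R.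
    rewrite (@ceil_def _ _ n.+1%:Z) -?pmulrn//.
    by rewrite subn1/= -[n.+1%:R]natr1 ltrDl k0 lerD2l.
  have t0 : 0 <= n%:R + k.+2%:R^-1 :> R by rewrite addr_ge0// ltW.
  have := hA i 0 (n%:R + k.+2%:R^-1) (lexx _) t0.
  by apply: filterS => w ->; rewrite ce.
apply: filterS h1 => w h i n t /andP[nt tn].
have n0 : 0 <= n%:R :> R by [].
pose k := Num.truncn (t - n%:R)^-1.
have kn : k.+2%:R^-1 < t - n%:R.
  rewrite invf_plt ?posrE ?subr_gt0//; apply: lt_le_trans (truncnS_gt _) _.
  by rewrite ler_nat.
have k0 : 0 < k.+2%:R^-1 :> R by rewrite invr_gt0.
have k1 : k.+2%:R^-1 <= 1 :> R by rewrite invf_le1// ler1n.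
have nS : n.+1%:R = n%:R + 1 :> R by rewrite -natr1.
have := h n k i; move: (k.+2%:R^-1) kn k0 k1 => e kn k0 k1.
rewrite (@arrivals_split i 0 (n%:R + e) n.+1%:R) ?nS; [|lra|lra|lra].
move=> /eqP; rewrite eq_sym -[X in _ == X]addn0 eqn_add2l => /eqP.
by apply: arrivals_eq0; [lra|apply/andP; split; lra].
Qed.

Lemma batchE : {ae P, forall w, forall i n, batch n i w = arr W i n.+1%:R w}.
Proof.
apply: filterS arrivals_at_integers => w h i n.
have n0 : 0 <= n%:R :> R by [].
have nS : n.+1%:R = n%:R + 1 :> R by rewrite -natr1.
have nSS : n.+2%:R = n.+1%:R + 1 :> R by rewrite -natr1.
apply: arrivals_single; first by rewrite nS; apply/andP; split; lra.
move=> v hv vn; have [vlt|] := ltP v n.+1%:R.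
  by apply: (h i n); apply/andP; split; lra.
rewrite le_eqVlt => /predU1P[/esym//|vgt].
by apply: (h i n.+1); rewrite vgt nSS; lra.
Qed.

End ArrivalCounts.

Section Decomposition.
Context (R : realType) (d : measure_display) (Om : measurableType d).
Variable P : probability Om R.

(** Used with the counts of consumed marks as [mk]: on each piece the index of the next mark is
    constant. *)
Lemma measure_le_decomposition (T : countType) (mk : Om -> T) (X Y : set Om) (c : R) :
  0 <= c -> measurable X -> measurable Y ->
  (forall m, measurable (mk @^-1` [set m])) ->
  (forall m, P (X `&` mk @^-1` [set m]) <= c%:E * P (Y `&` mk @^-1` [set m]))%E ->
  (P X <= c%:E * P Y)%E.
Proof.
move=> c0 mX mY mmk h.
pose part k := [set w | pickle (mk w) = k].
have partE k : part k = set0 \/ exists m, part k = mk @^-1` [set m].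
  have [[w wk]|nw] := pselect (exists w, part k w); last first.
    by left; apply/seteqP; split=> // w wk; apply: nw; exists w.
  right; exists (mk w); apply/seteqP; split=> v /=; last by rewrite -wk /part/= => ->.
  by rewrite /part/= -wk => /(pcan_inj pickleK).
have mpart k : measurable (part k) by case: (partE k) => [->|[m ->]].
have tpart (S : set Om) : trivIset setT (fun k => S `&` part k).
  by move=> i j _ _ [w [[_ /= wi] [_ /= wj]]]; rewrite -wi -wj.
have split_ (S : set Om) : measurable S -> (P S = \sum_(k <oo) P (S `&` part k))%E.
  move=> mS; transitivity (P (\bigcup_k (S `&` part k))).
    rewrite -setI_bigcupr; congr (P _); apply/seteqP; split=> [w Sw|w []//].
    by split=> //; exists (pickle (mk w)).
  rewrite measure_bigcup//; last by move=> k _; exact: measurableI.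
  by apply: eq_eseriesl => k; rewrite in_setT.
rewrite (split_ X)// (split_ Y)// -nneseriesZl//; apply: lee_nneseries => k _ //.
by case: (partE k) => [->|[m ->]]; rewrite ?setI0 ?measure0 ?mule0.
Qed.

Lemma integral_bool (E : set Om) (b : Om -> bool) : measurable E ->
  measurable [set w | b w] ->
  (\int[P]_(w in E) ((b w)%:R)%:E = P (E `&` [set w | b w]))%E.
Proof.
move=> mE mb; rewrite setIC -integral_indic//; apply: eq_integral => w _.
rewrite indicE; have -> // : (w \in [set w | b w]) = b w.
by apply/idP/idP; rewrite inE.
Qed.

End Decomposition.

(** * Stopped sigma-algebras and fresh marks *)

Section Past.
Context (R : realType) (N : network R) (d : measure_display) (Om : measurableType d).
Variables (P : probability Om R) (W : primitives N Om).
Hypothesis HW : primitives_ok P W.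
Local Notation B := 'I_(nbuf N).
Local Notation A := 'I_(nact N).
Local Notation H := 'I_(ncomp N).
Local Notation route := (@Defs.route R N d Om W).
Variables (seed : set (set Om)) (coin : H -> nat -> Om -> bool).
Hypothesis seed_sigma : sigma_algebra setT seed.
Hypothesis seedM : seed `<=` measurable.
Hypothesis coinM : forall h n, measurable [set w | coin h n w].
Hypothesis indep : sources_independent P W seed coin.
Variable Z : R -> Om -> config N.
Hypothesis nonant : non_anticipating W seed coin Z.

Local Notation src := (source_events W seed coin).

Lemma preimage_sigma_algebra (T : Type) (f : Om -> T) :
  sigma_algebra setT [set E | exists D : set T, E = f @^-1` D].
Proof.
split.
- by exists set0; rewrite preimage_set0.
- by move=> _ [D ->]; exists (~` D); rewrite setTD preimage_setC.
- move=> F hF; have /choice[D hD] : forall n, exists D, F n = f @^-1` D by [].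
  by exists (\bigcup_n D n); rewrite preimage_bigcup; apply: eq_bigcupr => n _.
Qed.

Lemma preimage_sigma_algebra_measurable (f : Om -> R) :
  sigma_algebra setT [set E | exists2 D : set R, measurable D & E = f @^-1` D].
Proof.
split.
- by exists set0; rewrite ?preimage_set0.
- move=> _ [D mD ->]; exists (~` D); first exact: measurableC.
  by rewrite setTD preimage_setC.
- move=> F hF; have /choice[D hD] : forall n, exists D, measurable D /\ F n = f @^-1` D.
    by move=> n; case: (hF n) => D; exists D.
  exists (\bigcup_n D n); first by apply: bigcupT_measurable => n; case: (hD n).
  by rewrite preimage_bigcup; apply: eq_bigcupr => n _; case: (hD n).
Qed.

Lemma src_sigma_algebra x : sigma_algebra setT (src x).
Proof.
case: x => [||j n|j n|h n] //=.
- exact: preimage_sigma_algebra.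
- exact: preimage_sigma_algebra_measurable.
- exact: preimage_sigma_algebra.
Qed.

Lemma src_measurable x : src x `<=` measurable.
Proof.
case: x => [||j n|j n|h n] //=.
- apply: sub_sigma_measurable => _ [i [t [D [t0 ->]]]].
  exact: (arrivals_preimage_measurable HW).
- move=> _ [D ->]; have -> : route j n @^-1` D =
      \bigcup_o (if `[< D o >] then [set w | route j n w = o] else set0).
    apply/seteqP; split=> [w Dw|w [l _]]; first by exists (route j n w) => //; rewrite asboolT.
    by case: asboolP => //= Do ro; rewrite /preimage/= ro.
  apply: countable_bigcupT_measurable => // o; case: asboolP => // _.
  exact: (route_measurable HW).
- move=> _ [D mD ->]; have := serv_measurable HW j n measurableT mD.
  by rewrite setTI.
- move=> _ [D ->]; have -> : coin h n @^-1` D =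
      (if `[< D true >] then [set w | coin h n w] else set0) `|`
      (if `[< D false >] then ~` [set w | coin h n w] else set0).
    apply/seteqP; split=> w /=; rewrite /preimage/=.
      by case E : (coin h n w) => Dw; [left|right]; rewrite asboolT//= E.
    move=> [|]; [case: (asboolP (D true))|case: (asboolP (D false))] => //= Dt.
      by move=> ->.
    by move=> /negP/negbTE ->.
  apply: measurableU; case: asboolP => // _; exact: measurableC.
Qed.

Lemma srcI x : setI_closed (src x).
Proof. by move=> E F; exact: (sigma_algebra_setI (src_sigma_algebra x)). Qed.

Lemma srcT x : src x setT.
Proof. exact: (sigma_algebra_setT (src_sigma_algebra x)). Qed.

Lemma src_indep x E F : src x E -> <<s others src x >> F -> P (E `&` F) = (P E * P F)%E.
Proof. exact: (others_independent src_measurable srcI srcT indep). Qed.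

Lemma history_src t : arrival_history W t `<=` src (Arrivals N).
Proof.
apply: smallest_sub; first exact: src_sigma_algebra.
move=> _ [i [s [D [/andP[s0 _] ->]]]]; apply: sub_gen_smallest => /=.
by exists i, s, D.
Qed.

(** Finite functions give the counts a countable type of values. *)
Definition mark t w : {ffun A -> nat} * {ffun A -> nat} * {ffun H -> nat} :=
  ([ffun j => started (Z t w) j], [ffun j => completed (Z t w) j],
   [ffun h => trials (Z t w) h]).

Local Notation marks := ({ffun A -> nat} * {ffun A -> nat} * {ffun H -> nat})%type.
Implicit Types m : marks.

Local Notation revealed_mark t m := (revealed W seed coin t m.1.1 m.1.2 m.2).

Lemma mark_preimage t m : mark t @^-1` [set m] =
  [set w | [/\ started (Z t w) = m.1.1, completed (Z t w) = m.1.2 &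
               trials (Z t w) = m.2]].
Proof.
case: m => [[s e] n]; apply/seteqP; split=> w /=; rewrite /mark.
  by move=> [<- <- <-]; split; apply/funext => x; rewrite ffunE.
move=> [-> -> ->]; congr (_, _, _); apply/ffunP => x; rewrite ffunE//.
Qed.

Lemma revealed_sigma_algebra t s e n : sigma_algebra setT (revealed W seed coin t s e n).
Proof. exact: smallest_sigma_algebra. Qed.

Lemma revealed_sub (G : set (set Om)) t s e n : sigma_algebra setT G ->
  seed `<=` G ->
  (forall i u (D : set nat), 0 <= u <= t ->
     G (arrivals_in W i [set v | 0 <= v <= u] @^-1` D)) ->
  (forall j k, (k < s j)%N -> src (Service j k) `<=` G) ->
  (forall j k, (k < e j)%N -> src (Route j k) `<=` G) ->
  (forall h k, (k < n h)%N -> src (Coin h k) `<=` G) ->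
  revealed W seed coin t s e n `<=` G.
Proof.
move=> sG h1 h2 h3 h4 h5; apply: smallest_sub => // E.
case=> [/h1//|[i [u [D [hu ->]]]]|[j [k [ks hE]]]|[[j [k [ks hE]]]|[h [k [ks hE]]]]].
- exact: h2.
- exact: (h3 _ _ ks).
- exact: (h4 _ _ ks).
- exact: (h5 _ _ ks).
Qed.

Lemma closed_history_others x t i u (D : set nat) : 0 <= u <= t -> x != Arrivals N ->
  <<s others src x >> (arrivals_in W i [set v | 0 <= v <= u] @^-1` D).
Proof.
move=> /andP[u0 ut] xA; apply: sub_gen_smallest; exists (Arrivals N); first by rewrite eq_sym.
have u1 : u < u + 1 by rewrite ltrDl.
by apply: (@history_src (u + 1)); exact: (arrivals_closed_history HW).
Qed.

Lemma others_sub x y : y != x -> src y `<=` <<s others src x >>.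
Proof. by move=> yx E hE; apply: sub_gen_smallest; exists y. Qed.

(** Only the routing marks of [j] with index below [e j] have been seen, so the one with index [e j]
    is still fresh. *)
Lemma revealed_route t s e n j : revealed W seed coin t s e n `<=`
  <<s others src (Route j (e j)) >>.
Proof.
apply: revealed_sub; first exact: smallest_sigma_algebra.
- by apply: (@others_sub _ (Seed N)); apply/eqP.
- by move=> i u D hu; apply: closed_history_others hu _; apply/eqP.
- by move=> j' k _; apply: others_sub; apply/eqP.
- move=> j' k kj; apply: others_sub; apply/eqP => -[jj kk].
  by move: kj; rewrite jj kk ltnn.
- by move=> h k _; apply: others_sub; apply/eqP.
Qed.

Lemma revealed_coin t s e n h : revealed W seed coin t s e n `<=`
  <<s others src (Coin h (n h)) >>.
Proof.
apply: revealed_sub; first exact: smallest_sigma_algebra.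
- by apply: (@others_sub _ (Seed N)); apply/eqP.
- by move=> i u D hu; apply: closed_history_others hu _; apply/eqP.
- by move=> j' k _; apply: others_sub; apply/eqP.
- by move=> j' k kj; apply: others_sub; apply/eqP.
- move=> h' k kh; apply: others_sub; apply/eqP => -[jj kk].
  by move: kh; rewrite jj kk ltnn.
Qed.

Lemma revealed_arrivals t t' s e n : t < t' -> revealed W seed coin t s e n `<=`
  <<s arrival_history W t' `|` others src (Arrivals N) >>.
Proof.
move=> tt'.
have oth x : x != Arrivals N -> src x `<=` <<s arrival_history W t' `|` others src (Arrivals N) >>.
  by move=> xA E hE; apply: sub_gen_smallest; right; exists x.
apply: revealed_sub; first exact: smallest_sigma_algebra.
- by apply: (@oth (Seed N)); apply/eqP.
- move=> i u D /andP[u0 ut]; apply: sub_gen_smallest; left.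
  by apply: (arrivals_closed_history HW) => //; exact: le_lt_trans tt'.
- by move=> j' k _; apply: oth; apply/eqP.
- by move=> j' k _; apply: oth; apply/eqP.
- by move=> h' k _; apply: oth; apply/eqP.
Qed.

(* The sets that are determined by what is revealed at the marks used up to
   time [t]: the stopped sigma-algebra of the configuration at [t]. *)
Definition past t : set (set Om) :=
  [set E | forall m, revealed_mark t m (E `&` mark t @^-1` [set m])].

(* Larger than [past t]: all arrivals and all marks other than the next coin of
   [h], so that the decision at [t] up to that coin is known too. *)
Definition before_coin h t : set (set Om) :=
  [set E | forall m, <<s others src (Coin h (m.2 h)) >> (E `&` mark t @^-1` [set m])].

Lemma marked_sigma_algebra t (G : marks -> set (set Om)) :
  (forall m, sigma_algebra setT (G m)) -> (forall m, G m (mark t @^-1` [set m])) ->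
  sigma_algebra setT [set E | forall m, G m (E `&` mark t @^-1` [set m])].
Proof.
move=> sG hG; split.
- by move=> m; rewrite set0I; case: (sG m).
- move=> E hE m.
  have -> : (setT `\` E) `&` mark t @^-1` [set m] =
      mark t @^-1` [set m] `\` (E `&` mark t @^-1` [set m]).
    apply/seteqP; split=> w /=.
      by move=> [[_ nE] Mw]; split=> // -[].
    by move=> [Mw nE]; split=> //; split=> // Ew; apply: nE.
  exact: (sigma_algebra_setD (sG m)).
- by move=> E hE m; rewrite setI_bigcupl; case: (sG m) => _ _ hU; apply: hU => k; exact: hE.
Qed.

Variable t : R.
Hypothesis t0 : 0 <= t.

Lemma state_revealed E m : state_events (fun w => st (Z t w)) E ->
  revealed_mark t m (E `&` mark t @^-1` [set m]).
Proof. by move=> hE; rewrite mark_preimage; exact: nonant. Qed.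

Lemma mark_revealed m : revealed_mark t m (mark t @^-1` [set m]).
Proof.
rewrite -[X in revealed _ _ _ _ _ _ _ X]setTI; apply: state_revealed.
have sS : sigma_algebra setT (state_events (fun w => st (Z t w))).
  exact: smallest_sigma_algebra.
exact: (sigma_algebra_setT sS).
Qed.

Lemma past_sigma_algebra : sigma_algebra setT (past t).
Proof.
by apply: (@marked_sigma_algebra t (fun m => revealed_mark t m)) => m;
  [exact: revealed_sigma_algebra|exact: mark_revealed].
Qed.

Lemma before_coin_sigma_algebra h : sigma_algebra setT (before_coin h t).
Proof.
apply: (@marked_sigma_algebra t (fun m => <<s others src (Coin h (m.2 h)) >>)) => m;
  first exact: smallest_sigma_algebra.
by apply: (@revealed_coin t m.1.1 m.1.2 m.2); exact: mark_revealed.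
Qed.

Lemma others_measurable x : <<s others src x >> `<=` measurable.
Proof. by apply: sub_sigma_measurable => E [y _]; exact: src_measurable. Qed.

Lemma revealed_measurable s e n : revealed W seed coin t s e n `<=` measurable.
Proof.
apply: revealed_sub; first exact: sigma_algebra_measurable.
- exact: seedM.
- move=> i u D /andP[u0 _].
  have u1 : u < u + 1 by rewrite ltrDl.
  apply: (@src_measurable (Arrivals N)); apply: (@history_src (u + 1)).
  exact: (arrivals_closed_history HW).
- by move=> j k _; exact: src_measurable.
- by move=> j k _; exact: src_measurable.
- by move=> h k _; exact: src_measurable.
Qed.

Lemma mark_measurable m : measurable (mark t @^-1` [set m]).
Proof. by apply: revealed_measurable; exact: mark_revealed. Qed.

Lemma marked_measurable E : (forall m, measurable (E `&` mark t @^-1` [set m])) ->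
  measurable E.
Proof.
move=> hE; have -> : E = \bigcup_m (E `&` mark t @^-1` [set m]).
  by apply/seteqP; split=> [w Ew|w [m _ []]//]; exists (mark t w).
exact: countable_bigcupT_measurable.
Qed.

Lemma past_measurable : past t `<=` measurable.
Proof. by move=> E hE; apply: marked_measurable => m; exact: revealed_measurable (hE m). Qed.

Lemma before_coin_measurable h : before_coin h t `<=` measurable.
Proof. by move=> E hE; apply: marked_measurable => m; exact: others_measurable (hE m). Qed.

Lemma past_before_coin h : past t `<=` before_coin h t.
Proof. by move=> E hE m; exact: revealed_coin (hE m). Qed.

Lemma state_past E : state_events (fun w => st (Z t w)) E -> past t E.
Proof. by move=> hE m; exact: state_revealed. Qed.

Lemma adapted_Q i c : adapted (past t) (fun w => Q (st (Z t w)) i c).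
Proof.
apply: (adapted_points past_sigma_algebra) => // q; apply: state_past.
by apply: sub_gen_smallest; apply: Or31; exists i, c, q.
Qed.

Lemma adapted_V_pos i c j : adapted (past t) (fun w => 0 < V (st (Z t w)) i c j).
Proof.
have h : past t [set w | 0 < V (st (Z t w)) i c j].
  have -> : [set w | 0 < V (st (Z t w)) i c j] = ~` [set w | V (st (Z t w)) i c j <= 0].
    by apply/seteqP; split=> w /=; rewrite ltNge => /negP.
  apply: (sigma_algebra_setC past_sigma_algebra); apply: state_past.
  by apply: sub_gen_smallest; apply: Or32; exists i, c, j, 0.
apply: (adapted_points past_sigma_algebra) => //; case=> //.
have -> : (fun w => 0 < V (st (Z t w)) i c j) @^-1` [set false] =
    ~` [set w | 0 < V (st (Z t w)) i c j].
  by apply/seteqP; split=> w /= => [->//|/negP/negbTE].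
exact: (sigma_algebra_setC past_sigma_algebra).
Qed.

Lemma before_coin_arrivals h (f : Om -> nat) :
  adapted (src (Arrivals N)) f -> adapted (before_coin h t) f.
Proof.
move=> hf D m; apply: (sigma_algebra_setI (smallest_sigma_algebra _ _)).
  by apply: (@others_sub _ (Arrivals N)) => //; apply/eqP.
by apply: (@revealed_coin t m.1.1 m.1.2 m.2); exact: mark_revealed.
Qed.

Definition next_dest j w := route j (completed (Z t w) j) w.

Lemma next_dest_mark j o m : [set w | next_dest j w = o] `&` mark t @^-1` [set m] =
  route j (m.1.2 j) @^-1` [set o] `&` mark t @^-1` [set m].
Proof.
apply/seteqP; split=> w /= [h1 h2]; split=> //; move: h1;
  by rewrite /next_dest -h2 /= ffunE.
Qed.

Lemma before_coin_next_dest h j : adapted (before_coin h t) (next_dest j).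
Proof.
apply: (adapted_points (before_coin_sigma_algebra h)) => // o m.
rewrite [X in X `&` _](_ : _ = [set w | next_dest j w = o])// next_dest_mark.
apply: (sigma_algebra_setI (smallest_sigma_algebra _ _)).
  by apply: (@others_sub _ (Route j (m.1.2 j))); [apply/eqP | exists [set o]].
by apply: (@revealed_coin t m.1.1 m.1.2 m.2); exact: mark_revealed.
Qed.

Lemma next_dest_measurable j o : measurable [set w | next_dest j w = o].
Proof.
apply: marked_measurable => m; rewrite next_dest_mark.
apply: measurableI; last exact: mark_measurable.
by apply: (@src_measurable (Route j (m.1.2 j))); exists [set o].
Qed.

(** For each value of the counts the destination is a fixed routing mark, independent of what the
    past reveals there. *)
Lemma cdom_next_dest j l : 0 <= routing N (buf j) l ->
  cdom P (past t) (fun w => (next_dest j w == Some l)%:R) (routing N (buf j) l).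
Proof.
move=> r0 E hE; have mE := past_measurable hE.
have e : [set w | next_dest j w == Some l] = [set w | next_dest j w = Some l].
  by apply/seteqP; split=> w /= /eqP.
have mb : measurable [set w | next_dest j w == Some l].
  by rewrite e; exact: next_dest_measurable.
rewrite integral_bool// e; apply: (@measure_le_decomposition _ _ _ _ _ (mark t)) => //.
- by rewrite -e; exact: measurableI.
- exact: mark_measurable.
move=> m; rewrite -setIA next_dest_mark setICA.
have hEm : <<s others src (Route j (m.1.2 j)) >> (E `&` mark t @^-1` [set m]).
  by apply: (@revealed_route t m.1.1 m.1.2 m.2); exact: hE.
have hR : src (Route j (m.1.2 j)) (route j (m.1.2 j) @^-1` [set Some l]).
  by exists [set Some l].
rewrite (src_indep hR hEm) -(route_law HW j (m.1.2 j) l).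
by [].
Qed.

Definition next_coin h w := coin h (trials (Z t w) h) w.

Lemma next_coin_mark h b m : [set w | next_coin h w = b] `&` mark t @^-1` [set m] =
  coin h (m.2 h) @^-1` [set b] `&` mark t @^-1` [set m].
Proof.
apply/seteqP; split=> w /= [h1 h2]; split=> //; move: h1;
  by rewrite /next_coin -h2 /= ffunE.
Qed.

Lemma next_coin_measurable h b : measurable [set w | next_coin h w = b].
Proof.
apply: marked_measurable => m; rewrite next_coin_mark.
apply: measurableI; last exact: mark_measurable.
by apply: (@src_measurable (Coin h (m.2 h))); exists [set b].
Qed.

Lemma before_coin_le h b (q : R) : 0 <= q ->
  (forall k, P [set w | coin h k w = b] = q%:E) ->
  forall E, before_coin h t E -> (P (E `&` [set w | next_coin h w = b]) <= q%:E * P E)%E.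
Proof.
move=> q0 hq E hE; have mE := before_coin_measurable hE.
apply: (@measure_le_decomposition _ _ _ _ _ (mark t)) => //.
- by apply: measurableI => //; exact: next_coin_measurable.
- exact: mark_measurable.
move=> m; rewrite -setIA next_coin_mark setICA.
have hR : src (Coin h (m.2 h)) (coin h (m.2 h) @^-1` [set b]) by exists [set b].
by rewrite (src_indep hR (hE m)) -(hq (m.2 h)).
Qed.

Lemma cdom_next_coin h (q : R) : 0 <= q ->
  (forall k, P [set w | coin h k w] = q%:E) ->
  cdom P (before_coin h t) (fun w => (next_coin h w)%:R) q /\
  cdom P (before_coin h t) (fun w => 1 - (next_coin h w)%:R) (1 - q).
Proof.
move=> q0 hq.
have hq1 k : P [set w | coin h k w = true] = q%:E by rewrite -(hq k).
have hq2 k : P [set w | coin h k w = false] = (1 - q)%:E.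
  rewrite EFinB -(hq k) -probability_setC//; congr (P _).
  by apply/seteqP; split=> w /= => [->//|/negP/negbTE].
have q1 : 0 <= 1 - q by rewrite -lee_fin -(hq2 0%N) measure_ge0.
split=> E hE; have mE := before_coin_measurable hE.
  by rewrite integral_bool//; [exact: before_coin_le | exact: (next_coin_measurable h true)].
have -> : (\int[P]_(w in E) (1 - (next_coin h w)%:R)%:E =
    \int[P]_(w in E) ((~~ next_coin h w)%:R)%:E)%E.
  by apply: eq_integral => w _; case: next_coin; rewrite ?subrr ?subr0.
have e : [set w | ~~ next_coin h w] = [set w | next_coin h w = false].
  by apply/seteqP; split=> w /= => [/negbTE//|->].
have mb : measurable [set w | ~~ next_coin h w] by rewrite e; exact: next_coin_measurable.
by rewrite integral_bool// e; exact: before_coin_le.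
Qed.

End Past.

(** * Arrivals given the past *)

Section Batches.
Context (R : realType) (N : network R) (d : measure_display) (Om : measurableType d).
Variables (P : probability Om R) (W : primitives N Om).
Hypothesis HW : primitives_ok P W.
Local Notation B := 'I_(nbuf N).
Local Notation A := 'I_(nact N).
Local Notation H := 'I_(ncomp N).
Variables (seed : set (set Om)) (coin : H -> nat -> Om -> bool).
Hypothesis seed_sigma : sigma_algebra setT seed.
Hypothesis seedM : seed `<=` measurable.
Hypothesis coinM : forall h n, measurable [set w | coin h n w].
Hypothesis indep : sources_independent P W seed coin.
Variable Z : R -> Om -> config N.
Hypothesis nonant : non_anticipating W seed coin Z.
Local Notation src := (source_events W seed coin).

Lemma batch_src n i : adapted (src (Arrivals N)) (batch W n i).
Proof.
have sA := src_sigma_algebra W coin seed_sigma (Arrivals N).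
have aA t : 0 <= t -> adapted (src (Arrivals N)) (arrivals W i 0 t).
  by move=> t0 D; apply: sub_gen_smallest => /=; exists i, t, D.
have n0 : 0 <= n%:R + 2^-1 :> R by rewrite addr_ge0 ?invr_ge0.
have -> : batch W n i = fun w =>
    (arrivals W i 0 (n%:R + 2^-1 + 1) w - arrivals W i 0 (n%:R + 2^-1) w)%N.
  apply/funext => w; rewrite (arrivals_split HW i w (lexx 0) n0) ?lerDl//.
  by rewrite addKn.
by apply: (adapted2 sA) => //; apply: aA => //; rewrite addr_ge0.
Qed.

Lemma past_arrivals t t' : 0 <= t -> t < t' ->
  past W seed coin Z t `<=` <<s arrival_history W t' `|` others src (Arrivals N) >>.
Proof.
move=> t0 tt' E hE; have -> : E = \bigcup_m (E `&` mark Z t @^-1` [set m]).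
  by apply/seteqP; split=> [w Ew|w [m _ []]//]; exists (mark Z t w).
apply: (sigma_algebra_countable_bigcup (smallest_sigma_algebra _ _)) => // m.
by apply: (revealed_arrivals HW (coin := coin) tt'); exact: hE.
Qed.

(** The past at [n] lies in the arrival history at [n + 1/2] joined with the other sources, and
    [sigma_join_cdom] shows that the join preserves the rate bound. *)
Lemma cdom_batch : exists n0, forall n i, (n0 <= n)%N ->
  cdom P (past W seed coin Z n%:R) (fun w => (batch W n i w)%:R) (alpha N i 0).
Proof.
have [t0 hrate] := arrivals_rate HW.
exists (Num.truncn t0).+1 => n i hn.
have n0 : 0 <= n%:R + 2^-1 :> R by rewrite addr_ge0 ?invr_ge0.
have tn : t0 <= n%:R + 2^-1.
  apply: le_trans (ltW (truncnS_gt t0)) _; apply: (@le_trans _ _ n%:R).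
    by rewrite ler_nat.
  by rewrite lerDl invr_ge0.
have [Y [Ymeas Yint Yeq] Yle] := hrate i _ n0 tn.
have hF := sigma_join_cdom (src_measurable HW seedM coinM)
  (srcI (coin := coin) seed_sigma) (srcT W coin seed_sigma) indep
  (src_sigma_algebra W coin seed_sigma (Arrivals N))
  (smallest_sigma_algebra _ _ : sigma_algebra setT (arrival_history W (n%:R + 2^-1)))
  (history_src coin seed_sigma (t:=_)) (L2_L1 (L2_batch HW n i)) Yint _ Ymeas _ Yle.
move=> E hE; apply: hF.
- move=> D _; exact: (batch_src n i ((fun k : nat => k%:R : R) @^-1` D)).
- exact: Yeq.
- by apply: past_arrivals hE; rewrite ?ltrDl ?invr_gt0.
Qed.

Lemma batch_sqr_bounded : arrivals_sqr_limsup P W -> exists (Ca : R) n0,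
  forall n i, (n0 <= n)%N -> \int[P]_w ((batch W n i w)%:R ^+ 2) <= Ca.
Proof.
move=> [Ca [t0 h]]; exists Ca, (Num.truncn t0).+1 => n i hn.
have n0 : 0 <= n%:R + 2^-1 :> R by rewrite addr_ge0 ?invr_ge0.
have tn : t0 <= n%:R + 2^-1.
  apply: le_trans (ltW (truncnS_gt t0)) _; apply: (@le_trans _ _ n%:R).
    by rewrite ler_nat.
  by rewrite lerDl invr_ge0.
rewrite -lee_fin EFin_EE; last by case: (L2_batch HW n i).
exact: h.
Qed.

End Batches.

(** * Stability *)

Section UpperBounds.
Import HBNNSimple.
Local Open Scope ereal_scope.

(* Unlike the library's monotonicity lemmas, this one does not ask that the
   smaller function be measurable. *)
Lemma ae_le_integral_ge0r (d : measure_display) (T : measurableType d) (R : realType)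
    (mu : {measure set T -> \bar R}) (D : set T) (f g : T -> \bar R) :
  measurable D -> (forall x, D x -> 0 <= g x) -> measurable_fun D g ->
  {ae mu, forall x, D x -> f x <= g x} ->
  \int[mu]_(x in D) f x <= \int[mu]_(x in D) g x.
Proof.
move=> mD g0 mg fg.
apply: (@le_trans _ _ (\int[mu]_(x in D) f^\+ x)).
  rewrite integralE -[leRHS]adde0 leeD2l// oppe_le0.
  by apply: integral_ge0 => x _; rewrite funenegE le_max lexx orbT.
rewrite ge0_integralE; last by move=> x _; rewrite funeposE le_max lexx orbT.
apply: ge_ereal_sup => _ [h hf <-].
have -> : sintegral mu h = \int[mu]_x (h x)%:E by rewrite integral_nnsfun// patch_setT.
rewrite [leRHS]integral_mkcond.
apply: ae_ge0_le_integral.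
- by [].
- by move=> x _; rewrite lee_fin; exact: fun_ge0.
- by apply/measurable_EFinP; exact: measurable_funP.
- by move=> x _; exact: erestrict_ge0.
- exact/(measurable_restrictT g mD).
apply: filterS fg => x fgx _; apply: le_trans (hf x) _.
rewrite !patchE; case: ifPn => //; rewrite inE => Dx.
by rewrite funeposE ge_max fgx//= g0.
Qed.

Lemma time_average_bounded (R : realType) (e : nat -> R) (f : R -> \bar R) :
  (forall n, (0 <= e n)%R) -> avg_bounded e ->
  (forall n s, (n%:R <= s < n.+1%:R)%R -> f s <= (e n)%:E) ->
  limf_esup (fun t : R => (t^-1)%:E * \int[lebesgue_measure]_(s in `[0%R, t]) f s)
    (pinfty_nbhs R) < +oo.
Proof.
move=> e0 [K hK] fe.
have K0 : (0 <= K)%R by have := hK 0%N; rewrite big_ord0 add0r mulr1.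
(* One neighbourhood of infinity bounds the limit superior. For [t > 1] the slots up to [M <= t + 1]
   cover [[0, t]], and [M + 1 <= t + 2 <= 3 t]. *)
rewrite limf_esupE; apply: (@le_lt_trans _ _ (3 * K)%:E); last exact: ltry.
apply: ge_ereal_inf; exists (ereal_sup [set (t^-1)%:E *
    \int[lebesgue_measure]_(s in `[0%R, t]) f s | t in [set t : R | (1 < t)%R]]).
  by exists [set t : R | (1 < t)%R] => //; exists 1%R; split.
apply: ge_ereal_sup => _ [t /= t1 <-].
have t0 : (0 < t)%R by exact: lt_trans t1.
pose M := (Num.truncn t).+1.
have tM : (t < M%:R)%R by exact: truncnS_gt.
have Mt : (M%:R <= t + 1)%R.
  by rewrite -natr1 lerD2r truncn_le ltW.
pose A n : set R := [set s | (n%:R <= s < n.+1%:R)%R].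
have AE n : A n = `[n%:R, n.+1%:R[%classic.
  by apply/seteqP; split=> s /=; rewrite in_itv.
have mA n : measurable (A n) by rewrite AE; exact: measurable_itv.
(* A step function above [f], measurable whatever [f] is. *)
pose g (s : R) : \bar R := \sum_(n < M) (e n * \1_(A n) s)%:E.
have mg n : measurable_fun `[0%R, t] (fun s => (e n * \1_(A n) s)%:E : \bar R).
  by apply/measurable_EFinP; apply: measurable_funM => //; exact: measurable_indic.
have mi n : measurable_fun `[0%R, t] (fun s => (\1_(A n) s)%:E : \bar R).
  by apply/measurable_EFinP; exact: measurable_indic.
have g0 n (s : R) : 0 <= (e n * \1_(A n) s)%:E by rewrite lee_fin mulr_ge0.
have hle : \int[lebesgue_measure]_(s in `[0%R, t]) f s <= (\sum_(n < M) e n)%:E.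
  apply: (@le_trans _ _ (\int[lebesgue_measure]_(s in `[0%R, t]) g s)).
    apply: ae_le_integral_ge0r => //.
    - by move=> s _; apply: sume_ge0 => n _; exact: g0.
    - by apply: emeasurable_sum => n; exact: mg.
    apply/aeW => s /=; rewrite in_itv/= => /andP[s0 st].
    have sM : (Num.truncn s < M)%N by rewrite ltnS le_truncn.
    have sA : A (Num.truncn s) s by rewrite /A/= truncn_le s0 truncnS_gt.
    apply: le_trans (fe _ _ sA) _.
    rewrite /g (bigD1 (Ordinal sM))//= indicE mem_set// mulr1 leeDl//.
    by apply: sume_ge0 => n _; exact: g0.
  rewrite /g ge0_integral_sum//; last by move=> n; exact: mg.
  rewrite -sumEFin; apply: lee_sum => n _.
  under eq_integral do rewrite EFinM.
  rewrite ge0_integralZl_EFin//; last first.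
    exact: mi.
  have -> : \int[lebesgue_measure]_(s in `[0%R, t]) (\1_(A n) s)%:E =
      lebesgue_measure (A n `&` `[0%R, t]) :> \bar R.
    by rewrite integral_indic//; exact: mA.
  apply: (@le_trans _ _ ((e n)%:E * 1)); last by rewrite mule1.
  apply: lee_wpmul2l; first by rewrite lee_fin.
  apply: (@le_trans _ _ (lebesgue_measure (A n))).
    apply: le_measure; rewrite ?inE; [apply: measurableI => //; exact: mA|exact: mA|].
    exact: subIsetl.
  by rewrite AE lebesgue_measure_itv/= lte_fin ltr_nat ltnSn -EFinB -natr1 addrAC subrr add0r.
apply: (@le_trans _ _ ((t^-1)%:E * (\sum_(n < M) e n)%:E)).
  by rewrite lee_wpmul2l// lee_fin invr_ge0 ltW.
rewrite -EFinM lee_fin ler_pdivrMl//.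
have h1 := hK M.
have h2 : (K * (M%:R + 1) <= K * (3 * t))%R by rewrite ler_wpM2l//; lra.
by apply: (le_trans h1); apply: (le_trans h2); rewrite mulrA mulrC [(K * 3)%R]mulrC.
Qed.

End UpperBounds.

(** * The drift model realized by a policy process *)

Section Process.
Context (R : realType) (N : network R) (d : measure_display) (Om : measurableType d).
Variables (P : probability Om R) (W : primitives N Om).
Hypothesis HN : network_ok N.
Hypothesis HW : primitives_ok P W.
Hypothesis Hsync : synchronized P W.
Variable act : 'I_(nbuf N) -> 'I_(nact N).
Hypothesis HB1 : forall i, buffer_acts i = [set act i]%SET.
Hypothesis Hsqr : arrivals_sqr_limsup P W.
Local Notation B := 'I_(nbuf N).
Local Notation H := 'I_(ncomp N).
Local Notation comp := (@Defs.comp R N).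
Local Notation route := (@Defs.route R N d Om W).
Local Notation serv := (@Defs.serv R N d Om W).
Variables (p : policy R) (x : state N).
Variables (seed : set (set Om)) (coin : H -> nat -> Om -> bool) (Z : R -> Om -> config N).
Hypothesis seed_sigma : sigma_algebra setT seed.
Hypothesis seedM : seed `<=` measurable.
Hypothesis coinM : forall h n, measurable [set w | coin h n w].
Hypothesis hlaw : coin_law P p coin.
Hypothesis indep : sources_independent P W seed coin.
Hypothesis nonant : non_anticipating W seed coin Z.
Hypothesis hev : {ae P, forall w, Z 0 w = initial_config x /\
  evolves (fun j n => route j n w)
    (policy_run p (fun j n => serv j n w) (fun h n => coin h n w))
    (fun i t => arr W i t w) (Z ^~ w)}.
Hypothesis h01 : forall n : nat, {ae P, forall w, forall i c j,
  V (st (Z n%:R w)) i c j = 0 \/ V (st (Z n%:R w)) i c j = 1}.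
Hypothesis hfin : (state_norm x < +oo)%E.

Let beta1 (j : 'I_(nact N)) : beta j = 1 :> R. Proof. by case: Hsync. Qed.

(** A single event of probability 1 on which the pathwise lemmas apply to all slots at once. *)
Definition good_path w : Prop :=
  [/\ Z 0 w = initial_config x,
   forall n, V01 (Z n%:R w),
   forall n, in_state_space (st (Z n%:R w)) /\ admissible (st (Z n%:R w)),
   forall n, jump (fun j k => route j k w)
     (policy_run p (fun j n => serv j n w) (fun h n => coin h n w))
     (fun i => batch W n i w) (Z n%:R w) 1 (Z n.+1%:R w) &
   forall n u, n%:R <= u < n.+1%:R -> Z u w = flow (u - n%:R) (Z n%:R w)].

Lemma good_path_ae : {ae P, forall w, good_path w}.
Proof.
have h01' := ae_foralln h01.
have h2 : {ae P, forall w, (forall i n t, n%:R < t < n.+1%:R -> arr W i t w = 0%N) /\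
    (forall i n, batch W n i w = arr W i n.+1%:R w)}.
  have := arrivals_at_integers HW Hsync; have := batchE HW Hsync.
  by apply: filterS2 => w h1 h2.
move: hev h01' h2; apply: filterS3 => w [Z0 ev] v01 [ar bE].
have slot n := evolves_slot beta1 (n := n) ev (v01 n) (fun i => ar i n).
split => //.
- by move=> n; case: ev => h _ _; apply: h.
- move=> n; have -> : (fun i => batch W n i w) = (fun i => arr W i n.+1%:R w).
    by apply/funext => i.
  by case: (slot n).
- by move=> n; case: (slot n).
Qed.

(** One good path is enough to learn deterministic facts about the initial state, such as its
    admissibility, which are imposed along paths only. *)
Lemma good_path_exists : exists w, good_path w.
Proof.
apply: contrapT => hno; have [E [mE E0 sub]] := good_path_ae.
have ET : E = setT.
  by apply/seteqP; split=> // w _; apply: sub => gw; apply: hno; exists w.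
by move: E0; rewrite ET probability_setT => /eqP; rewrite onee_eq0.
Qed.

Lemma admissible_initial : admissible x.
Proof.
have [w [Z0 _ h _ _]] := good_path_exists.
by have [_] := h 0%N; rewrite mulr0n Z0.
Qed.

(** Each occupied index contributes at least 1 to the series, so a finite sum leaves only finitely
    many of them. *)
Lemma queue_eventually0 (q : nat -> nat) : (\sum_(0 <= c <oo) ((q c)%:R : R)%:E < +oo)%E ->
  exists m, forall c, (m <= c)%N -> q c = 0%N.
Proof.
move=> qfin; apply: contrapT => hno.
have inf m : exists2 c, (m <= c)%N & (0 < q c)%N.
  apply: contrapT => h; apply: hno; exists m => c mc.
  by apply/eqP; rewrite -leqn0 leqNgt; apply/negP => qc; apply: h; exists c.
have big k : exists m, (k%:R <= \sum_(0 <= c < m) (q c)%:R :> R).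
  elim: k => [|k [m IH]]; first by exists 0%N; rewrite big_geq.
  have [c mc qc] := inf m; exists c.+1.
  rewrite (big_cat_nat _ (n := m))//= ?(leq_trans mc)// -natr1 lerD//.
  rewrite big_nat_recr//= -[leLHS]add0r lerD ?ler1n//; exact: sumr_ge0.
have [k hk] : exists k : nat, (\sum_(0 <= c <oo) ((q c)%:R : R)%:E < k%:R%:E)%E.
  exists (Num.truncn (fine (\sum_(0 <= c <oo) ((q c)%:R : R)%:E))).+1.
  rewrite -[ltLHS]fineK ?lte_fin ?truncnS_gt//.
  by rewrite ge0_fin_numE//; apply: nneseries_ge0 => c _ _; rewrite lee_fin.
have [m hm] := big k; move: hk; rewrite ltNge => /negP; apply.
apply: (@le_trans _ _ (\sum_(0 <= c < m) ((q c)%:R : R)%:E)%E).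
  by rewrite sumEFin lee_fin.
by apply: nneseries_lim_ge => c _ _; rewrite lee_fin.
Qed.

Lemma initial_counter_bound :
  exists cI, forall i c, (cI <= c)%N -> jobs act x i c = 0%N.
Proof.
have [own uni _] := admissible_initial.
have V0 i c j : 0 <= V x i c j.
  have [w [Z0 _ h _ _]] := good_path_exists.
  by have [[hv _] _] := h 0%N; have := hv i c j; rewrite mulr0n Z0.
suff /choice[m hm] : forall i, exists m, forall c, (m <= c)%N -> jobs act x i c = 0%N.
  exists (\max_i m i)%N => i c hc; apply: (hm i); apply: leq_trans hc.
  exact: leq_bigmax.
move=> i.
have [|m1 h1] := @queue_eventually0 (Q x i).
  apply: le_lt_trans hfin; rewrite /state_norm (bigD1 i)//= -addeA leeDl//.
  apply: adde_ge0; first by apply: sume_ge0 => l _; apply: nneseries_ge0 => c _ _; rewrite lee_fin.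
  by do 2! (apply: sume_ge0 => ? _); apply: nneseries_ge0 => c _ _; rewrite lee_fin.
have [[c0 hc0]|hn] := pselect (exists c, in_service act x i c).
  exists (maxn m1 c0.+1) => c; rewrite geq_max => /andP[mc c0c].
  rewrite /jobs h1//; case E : in_service => //.
  by have [e] := uni _ _ _ _ _ hc0 E; rewrite e ltnn in c0c.
by exists m1 => c mc; rewrite /jobs h1//; case E : in_service => //; exfalso; apply: hn; exists c.
Qed.

Definition jobs_at n i c w := jobs act (st (Z n%:R w)) i c.
Definition served_at n i c w := nat_of_bool (in_service act (st (Z n%:R w)) i c).
Definition routed_to n i l w := nat_of_bool (next_dest W Z n%:R (act i) w == Some l).
Definition coin_at n i w := coin_outcome (fun h k => coin h k w) p (comp i) (Z n%:R w).
Definition past_at n := past W seed coin Z n%:R.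
(** Under LRFS the outcome is constantly false, and the coin bounds with probability 0 hold for the
    full sigma-algebra. *)
Definition before_coin_at n i : set (set Om) :=
  if p is EpsLRFS _ then null_ext P (before_coin W seed coin Z (comp i) n%:R)
  else measurable.
Definition coin_prob : R := if p is EpsLRFS eps then eps else 0.

Let n0 n : 0 <= n%:R :> R. Proof. by []. Qed.

Lemma sigma_past n : sigma_algebra setT (past_at n).
Proof. by apply: past_sigma_algebra. Qed.

Lemma past_at_measurable n : past_at n `<=` measurable.
Proof. exact: (past_measurable HW seed_sigma seedM coinM). Qed.

Lemma adapted_served n i c : adapted (past_at n) (served_at n i c).
Proof.
apply: (@adapted_comp _ _ (past_at n) _ _ nat_of_bool); exact: (adapted_V_pos nonant (n0 n)).
Qed.

Lemma adapted_jobs n i c : adapted (past_at n) (jobs_at n i c).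
Proof.
apply: (adapted2 (sigma_past n)) => //; last exact: adapted_served.
exact: (adapted_Q nonant (n0 n)).
Qed.

Lemma measurable_routed n i l : measurable_fun setT (fun w => (routed_to n i l w)%:R : R).
Proof.
apply: adapted_measurable.
have mN o := next_dest_measurable HW seed_sigma seedM coinM nonant (n0 n) (act i) o.
have aN : adapted measurable (next_dest W Z n%:R (act i)).
  by apply: (adapted_points (sigma_algebra_measurable _)) => // o; exact: mN.
exact: (@adapted_comp _ _ _ _ _ (fun o => nat_of_bool (o == Some l)) _ aN).
Qed.

Lemma jobs_at_step n : {ae P, forall w, forall i c,
  (jobs_at n.+1 i c w + served_at n i c w = jobs_at n i c w +
   (if c is c'.+1 then \sum_l served_at n l c' w * routed_to n l i w
    else batch W n i w))%N}.
Proof.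
apply: filterS good_path_ae => w [Z0 v01 sa ju _] i c.
have [h _] := jump_jobs HN beta1 HB1 (fun j k => serv_gt0 HW j k w)
  (v01 n) (sa n).2 (sa n).1 (ju n).
by rewrite /jobs_at /served_at h.
Qed.

(** The balance equation determines the jobs at [n.+1] from the past, the batch and the
    destinations; the coin does not appear in it. *)
Lemma adapted_jobs_before_coin n h l c :
  adapted (null_ext P (before_coin W seed coin Z h n%:R)) (jobs_at n.+1 l c).
Proof.
have sG := before_coin_sigma_algebra HW (coin := coin) seed_sigma nonant (n0 n) h.
have past_sub (T : Type) (f : Om -> T) : adapted (past_at n) f ->
    adapted (before_coin W seed coin Z h n%:R) f.
  by move=> af D; apply: (past_before_coin HW seed_sigma); exact: af.
have aroute i : adapted (before_coin W seed coin Z h n%:R) (routed_to n i l).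
  apply: (@adapted_comp _ _ _ _ _ (fun o => nat_of_bool (o == Some l))).
  exact: (before_coin_next_dest HW seed_sigma nonant (n0 n)).
apply: (@adapted_null_ext _ _ _ _ _ _ (fun w => jobs_at n l c w - served_at n l c w +
   (if c is c'.+1 then \sum_i served_at n i c' w * routed_to n i l w
    else batch W n l w))%N).
- apply: (adapted2 sG) => //.
    apply: (adapted2 sG) => //; apply: past_sub; first exact: adapted_jobs.
    exact: adapted_served.
  case: c => [|c].
    apply: (before_coin_arrivals HW seed_sigma nonant (n0 n)).
    exact: (batch_src HW).
  apply: (adapted_sum sG) => i _; apply: (adapted2 sG) => //.
  by apply: past_sub; exact: adapted_served.
- by move=> D; apply: past_at_measurable; exact: adapted_jobs.
apply: filterS (jobs_at_step n) => w /(_ l c) jw.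
(* The truncated subtraction is exact, since jobs in service are among the jobs present. *)
by rewrite -[LHS](addnK (served_at n l c w)) jw -addnBAC// leq_addl.
Qed.

Hypothesis coin_prob0 : 0 <= coin_prob.

Lemma before_coin_at_sigma_algebra n i : sigma_algebra setT (before_coin_at n i).
Proof.
rewrite /before_coin_at; case: p; first exact: sigma_algebra_measurable.
by move=> _; apply: null_ext_sigma_algebra; apply: (before_coin_sigma_algebra HW).
Qed.

Lemma before_coin_at_measurable n i : before_coin_at n i `<=` measurable.
Proof. by rewrite /before_coin_at; case: p => // _ E []. Qed.

Lemma before_coin_at_jobs n i l c : adapted (before_coin_at n i) (jobs_at n.+1 l c).
Proof.
rewrite /before_coin_at; case: p => [|_]; last exact: adapted_jobs_before_coin.
by move=> D; apply: past_at_measurable; exact: adapted_jobs.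
Qed.

Lemma measurable_coin_at n i : measurable_fun setT (fun w => (coin_at n i w)%:R : R).
Proof.
rewrite /coin_at /coin_outcome; case: p => [|_]; first exact: measurable_cst.
apply: (@adapted_measurable _ _ _
  (fun w => nat_of_bool (coin (comp i) (trials (Z n%:R w) (comp i)) w))).
apply: (@adapted_comp _ _ _ _ _ nat_of_bool).
apply: (adapted_points (sigma_algebra_measurable _)) => // b.
exact: (next_coin_measurable HW seed_sigma seedM coinM nonant (n0 n)).
Qed.

Lemma cdom_coin_at n i :
  cdom P (before_coin_at n i) (fun w => (coin_at n i w)%:R) coin_prob /\
  cdom P (before_coin_at n i) (fun w => 1 - (coin_at n i w)%:R) (1 - coin_prob).
Proof.
have := measurable_coin_at n i; move: hlaw coin_prob0.
rewrite /coin_prob /before_coin_at /coin_at /coin_outcome; case: p => [|eps] hp eps0 mc.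
  split=> E mE; first by rewrite integral0_eq// mul0e.
  by under eq_integral do rewrite subr0; rewrite subr0 integral_cst.
have [h1 h2] := cdom_next_coin HW seed_sigma seedM coinM indep nonant (n0 n) eps0 (hp (comp i)).
have bm := before_coin_measurable HW seedM coinM (Z := Z) (t := n%:R) (h := comp i).
split; apply: cdom_null_ext => //.
  by apply: measurable_funB => //; exact: measurable_cst.
by move=> w; rewrite subr_ge0 lern1 leq_b1.
Qed.

Section Counters.
Variable cI : nat.
Hypothesis hcI : forall i c, (cI <= c)%N -> jobs act x i c = 0%N.

Lemma jobs_at_eq0 n : {ae P, forall w, forall i c,
  (cI + n <= c)%N -> jobs_at n i c w = 0%N}.
Proof.
apply: filterS good_path_ae => w [Z0 v01 sa ju _] i c hc.
apply: (jobs_counter_bound HN beta1 HB1 (fun j k => serv_gt0 HW j k w)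
  v01 (fun n => (sa n).2) (fun n => (sa n).1) ju _ i hc).
by rewrite mulr0n Z0.
Qed.

Lemma served_le_jobs n : {ae P, forall w, forall i c, (served_at n i c w <= jobs_at n i c w)%N}.
Proof. by apply/aeW => w i c; rewrite leq_addl. Qed.

Lemma served_at_le1 n : {ae P, forall w, forall i,
  (\sum_(c < cI + n) served_at n i c w <= 1)%N}.
Proof.
apply: filterS good_path_ae => w [_ _ sa _ _] i.
by apply: in_service_le1; case: (sa n).
Qed.

Lemma routed_to_le1 n : {ae P, forall w, forall i, (\sum_l routed_to n i l w <= 1)%N}.
Proof.
apply/aeW => w i; rewrite /routed_to; case: next_dest => [l|]; last by rewrite big1.
rewrite (bigD1 l)//= eqxx big1// => l' ll'.
by apply/eqP; rewrite eqb0; apply: contra ll' => /eqP[->].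
Qed.

Lemma L2_jobs0 i c : L2 P (fun w => (jobs_at 0 i c w)%:R).
Proof.
apply: (L2_dom _ (L2_cst P (jobs act x i c)%:R)).
  by apply: adapted_measurable => D; apply: (@past_at_measurable 0); exact: adapted_jobs.
apply: filterS good_path_ae => w [Z0 _ _ _ _].
by rewrite ger0_norm// /jobs_at mulr0n Z0.
Qed.

Lemma cdom_routed n i l :
  cdom P (past_at n) (fun w => (routed_to n i l w)%:R) (routing N i l).
Proof.
rewrite -[X in routing N X l](buf_act HB1).
apply: (cdom_next_dest HW seed_sigma seedM coinM indep nonant (n0 n)).
exact: routing_ge0 HN _ _.
Qed.

Lemma frozen_or_served_at n : {ae P, forall w, forall i,
  (forall c, (jobs_at n.+1 i c w <= Q x i c)%N) \/
  (forall c, (0 < jobs_at n.+1 i c w)%N ->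
     if coin_at n i w then exists l c', (c <= c')%N /\ (0 < served_at n.+1 l c' w)%N
     else exists l c' k, [/\ (c' <= c)%N, k \in procs (act l), k \in procs (act i) &
                             (0 < served_at n.+1 l c' w)%N])}.
Proof.
apply: filterS good_path_ae => w [Z0 v01 sa ju _] i.
have := frozen_or_served HN beta1 HB1 (fun j k => serv_gt0 HW j k w)
  v01 (fun n => (sa n).2) (fun n => (sa n).1) ju n i.
rewrite mulr0n Z0 => -[h|h]; [by left|right=> c /h].
rewrite /served -/(coin_at n i w); case: coin_at.
  by move=> [l [c' [h1 _ h2]]]; exists l, c'; rewrite /served_at h2.
by move=> [l [c' [k [h1 h2 h3 h4]]]]; exists l, c', k; rewrite /served_at h4.
Qed.

Lemma initial_mass : exists x0, forall i m, (\sum_(c < m) Q x i c <= x0)%N.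
Proof.
exists (\sum_i \sum_(c < cI) Q x i c)%N => i m.
apply: (@leq_trans (\sum_(c < cI) Q x i c)); last by rewrite (bigD1 i)//= leq_addr.
rewrite -!(big_mkord xpredT (Q x i)).
have [mc|cm] := leqP m cI; first by rewrite [leqRHS](big_cat_nat _ (n := m))//= leq_addr.
rewrite [leqLHS](big_cat_nat _ (n := cI))//= ?(ltnW cm)// -[leqRHS]addn0 leq_add2l big_nat big1//.
by move=> c /andP[cc _]; have := hcI i cc; rewrite /jobs; case: (Q x i c).
Qed.

Definition proc_rate k : R := \sum_(l | k \in procs (act l)) eff_rate l.

Hypothesis slack : exists2 del, 0 < del &
  forall i, \sum_(k in procs (act i)) proc_rate k + coin_prob <= 1 - del.

Lemma proc_rate_ge0 k : 0 <= proc_rate k.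
Proof.
apply: sumr_ge0 => l _.
have al0 i : 0 <= alpha N i 0 by exact: ltW (alpha_gt0 HN i).
have := flow_rate_ge (routing_ge0 HN) (routing_cvg HN) al0 0 l.
by rewrite big_ord0.
Qed.

Lemma avg_bounded_jobs : 0 < coin_prob \/ bounded_routes N ->
  avg_bounded (fun n => \int[P]_w (total_jobs cI jobs_at n w)%:R).
Proof.
move=> hor; have [x0 hx0] := initial_mass; have [del del0 hdel] := slack.
(* Without buffers the slack says nothing about [coin_prob], but then there are no jobs. *)
have [i0 _|noB] := pickP (xpredT : pred B); last first.
  apply: (@eq_avg_bounded _ (fun=> 0)); last exact: avg_bounded_cst.
  move=> n; rewrite (_ : (fun w => _) = fun=> 0) ?EE_cst//.
  by apply/funext => w; rewrite /total_jobs big1// => i; have := noB i.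
have coin_prob1 : coin_prob <= 1.
  have h := hdel i0; have : 0 <= \sum_(k in procs (act i0)) proc_rate k.
    by apply: sumr_ge0 => k _; exact: proc_rate_ge0.
  by move: h del0; lra.
have r0 := routing_ge0 HN; have r1 := routing_le1 HN; have rc := routing_cvg HN.
have al0 i : 0 <= alpha N i 0 by exact: ltW (alpha_gt0 HN i).
have [n1 hn1] := cdom_batch HW seed_sigma seedM coinM indep Z.
have [Ca [n2 hn2]] := batch_sqr_bounded HW Hsqr.
have arr n i : (maxn n1 n2 <= n)%N ->
    cdom P (past_at n) (fun w => (batch W n i w)%:R) (alpha N i 0).
  by rewrite geq_max => /andP[h _]; exact: hn1.
have aCa n i : (maxn n1 n2 <= n)%N -> \int[P]_w ((batch W n i w)%:R ^+ 2) <= Ca.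
  by rewrite geq_max => /andP[_ h]; exact: hn2.
have low c : avg_bounded (fun n => \int[P]_w (\sum_i (lo cI jobs_at n i c w)%:R)).
  apply: (avg_bounded_low r0 al0 sigma_past past_at_measurable
    adapted_jobs adapted_served measurable_routed L2_jobs0 jobs_at_step jobs_at_eq0
    served_le_jobs served_at_le1 routed_to_le1 (L2_batch HW) cdom_routed arr aCa coin_prob0
    before_coin_at_sigma_algebra before_coin_at_measurable before_coin_at_jobs
    measurable_coin_at (fun n i => (cdom_coin_at n i).1) hx0 frozen_or_served_at
    (g := fun b k => low_visits (routing N) (fun l => k \in procs (act l)) b)
    (kap := fun b => b.+1%:R) del0 hdel).
  - by move=> b k i c'; exact: low_visits_bound.
  - by move=> b k i c'; exact: low_visits_rec.
  - move=> b k i c' bc; rewrite /routed_potential big1// => l _.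
    by rewrite low_visits_eq0 ?mulr0.
  - by move=> b k; exact: low_visits_load.
case: hor => [eps0|[d' hd]].
  (* The high-level drift requires that [2 * (number of buffers + 1)] times the gain be at most
     [coin_prob]. *)
  have [c0 hc0] : exists c0, \sum_i alpha N i 0 * high_visits (routing N) c0 i 0 <=
      coin_prob / (2 * #|{: B}|.+1%:R).
    by apply: high_visits_small => //; rewrite divr_gt0// mulr_gt0.
  apply: (avg_bounded_total r0 al0 sigma_past past_at_measurable
    adapted_jobs adapted_served measurable_routed L2_jobs0 jobs_at_step jobs_at_eq0
    served_le_jobs served_at_le1 routed_to_le1 (L2_batch HW) cdom_routed arr aCa
    coin_prob0 coin_prob1
    before_coin_at_sigma_algebra before_coin_at_measurable before_coin_at_jobs
    measurable_coin_at (fun n i => (cdom_coin_at n i).2) hx0 frozen_or_served_at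
    (c0 := c0) (g := high_visits (routing N) c0)
    (kap := \sum_l total_visits (routing N) l)) => //.
  - by move=> i c; exact: high_visits_bound.
  - by move=> i c; exact: high_visits_ge.
  - by move=> i c; exact: high_visits_rec.
  by rewrite mulrC -ler_pdivlMr// mulr_gt0.
(* Initial jobs have counter indices below [cI] and are routed at most [d'] times, so none of them
   reaches [cI + d'], nor does any new job. *)
apply: (avg_bounded_total_bounded_routes r0 al0 sigma_past past_at_measurable
    adapted_jobs adapted_served measurable_routed L2_jobs0 jobs_at_step jobs_at_eq0
    served_le_jobs served_at_le1 routed_to_le1 (L2_batch HW) cdom_routed arr (c0 := (cI + d')%N)
  (g := high_visits (routing N) (cI + d')%N)) => //.
- by move=> i c; case/andP: (high_visits_bound r0 r1 rc (cI + d')%N i c).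
- by move=> i c; exact: high_visits_ge.
- by move=> i c; exact: high_visits_rec.
- by move=> i; apply: high_visits_eq0 hd _; rewrite subn0 leq_addl.
- by move=> i c ccI; apply: high_visits_eq0 hd _; lia.
Qed.

Lemma norm_le_jobs n s : n%:R <= s < n.+1%:R ->
  (\int[P]_w state_norm (st (Z s w)) <= (\int[P]_w (total_jobs cI jobs_at n w)%:R)%:E)%E.
Proof.
move=> ns.
have tL : L1 P (fun w => (total_jobs cI jobs_at n w)%:R).
  exact: (L1_total past_at_measurable adapted_jobs L2_jobs0 jobs_at_step jobs_at_eq0
    served_le_jobs served_at_le1 routed_to_le1 (L2_batch HW)).
rewrite EFin_EE//; apply: ae_le_integral_ge0r => //; first exact: measurable_int tL.
have := jobs_at_eq0 n; have := good_path_ae; apply: filterS2 => w [Z0 v01 sa ju fl] j0 _.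
rewrite (fl n s ns).
apply: (state_norm_flow beta1 HB1 (m := (cI + n)%N)) => //.
- by have [] := sa n.
- by rewrite subr_ge0; case/andP: ns.
Qed.

Lemma process_stable : 0 < coin_prob \/ bounded_routes N ->
  (limf_esup (fun t : R =>
     (t^-1)%:E * \int[lebesgue_measure]_(s in `[0%R, t])
                   \int[P]_w state_norm (st (Z s w))) (pinfty_nbhs R) < +oo)%E.
Proof.
move=> hor; apply: (@time_average_bounded _ (fun n => \int[P]_w (total_jobs cI jobs_at n w)%:R)).
- by move=> n; exact: EE_ge0.
- exact: avg_bounded_jobs.
- exact: norm_le_jobs.
Qed.

End Counters.
End Process.

(** The minimum starts from 1, which keeps it positive when there is no index. *)
Lemma uniform_slack (R : realType) n (f : 'I_n -> R) : (forall i, f i < 1) ->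
  exists2 del, 0 < del & forall i, f i <= 1 - del.
Proof.
move=> f1; exists (\big[Num.min/1]_(i < n) (1 - f i)).
  by apply: lt_bigmin => // i _; rewrite subr_gt0.
by move=> i; rewrite lerBrDl -lerBrDr; exact: bigmin_le_cond.
Qed.

Lemma load_slack (R : realType) (N : network R) (act : 'I_(nbuf N) -> 'I_(nact N)) (eps : R) :
  network_ok N -> 0 <= eps ->
  (forall i k, k \in procs (act i) ->
     proc_rate act k + eps < 1 / (\max_(l < nbuf N) #|procs (act l)|)%:R) ->
  exists2 del, 0 < del &
    forall i, \sum_(k in procs (act i)) proc_rate act k + eps <= 1 - del.
Proof.
move=> HN eps0 h; apply: uniform_slack => i.
set M := (\max_(l < nbuf N) _)%N in h.
have [k0 k0i] : exists k, k \in procs (act i) by exact/set0Pn/(procs_neq0 HN).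
have KM : (#|procs (act i)| <= M)%N by exact: (@leq_bigmax _ (fun l => #|procs (act l)|)).
have K0 : (0 < #|procs (act i)|)%N by rewrite card_gt0 (procs_neq0 HN).
have M0 : 0 < M%:R :> R by rewrite ltr0n (leq_trans K0).
(* [eps] is charged once per processor of [i]; there is at least one, so this only enlarges the
   sum. *)
apply: (@le_lt_trans _ _ (\sum_(k in procs (act i)) (proc_rate act k + eps))).
  by rewrite big_split/= lerD2l sumr_const -mulr_natr ler_peMr// ler1n.
apply: (@lt_le_trans _ _ (\sum_(k in procs (act i)) (1 / M%:R))).
  by apply: ltr_sum => //; [apply/hasP; exists k0; rewrite ?mem_index_enum | move=> k; exact: h].
by rewrite sumr_const -[leLHS]mulr_natl mul1r ler_pdivrMr// mul1r ler_nat.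
Qed.

Theorem proposition5p2 (R : realType) (N : network R) (d : measure_display)
  (Om : measurableType d) (P : probability Om R) (W : primitives N Om)
  (HN : network_ok N) (HW : primitives_ok P W)
  (Hsync : synchronized P W)
  (act : 'I_(nbuf N) -> 'I_(nact N))
  (HB1 : forall i, buffer_acts i = [set act i]%SET)
  (Hsqr : arrivals_sqr_limsup P W) :
  let Ki i := procs (act i) in
  let maxK : R := (\max_(i < nbuf N) #|Ki i|)%:R in
  let rhok k : R := \sum_(i | k \in Ki i) load i in
  let mk k : R := \sum_(i | k \in Ki i) mean_service i in
  (forall k, rhok k < 1 / maxK) ->
  (forall eps : R, 0 < eps ->
     (* a processor used by no buffer has m^(k) = 0 and imposes no bound *)
     (eps%:E < \big[Order.min/+oo]_(k | mk k != 0%R)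
                 ((1 / maxK - rhok k) / mk k)%:E)%E ->
     queue_length_stable P (fun x X =>
       policy_process P W (EpsLRFS eps) x X /\ synchronized_process P X)) /\
  (bounded_routes N ->
     queue_length_stable P (fun x X =>
       policy_process P W (@LRFS R) x X /\ synchronized_process P X)).
Proof.
move=> Ki maxK rhok mk hrho.
have mean1 (i : 'I_(nbuf N)) : mean_service i = 1 by case: Hsync.
have rateE k : proc_rate act k = rhok k.
  by apply: eq_bigr => l _; rewrite /load mean1 mulr1.
have stable (p : policy R) : 0 <= coin_prob p ->
    (forall i k, k \in Ki i -> rhok k + coin_prob p < 1 / maxK) ->
    0 < coin_prob p \/ bounded_routes N ->
    queue_length_stable P (fun x X => policy_process P W p x X /\ synchronized_process P X).
  move=> eps0 hk hor x _ xfin X [[seed [coin [Z hX]]] h01].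
  move: hX h01 => [[seed_sigma seedM coinM] [law indep] nonant hev ->] h01.
  have [cI hcI] := initial_counter_bound HW Hsync act hev h01 xfin.
  apply: (process_stable HN HW Hsync HB1 Hsqr seed_sigma seedM coinM law indep nonant hev
    h01 xfin eps0 hcI _ hor).
  by apply: load_slack => // i k ki; rewrite rateE; exact: hk ki.
split=> [eps eps0 heps|hb].
  apply: (stable (EpsLRFS eps)); first exact: ltW; last by left.
  move=> i k ki.
  (* All mean service times are 1. From [eps * mk k < 1 / maxK - rhok k] and [mk k >= 1] follows
     [rhok k + eps < 1 / maxK], the form that [load_slack] uses. *)
  have mk1 : 1 <= mk k.
    rewrite /mk (bigD1 i)//= mean1 lerDl; apply: sumr_ge0 => l _.
    by rewrite mean1.
  have mk0 : 0 < mk k by exact: lt_le_trans mk1.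
  have : (eps%:E < ((1 / maxK - rhok k) / mk k)%:E)%E.
    by apply: (lt_le_trans heps); apply: bigmin_le_cond; exact: lt0r_neq0.
  rewrite lte_fin ltr_pdivlMr// => h.
  by rewrite addrC -ltrBrDr (le_lt_trans _ h)// ler_peMr// ltW.
apply: (stable (@LRFS R)) => //=; last by right.
by move=> i k _; rewrite addr0.
Qed.
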